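(* Let $0<\theta<\theta_0\le\infty$ and let $\mu\neq\delta_0$ be a probability measure on $[0,\infty)$ with finite mean $\langle\mu\rangle$. Let $\hat H_\theta^\infty=\frac1\theta\log D_\theta^\infty$, where $$D_\theta^\infty:=\lim_{n\to\infty}\frac1{m(\theta)^n}\sum_{|v|=n}e^{\theta S(v)}\quad\text{(almost sure limit)},$$ which is also the mean $1$ solution of the linear recursive distributional equation $\Delta\overset{d}{=}\sum_{|v|=1}e^{\theta S(v)-\nu(\theta)}\Delta_v$, where the $\Delta_v$ are independent copies of $\Delta$ (independent of the first generation $\{S(v)\}_{|v|=1}$). Then, as $n\to\infty$, $$R_n^*(\theta,\mu)-\frac{\nu(\theta)}{\theta}\,n-\hat H_\theta^\infty\ \Rightarrow\ \frac1\theta\left[\log\langle\mu\rangle-\log E\right],$$ where $E\sim$ Exponential(1) and $\Rightarrow$ denotes convergence in distribution.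
   Context: Branching random walk (BRW). Let $Z=\sum_{j=1}^N\delta_{\xi_j}$ be a point process on $\mathbb R$ with $N:=Z(\mathbb R)<\infty$ a.s. Start with one particle at $0$ in generation $0$. Each particle of generation $n-1$ independently produces offspring (generation $n$) whose displacements from the parent's position are the atoms of an independent copy of $Z$. For a particle $v$, $|v|$ is its generation and $S(v)$ its position. Let $m(\theta):=\mathbb E\left[\sum_{j=1}^N e^{\theta\xi_j}\right]$ and $\nu:=\log m$. Standing assumptions: (A1) there is $\vartheta>0$ with $m(\theta)<\infty$ for all $\theta\in(-\vartheta,\infty)$; (A2) $\mathbb P(N=1)<1$, $\mathbb P(Z(\{t\})=N)<1$ for every $t\in\mathbb R$, and $\mathbb P(N\ge1)=1$; (A3) $\mathbb E[N^{1+p}]<\infty$ for some $p>0$. $\theta_0:=\inf\{\theta>0:\nu(\theta)/\theta=\nu'(\theta)\}\in(0,\infty]$, with $\inf\emptyset=\infty$ (the set has at most one element). Under these assumptions, for $\theta<\theta_0$ the limit $D_\theta^\infty$ of the additive martingale is known to exist, to be strictly positive a.s., and to have mean $1$. Last progeny modified BRW. Given $\theta>0$ and $\mu$, for each $n\ge1$ let $\{Y_v\}_{|v|=n}$ be i.i.d. with law $\mu$ and $\{E_v\}_{|v|=n}$ i.i.d. Exponential(1), independent of each other and of the BRW $(S(u))$, all on the same probability space. With $\log 0=-\infty$, $$R_n^*(\theta,\mu):=\max_{|v|=n}\left\{S(v)+\tfrac1\theta\left(\log Y_v-\log E_v\right)\right\}.$$ *)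

(* Defs.v *)
From HB Require Import structures.
From mathcomp Require Import all_boot all_order all_algebra finmap.
From mathcomp Require Import all_classical all_reals all_analysis.

Set Implicit Arguments.
Unset Strict Implicit.
Unset Printing Implicit Defensive.
Import Order.TTheory GRing.Theory Num.Theory.
Import numFieldNormedType.Exports.

Local Open Scope classical_set_scope.
Local Open Scope ring_scope.

HB.instance Definition _ (T : choiceType) := isPointed.Build (seq T) [::].

(* A finite point process sum_(j < N) delta_(xi_j) is a random finite sequence
   [:: xi_0; ...; xi_(N-1)].  The sigma-algebra on finite sequences is the one
   generated by the boxes {N = n, xi_0 \in B_0, ..., xi_(n-1) \in B_(n-1)}. *)
Definition seq_boxes (R : realType) : set (set (seq R)) :=
  [set C | exists n (B : nat -> set R), (forall j, measurable (B j)) /\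
     C = [set s | size s = n /\ forall j, (j < n)%N -> B j (nth 0 s j)]].

Definition config (R : realType) := g_sigma_algebraType (@seq_boxes R).
HB.instance Definition _ (R : realType) :=
  Measurable.copy (config R) (g_sigma_algebraType (@seq_boxes R)).

Section Probability.
Context {d : measure_display} {T : measurableType d} {R : realType}.
Variable P : probability T R.

Definition mutually_independent (I : choiceType) (F : I -> set (set T)) :=
  forall (J : {fset I}) (A : I -> set T),
    (forall i, i \in J -> F i (A i)) ->
    P (\bigcap_(i in [set` J]) A i) = (\prod_(i <- J) P (A i))%E.

Definition has_law d' (T' : measurableType d') (X : T -> T')
    (mu : set T' -> \bar R) :=
  forall B, measurable B -> P (X @^-1` B) = mu B.

Definition same_law d' (T' : measurableType d') (X Y : T -> T') :=
  has_law X (pushforward P Y).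

Definition ecdf (X : T -> \bar R) (x : R) : \bar R :=
  P [set w | (X w <= x%:E)%E].

End Probability.

(* The variables may take the value -oo (or +oo) with positive probability;
   the limit is meant to be a.s. finite. *)
Definition cvg_in_distribution (R : realType)
    d (T : measurableType d) (P : probability T R) (X : nat -> T -> \bar R)
    d' (T' : measurableType d') (Q : probability T' R) (X0 : T' -> \bar R) :=
  forall x : R, {for x, continuous (ecdf Q X0)} ->
    ecdf P (X n) x @[n --> \oo] --> ecdf Q X0 x.

Section PointProcess.
Context {d : measure_display} {T : measurableType d} {R : realType}.
Variables (P : probability T R) (Z : T -> config R).

Definition moment (theta : R) : \bar R :=
  (\int[P]_w (\sum_(x <- (Z w : seq R)) expR (theta * x))%:E)%E.

Definition nu (theta : R) : R := ln (fine (moment theta)).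

Definition theta0 : \bar R :=
  ereal_inf [set theta%:E | theta in
    [set theta : R | 0 < theta /\ nu theta / theta = derive1 nu theta]].

Definition assumption_A1 :=
  exists2 vartheta : R, 0 < vartheta &
    forall theta : R, - vartheta < theta -> (moment theta < +oo)%E.

Definition assumption_A2 :=
  [/\ (P [set w | size (Z w) = 1%N] < 1)%E,
      forall t : R, (P [set w | count_mem t (Z w : seq R) = size (Z w)] < 1)%E
    & P [set w | (1 <= size (Z w))%N] = 1%E].

Definition assumption_A3 :=
  exists2 p : R, 0 < p &
    (\int[P]_w (((size (Z w))%:R : R) `^ (1 + p))%:E < +oo)%E.

(* Solving Delta =d \sum_j e^(theta xi_j - nu theta) Delta_j depends only on the
   law of Delta; the copies Delta_j are realised on T itself. *)
Definition solves_linear_RDE (theta : R) (Delta : T -> R) :=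
  exists Deltas : nat -> {RV P >-> R},
    [/\ forall j, same_law P (Deltas j) Delta,
        mutually_independent P (fun i : option nat =>
          if i is Some j then g_sigma_algebra_preimage (Deltas j)
          else g_sigma_algebra_preimage Z)
      & same_law P Delta (fun w => \sum_(j < size (Z w))
          expR (theta * nth 0 (Z w : seq R) j - nu theta) * Deltas j w)].

End PointProcess.

Section BranchingRandomWalk.
Context {d : measure_display} {T : measurableType d} {R : realType}.

(* Particles carry Ulam-Harris labels: the root is [::] and the children of u
   are rcons u 0, rcons u 1, ...  The displacements of the children of u are
   listed by Z u; labels that are never born carry an unused Z u. *)
Variable Z : seq nat -> T -> config R.

Fixpoint generation (n : nat) (w : T) : seq (seq nat) :=
  if n is k.+1 then
    flatten [seq [seq rcons u j | j <- iota 0 (size (Z u w))]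
            | u <- generation k w]
  else [:: [::]].

Definition position (v : seq nat) (w : T) : R :=
  \sum_(k < size v) nth 0 (Z (take k v) w : seq R) (nth 0%N v k).

Definition additive_martingale (P : probability T R) (theta : R)
    (n : nat) (w : T) : R :=
  (fine (moment P (Z [::]) theta) ^+ n)^-1 *
  \sum_(v <- generation n w) expR (theta * position v w).

Definition martingale_limit (P : probability T R) (theta : R) (w : T) : R :=
  limn (fun n => additive_martingale P theta n w).

Definition last_progeny_modified_max (theta : R) (Y E : seq nat -> T -> R)
    (n : nat) (w : T) : \bar R :=
  (\big[maxe/-oo]_(v <- generation n w)
     ((position v w)%:E
      + (theta^-1)%:E * (lne (Y v w)%:E - lne (E v w)%:E)))%E.

(* For a fixed n: the displacement lists of all labels, the Y_v with |v| = n
   and the E_v with |v| = n form one mutually independent family. *)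
Definition independent_generation (P : probability T R)
    (Y E : seq nat -> T -> R) (n : nat) :=
  mutually_independent P
    (fun i : (seq nat + n.-tuple nat + n.-tuple nat)%type =>
       match i with
       | inl (inl u) => g_sigma_algebra_preimage (Z u)
       | inl (inr v) => g_sigma_algebra_preimage (Y v)
       | inr v => g_sigma_algebra_preimage (E v)
       end).

End BranchingRandomWalk.

(* Main.v *)
Require Import Defs.
From HB Require Import structures.
From mathcomp Require Import all_boot all_order all_algebra finmap.
From mathcomp Require Import all_classical all_reals all_analysis.
From mathcomp Require Import measurable_realfun ring lra.
Import Order.TTheory GRing.Theory Num.Theory.
Import numFieldNormedType.Exports.
Local Open Scope classical_set_scope.
Local Open Scope ring_scope.
Set Implicit Arguments.
Unset Strict Implicit.
Unset Printing Implicit Defensive.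

(* Conditionally on the tree and the marks Y_v, the clocks E_v make the maximum
   lie below x with probability exp(- e^(- theta x) sum_v e^(theta S(v)) Y_v), so
   after centring one needs A_n / D -> <mu> in probability, where
   A_n = sum_v e^(theta S(v) - n nu) Y_v.  Both A_n - <mu> W_n -> 0 and the L1
   convergence of the additive martingale W_n come from one weak law for sums of
   independent marks with small random weights a_v = e^(theta S(v) - n nu): as
   theta < theta0, some q in (1, 2] satisfies nu(q theta) < q nu(theta), hence the
   expected sum of the a_v ^ q decays exponentially.  For W_n the marks are the
   normalised offspring sums, cut off at families of size e^(delta n), which the
   moment of order 1 + p of N permits. *)

(** Neither the marks nor the offspring sums need have a second moment, so each is split into a part
    with controlled second moment and a remainder of small mean, estimated in L1 only. For the Y_v
    the cut-off is a fixed level chosen before n; for the offspring sums it grows with n, since the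
    increments must be summable. Their geometric rate yields almost sure convergence, L1 convergence
    and mean 1 together. D depends on the whole tree, not on its first n generations. The clocks are
    therefore integrated out given the displacements of all labels, and the division by D is
    controlled on {D >= dl} only; hence D > 0 almost surely must be proved, from the recursion at
    the root. That recursion needs the subtree limits to have the law of D, which is why the limit
    is treated as a function of an environment, on a product sigma-algebra. Conditioning is
    expressed by integrating against nonnegative functions measurable for a sigma-algebra, and a sum
    over a random generation is a limit of sums over fixed lists of labels with weight 0 off the
    tree. *)

Lemma g_sigma_sub (T : Type) (G1 G2 : set (set T)) :
  G1 `<=` <<s G2 >> -> <<s G1 >> `<=` <<s G2 >>.
Proof. by move=> G12; apply: smallest_sub => //; exact: smallest_sigma_algebra. Qed.

(** * Independence of generated sigma-algebras *)

Section Independence.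
Context {d : measure_display} {T : measurableType d} {R : realType}.
Variable P : probability T R.

(** A pi-lambda argument, one index at a time: with C the intersection of the other events, B -> P(B
    and C) and B -> P(C) P(B) are finite measures that agree on the pi-system [F k], hence on the
    sigma-algebra it generates. *)
Lemma mutually_independent_sigma (I : choiceType) (F : I -> set (set T)) :
  (forall i, F i `<=` measurable) -> (forall i, setI_closed (F i)) ->
  (forall i, F i setT) ->
  mutually_independent P F -> mutually_independent P (fun i => <<s F i >>).
Proof.
move=> Fm FI FT indF.
have sFm i : <<s F i >> `<=` measurable by apply: smallest_sub => //; exact: sigma_algebra_measurable.
(* The mixed form, generated sigma-algebras for the indices in [s] and generators elsewhere, is what
   an induction on [s] can carry. *)
suff key (s : seq I) (J : {fset I}) (A : I -> set T) :
    (forall i, i \in J -> if i \in s then <<s F i >> (A i) else F i (A i)) ->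
    P (\bigcap_(i in [set` J]) A i) = (\prod_(i <- J) P (A i))%E.
  by move=> J A JA; apply: (key J) => i iJ; rewrite iJ; exact: JA.
elim: s J A => [|k s IH] J A JA; first exact: indF.
have [kJ|kJ] := boolP (k \in J); last first.
  apply: IH => i iJ; have := JA i iJ; rewrite inE; case: eqP => //= ik.
  by move: kJ; rewrite -ik iJ.
have [ks|ks] := boolP (k \in s).
  apply: IH => i iJ; have := JA i iJ; rewrite inE; case: eqP => //= ->.
  by rewrite ks.
pose K := (J `\ k)%fset; pose C := \bigcap_(i in [set` K]) A i.
have KA i : i \in K -> if i \in s then <<s F i >> (A i) else F i (A i).
  rewrite !inE => /andP[ik iJ]; have := JA i iJ.
  by rewrite inE (negbTE ik).
have mC : measurable C.
  apply: fin_bigcap_measurable => // i /= /KA.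
  by case: ifP => _ => [/sFm|/Fm].
have PC : P C = (\prod_(i <- K) P (A i))%E by exact: IH.
have PC0 : (0 <= fine (P C))%R by exact: fine_ge0.
pose m1 : {measure set T -> \bar R} := mrestr P mC.
pose m2 : {measure set T -> \bar R} := mscale (NngNum PC0) P.
have m2E B : m2 B = (P C * P B)%E.
  by rewrite /m2 /= /mscale; congr (_ * _)%E; rewrite /= fineK ?fin_num_measure.
have JE (B : set T) : let A' := fun i => if i == k then B else A i in
   \bigcap_(i in [set` J]) A' i = B `&` C /\
   (\prod_(i <- J) P (A' i) = P B * \prod_(i <- K) P (A i))%E.
  split.
    rewrite -(fsetD1K kJ) set_fsetU1 bigcap_setU1 eqxx; congr (_ `&` _).
    apply: eq_bigcapr => i /=; rewrite !inE => /andP[/negbTE ->] //.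
  rewrite (big_fsetD1 k) //= eqxx; congr (_ * _)%E.
  apply: eq_big_seq => i; rewrite !inE => /andP[/negbTE ->] //.
have eqG B : F k B -> m1 B = m2 B.
  move=> FB; rewrite m2E /m1 /= /mrestr.
  have [<- JP] := JE B; rewrite IH; first by rewrite JP -PC muleC.
  move=> i iJ; case: eqP => [->|/eqP ik]; first by rewrite (negbTE ks).
  by apply: KA; rewrite !inE ik.
have : m1 (A k) = m2 (A k).
  apply: (g_sigma_algebra_measure_unique (F k) _ (fun=> setT)) => //.
  - by rewrite bigcup_const.
  - by move=> _; rewrite /m1/= /mrestr; apply: le_lt_trans (probability_le1 _ _) _ => //;
      [exact: measurableI|rewrite ltry].
  - by have := JA k kJ; rewrite mem_head.
rewrite m2E /m1 /= /mrestr PC => mA.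
have [E1 E2] := JE (A k).
have -> : A = (fun i => if i == k then A k else A i).
  by apply/funext => i; case: eqP => // ->.
by rewrite E1 E2 mA muleC.
Qed.

(** The sigma-algebra of a block is generated by the pi-system of finite intersections of events
    with indices in that block. Blocks being disjoint, intersecting such events over several blocks
    is one intersection over distinct indices, so the independence of the [F i] applies. *)
Lemma mutually_independent_group (I K : choiceType) (kap : I -> K)
    (F : I -> set (set T)) :
  (forall i, F i `<=` measurable) -> (forall i, setI_closed (F i)) ->
  (forall i, F i setT) ->
  mutually_independent P F ->
  mutually_independent P
    (fun k => <<s \bigcup_(i in [set i | kap i = k]) F i >>).
Proof.
move=> Fm FI FT indF.
pose G k : set (set T) := [set B | exists (L : {fset I}) (A : I -> set T),
  [/\ forall i, i \in L -> kap i = k, forall i, F i (A i) &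
      B = \bigcap_(i in [set` L]) A i]].
have -> : (fun k => <<s \bigcup_(i in [set i | kap i = k]) F i >>) =
          (fun k => <<s G k >>).
  apply/funext => k; apply/seteqP; split.
    apply: g_sigma_sub.
    move=> B; rewrite /bigcup /= => -[i ik FB]; apply: sub_sigma_algebra.
    exists [fset i]%fset, (fun j => if j == i then B else setT); split.
    - by move=> j; rewrite inE => /eqP ->.
    - by move=> j; case: eqP => [->|].
    - by rewrite set_fset1 bigcap_set1 eqxx.
  apply: g_sigma_sub.
  move=> B [L [A [Lk FA ->]]].
  have := @fin_bigcap_measurable _
    (g_sigma_algebraType (\bigcup_(i in [set i | kap i = k]) F i)) I [set` L] A.
  apply => // i /= iL; apply: sub_sigma_algebra; exists i => //=.
  exact: Lk.
apply: mutually_independent_sigma.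
- move=> k B [L [A [_ FA ->]]].
  by apply: fin_bigcap_measurable => // i _; exact: Fm.
- move=> k B1 B2 [L1 [A1 [L1k FA1 ->]]] [L2 [A2 [L2k FA2 ->]]].
  exists (L1 `|` L2)%fset, (fun i => (if i \in L1 then A1 i else setT) `&`
                                (if i \in L2 then A2 i else setT)); split.
  + by move=> i; rewrite inE => /orP[/L1k|/L2k].
  + by move=> i; apply: FI; case: ifP.
  + apply/seteqP; split => w.
      move=> [B1w B2w] i /= _; split; case: ifPn => // iL; [exact: B1w|exact: B2w].
    move=> H; split=> i /= iL.
      by have := H i; rewrite /= inE iL /= => /(_ isT) [].
    by have := H i; rewrite /= inE iL orbT /= => /(_ isT) [].
- by move=> k; exists fset0, (fun=> setT); split => //; rewrite set_fset0 bigcap_set0.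
move=> J B JB.
have /choice[L HL] : forall k, exists L : {fset I}, k \in J -> exists A : I -> set T,
   [/\ forall i, i \in L -> kap i = k, forall i, F i (A i) &
      B k = \bigcap_(i in [set` L]) A i].
  move=> k; have [/JB [L [A H]]|_] := boolP (k \in J); last by exists fset0.
  by exists L => _; exists A.
have /choice[A HA] : forall k, exists A : I -> set T, k \in J ->
   [/\ forall i, i \in L k -> kap i = k, forall i, F i (A i) &
      B k = \bigcap_(i in [set` L k]) A i].
  move=> k; have [/HL [A H]|_] := boolP (k \in J); last by exists (fun=> setT).
  by exists A => _.
(* Since [kap] determines the block, the sets [L k] with [k] in [J] are disjoint, and the single
   family [AA] on their union carries all the chosen events. *)
pose LL := (\bigcup_(k <- J) L k)%fset.
pose AA i := A (kap i) i.
have LLE i : (i \in LL) = (kap i \in J) && (i \in L (kap i)).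
  apply/bigfcupP/idP => [[k /andP[kJ _] iL]|/andP[kJ iL]].
    by have [/(_ _ iL) -> _ _] := HA k kJ; rewrite kJ.
  by exists (kap i) => //; rewrite kJ.
have PB k : k \in J -> P (B k) = (\prod_(i <- L k) P (AA i))%E.
  move=> kJ; have [kapL FA ->] := HA k kJ.
  rewrite indF => [|i _]; last exact: FA.
  by apply: eq_big_seq => i /kapL <-.
have -> : \bigcap_(k in [set` J]) B k = \bigcap_(i in [set` LL]) AA i.
  apply/seteqP; split => w H.
    move=> i /=; rewrite LLE => /andP[kJ iL].
    by have := H _ kJ; have [_ _ ->] := HA _ kJ; apply.
  move=> k /= kJ; have [kapL FA ->] := HA k kJ => i /= iL.
  have := H i; rewrite /= LLE /AA (kapL _ iL) kJ iL; exact.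
rewrite indF => [|i]; last first.
  by rewrite LLE => /andP[kJ _]; have [_ + _] := HA _ kJ; exact.
rewrite (eq_big_seq _ PB) /LL.
rewrite [LHS](partition_big_imfset _ kap) /=.
rewrite [RHS](bigID (fun k => k \in kap @` LL)%fset) /= [X in (_ * X)%E]big1_seq ?mule1.
  rewrite -[RHS]big_filter.
  have pe : perm_eq [seq k <- J | (k \in kap @` LL)%fset] (kap @` LL)%fset.
    apply: uniq_perm; rewrite ?filter_uniq ?fset_uniq // => k.
    rewrite mem_filter andb_idr // => /imfsetP[i /=]; rewrite LLE => /andP[kJ _] -> //.
  rewrite [RHS](perm_big _ pe) /=.
  apply: eq_big_seq => k /imfsetP[j /=]; rewrite LLE => /andP[kJ jL] kE.
  rewrite -[LHS]big_filter; apply: perm_big; apply: uniq_perm; rewrite ?filter_uniq ?fset_uniq // => i.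
  rewrite mem_filter -/LL LLE -kE in kJ jL *.
  have [kapL _ _] := HA k kJ.
  apply/andP/idP => [[/eqP ->/andP[]//]|iL].
  by rewrite (kapL _ iL) eqxx kJ iL.
move=> k /andP[kLL kJ]; rewrite big1_seq // => i /= iL.
case/negP: kLL; apply/imfsetP; exists i => /=; have [kapL _ _] := HA k kJ; last by rewrite kapL.
by rewrite LLE kapL // kJ.
Qed.

(** Grouping along the boolean [i == i0] leaves exactly two blocks. *)
Lemma mutually_independent_pair (I : choiceType) (F : I -> set (set T)) (i0 : I) :
  (forall i, F i `<=` measurable) -> (forall i, setI_closed (F i)) ->
  (forall i, F i setT) -> mutually_independent P F ->
  forall A B, <<s \bigcup_(i in [set i | i != i0]) F i >> A -> F i0 B ->
    P (A `&` B) = (P A * P B)%E.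
Proof.
move=> Fm FI FT indF A B FA FB.
have := @mutually_independent_group _ _ (fun i => i == i0) _ Fm FI FT indF
  [fset true; false]%fset (fun b => if b then B else A).
rewrite big_fsetU1 ?inE//= big_seq_fset1 set_fsetU1 bigcap_setU1 set_fset1 bigcap_set1.
rewrite setIC muleC; apply=> -[] _; last first.
  apply: g_sigma_sub FA => C [i /= ii0 FC]; apply: sub_sigma_algebra.
  by exists i => //=; exact/negbTE.
by apply: sub_sigma_algebra; exists i0 => //=; rewrite eqxx.
Qed.

End Independence.

Section IndependentPair.
Context {d d1 d2 : measure_display} {T : measurableType d} {R : realType}.
Context {S1 : measurableType d1} {S2 : measurableType d2}.
Variable P : probability T R.

(** Independence makes the joint law of [X] and [Y] a product measure, since it is one on
    rectangles; Tonelli then gives the iterated integral, written back on [T]. *)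
Lemma independent_integral (X : T -> S1) (Y : T -> S2)
    (mX : measurable_fun setT X) (mY : measurable_fun setT Y)
    (ind : forall A B, measurable A -> measurable B ->
      P (X @^-1` A `&` Y @^-1` B) = (P (X @^-1` A) * P (Y @^-1` B))%E)
    (f : S1 * S2 -> \bar R) :
  measurable_fun setT f -> (forall z, 0 <= f z)%E ->
  (\int[P]_w f (X w, Y w) = \int[P]_w \int[P]_w' f (X w, Y w'))%E.
Proof.
move=> mf f0.
pose X' : {RV P >-> S1} := HB.pack X (isMeasurableFun.Build _ _ _ _ X mX).
pose Y' : {RV P >-> S2} := HB.pack Y (isMeasurableFun.Build _ _ _ _ Y mY).
have mXY : measurable_fun setT (fun w => (X w, Y w)) by exact: measurable_fun_pair.
pose XY : {RV P >-> (S1 * S2)%type} :=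
  HB.pack (fun w => (X w, Y w)) (isMeasurableFun.Build _ _ _ _ _ mXY).
rewrite -(ge0_integral_distribution XY) //.
rewrite (eq_measure_integral (distribution P X' \x distribution P Y')%E); last first.
  move=> A mA _; apply/esym; apply: product_measure_unique => // *; exact: ind.
rewrite fubini_tonelli1 // /fubini_F.
rewrite ge0_integral_distribution //; last 2 first.
- exact: measurable_fun_fubini_tonelli_F.
- by move=> x; exact: integral_ge0.
apply: eq_integral => w _ /=; rewrite ge0_integral_distribution //.
exact: measurableT_comp.
Qed.

End IndependentPair.

(** * Weak law for sums of marks with small random weights *)

Section TruncatedLLN.
Context {d : measure_display} {T : measurableType d} {R : realType}.
Variable P : probability T R.
Local Open Scope ereal_scope.

(** [H] is only a generating class: the domain [T] is re-equipped with the sigma-algebra generated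
    by [H], so that all closure properties of measurable functions apply as they stand. *)
Definition sub_measurable (H : set (set T)) d' (S : measurableType d') (f : T -> S) :=
  measurable_fun [set: g_sigma_algebraType H] (f : g_sigma_algebraType H -> S).

Lemma measurable_g_sigma_weaken (H : set (set T)) d' (S : measurableType d') (f : T -> S) :
  H `<=` measurable ->
  sub_measurable H f -> measurable_fun setT f.
Proof.
move=> Hm mf _ B mB; have := mf measurableT B mB.
by apply: smallest_sub => //; exact: sigma_algebra_measurable.
Qed.

Variables (C : eqType) (s : seq C) (H : C -> set (set T)).
Variables (a b g r : C -> T -> R) (c eps V B t : R).
Hypotheses (us : uniq s) (Hm : forall v, H v `<=` measurable).
Hypotheses (a0 : forall v w, (0 <= a v w)%R) (g0 : forall v w, (0 <= g v w)%R)
  (r0 : forall v w, (0 <= r v w)%R).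
Hypotheses (mb : forall v, measurable_fun setT (b v))
  (mg : forall v, measurable_fun setT (g v)) (mr : forall v, measurable_fun setT (r v)).
Hypotheses (c0 : (0 <= c)%R) (eps0 : (0 <= eps)%R) (V0 : (0 <= V)%R) (t0 : (0 < t)%R).
Hypothesis Ha : forall v v', sub_measurable (H v) (a v').
Hypothesis Hg : forall v v', v != v' -> sub_measurable (H v) (g v').
(** [Eg], [Eg2] and [Er] stand for E[g_v | H_v] = c, E[g_v^2 | H_v] <= V and E[r_v | H_v] = eps,
    tested against nonnegative [H v]-measurable functions; [H v] sees all the weights and the other
    [g v']. *)
Hypothesis Eg : forall v (f : T -> R), v \in s -> (forall w, 0 <= f w)%R ->
  sub_measurable (H v) f ->
  \int[P]_w (f w * g v w)%:E = (\int[P]_w (f w)%:E) * c%:E.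
Hypothesis Eg2 : forall v (f : T -> R), v \in s -> (forall w, 0 <= f w)%R ->
  sub_measurable (H v) f ->
  \int[P]_w (f w * g v w ^+ 2)%:E <= (\int[P]_w (f w)%:E) * V%:E.
Hypothesis Er : forall v (f : T -> R), v \in s -> (forall w, 0 <= f w)%R ->
  sub_measurable (H v) f ->
  \int[P]_w (f w * r v w)%:E = (\int[P]_w (f w)%:E) * eps%:E.
Hypothesis Ea : \sum_(v <- s) \int[P]_w (a v w)%:E <= 1.
Hypothesis ab1 : forall v w, (1 < a v w)%R -> (a v w <= b v w)%R.
Hypothesis ab2 : forall v w, (a v w <= 1)%R -> (a v w ^+ 2 <= b v w)%R.
Hypothesis Eb : \sum_(v <- s) \int[P]_w (b v w)%:E <= B%:E.

Let al v w : R := if (a v w <= 1)%R then a v w else 0%R.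
Let ah v w : R := if (a v w <= 1)%R then 0%R else a v w.

Let Hal v v' : sub_measurable (H v) (al v').
Proof.
apply: measurable_fun_ifT => //; last exact: Ha.
by apply: measurable_fun_ler => //; exact: Ha.
Qed.

Let Hah v v' : sub_measurable (H v) (ah v').
Proof.
apply: measurable_fun_ifT => //; last exact: Ha.
by apply: measurable_fun_ler => //; exact: Ha.
Qed.

Let mal v : measurable_fun setT (al v).
Proof. exact: (measurable_g_sigma_weaken (@Hm v) (@Hal v v)). Qed.
Let mah v : measurable_fun setT (ah v).
Proof. exact: (measurable_g_sigma_weaken (@Hm v) (@Hah v v)). Qed.
Let ma v : measurable_fun setT (a v).
Proof. exact: (measurable_g_sigma_weaken (@Hm v) (@Ha v v)). Qed.

Let al0 v w : (0 <= al v w)%R. Proof. by rewrite /al; case: ifP. Qed.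
Let ah0 v w : (0 <= ah v w)%R. Proof. by rewrite /ah; case: ifP. Qed.
Let al1 v w : (al v w <= 1)%R. Proof. by rewrite /al; case: ifP. Qed.
Let b0 v w : (0 <= b v w)%R.
Proof.
have [a1|a1] := leP (a v w) 1%R; first by apply: le_trans (ab2 a1); exact: sqr_ge0.
exact: le_trans (ab1 a1).
Qed.

Let Eal v v' : \int[P]_w (al v w * al v' w)%:E \is a fin_num.
Proof.
rewrite ge0_fin_numE; last by apply: integral_ge0 => w _; rewrite lee_fin mulr_ge0.
apply: (@le_lt_trans _ _ (\int[P]_w 1)); last by rewrite integral_cst //= mul1e; apply: le_lt_trans (probability_le1 _ _) _ => //; rewrite ltry.
apply: ge0_le_integral => //.
- by move=> w _; rewrite lee_fin mulr_ge0.
- by apply/measurable_EFinP; exact: measurable_funM.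
- by move=> w _; rewrite lee_fin mulr_ile1.
Qed.

Let S w : R := (\sum_(v <- s) al v w * g v w)%R.
Let M w : R := (\sum_(v <- s) al v w * c)%R.
(** Common value of E[M^2] and E[S M], where [M] is [S] with each mark replaced by its conditional
    mean. It is finite because the light weights [al] are at most 1. *)
Let X : \bar R := \sum_(v <- s) \sum_(v' <- s) (\int[P]_w (al v w * al v' w)%:E) * (c ^+ 2)%:E.

Let int_dsum (F : C -> C -> T -> R) :
  (forall v v', measurable_fun setT (F v v')) -> (forall v v' w, (0 <= F v v' w)%R) ->
  \int[P]_w (\sum_(v <- s) \sum_(v' <- s) F v v' w)%:E =
  \sum_(v <- s) \sum_(v' <- s) \int[P]_w (F v v' w)%:E.
Proof.
move=> mF F0.
under eq_integral do rewrite -sumEFin.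
rewrite ge0_integral_sum //; last 2 first.
- by move=> v; apply/measurable_EFinP; exact: measurable_sum.
- by move=> v w _; rewrite lee_fin sumr_ge0.
apply: eq_bigr => v _; under eq_integral do rewrite -sumEFin.
rewrite ge0_integral_sum // => v'; first exact/measurable_EFinP.
by move=> w _; rewrite lee_fin.
Qed.

Let EMM : \int[P]_w (M w ^+ 2)%:E = X.
Proof.
under eq_integral do rewrite expr2 /M big_distrlr /=.
rewrite int_dsum; last 2 first.
- by move=> v v'; do ![apply: measurable_funM => //].
- by move=> v v' w; rewrite !mulr_ge0.
apply: eq_bigr => v _; apply: eq_bigr => v' _.
rewrite -ge0_integralZr //; last 3 first.
- by apply/measurable_EFinP; exact: measurable_funM.
- by move=> w _; rewrite lee_fin mulr_ge0.
- by rewrite lee_fin sqr_ge0.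
by apply: eq_integral => w _; rewrite -EFinM expr2 mulrACA.
Qed.

Let ESM : \int[P]_w (S w * M w)%:E = X.
Proof.
under eq_integral do rewrite /S /M big_distrlr /=.
rewrite int_dsum; last 2 first.
- by move=> v v'; do ![apply: measurable_funM => //].
- by move=> v v' w; rewrite !mulr_ge0.
apply: eq_big_seq => v vs; apply: eq_bigr => v' _.
transitivity (\int[P]_w (c%:E * (al v w * al v' w * g v w)%:E)).
  by apply: eq_integral => w _; rewrite -EFinM; congr (_%:E); ring.
rewrite ge0_integralZl //; last 2 first.
- by apply/measurable_EFinP; do ![apply: measurable_funM => //].
- by move=> w _; rewrite lee_fin !mulr_ge0.
have /= -> // := @Eg v (fun w => (al v w * al v' w)%R); last 2 first.
- by move=> w; rewrite mulr_ge0.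
- by apply: measurable_funM; exact: Hal.
by rewrite muleC -muleA -EFinM -expr2.
Qed.

(** Off the diagonal [g v'] is integrated out first, [g v] being [H v']-measurable, and [g v] next:
    these terms reproduce those of [X]. Only the diagonal costs [V], and there al^2 <= b. *)
Let ESS : \int[P]_w (S w ^+ 2)%:E <= X + (V * B)%:E.
Proof.
under eq_integral do rewrite expr2 /S big_distrlr /=.
rewrite int_dsum; last 2 first.
- by move=> v v'; do ![apply: measurable_funM => //].
- by move=> v v' w; rewrite !mulr_ge0.
have bd : \sum_(v <- s) (\int[P]_w (al v w * al v w)%:E) * V%:E <= (V * B)%:E.
  rewrite -ge0_sume_distrl; last first.
    by move=> v _; apply: integral_ge0 => w _; rewrite lee_fin mulr_ge0.
  rewrite muleC EFinM; apply: lee_wpmul2l => //; apply: le_trans Eb.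
  apply: lee_sum => v _; apply: ge0_le_integral => //.
  - by move=> w _; rewrite lee_fin mulr_ge0.
  - by apply/measurable_EFinP; exact: measurable_funM.
  - by apply/measurable_EFinP.
  - move=> w _; rewrite lee_fin /al; case: ifPn => [/ab2|_]; first by rewrite expr2.
    by rewrite mul0r.
apply: le_trans (leeD (lexx X) bd); rewrite /X -big_split /=.
rewrite [leLHS]big_seq [leRHS]big_seq; apply: lee_sum => v vs.
rewrite (bigD1_seq v) //= [X in _ <= X + _](bigD1_seq v) //= [leRHS]addeAC.
rewrite leeD //; last first.
  rewrite big_seq_cond [leRHS]big_seq_cond; apply: lee_sum => v' /andP[v's v'v].
  have -> : \int[P]_w (al v w * g v w * (al v' w * g v' w))%:E =
      \int[P]_w (al v w * al v' w * g v w * g v' w)%:E.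
    by apply: eq_integral => w _; congr (_%:E); ring.
  have /= -> // := @Eg v' (fun w => (al v w * al v' w * g v w)%R); last 2 first.
  - by move=> w; rewrite !mulr_ge0.
  - by apply: measurable_funM; [by apply: measurable_funM; exact: Hal|exact: Hg].
  have /= -> // := @Eg v (fun w => (al v w * al v' w)%R); last 2 first.
  - by move=> w; rewrite !mulr_ge0.
  - by apply: measurable_funM; exact: Hal.
  by rewrite -muleA -EFinM -expr2.
under eq_integral do rewrite mulrACA -(expr2 (g _ _)).
apply: le_trans (@Eg2 v (fun w => (al v w * al v w)%R) _ _ _) _ => //.
- by move=> w; rewrite mulr_ge0.
- by apply: measurable_funM; exact: Hal.
by rewrite leeDr // mule_ge0 ?lee_fin ?sqr_ge0 // integral_ge0 // => w _; rewrite lee_fin mulr_ge0.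
Qed.

Let mS : measurable_fun setT S.
Proof. by apply: measurable_sum => v; exact: measurable_funM. Qed.
Let mM : measurable_fun setT M.
Proof. by apply: measurable_sum => v; exact: measurable_funM. Qed.
Let S0 w : (0 <= S w)%R. Proof. by apply: sumr_ge0 => v _; rewrite mulr_ge0. Qed.
Let M0 w : (0 <= M w)%R. Proof. by apply: sumr_ge0 => v _; rewrite mulr_ge0. Qed.

Let EvarS : \int[P]_w ((S w - M w) ^+ 2)%:E <= (V * B)%:E.
Proof.
have Xf : X \is a fin_num.
  by apply/sum_fin_numP => v _ _; apply/sum_fin_numP => v' _ _; rewrite fin_numM.
(* Adding 2X to both sides avoids subtracting extended reals: what remains is E[(S - M)^2] + 2
   E[S M] = E[S^2] + E[M^2] <= 2X + V B. *)
rewrite -(leeD2rE (x := X + X)) ?fin_numD ?Xf //.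
apply: (@le_trans _ _ (\int[P]_w (S w ^+ 2)%:E + \int[P]_w (M w ^+ 2)%:E)).
  rewrite -ESM -ge0_integralD //; last 4 first.
  - by move=> w _; rewrite lee_fin mulr_ge0.
  - by apply/measurable_EFinP; exact: measurable_funM.
  - by move=> w _; rewrite lee_fin mulr_ge0.
  - by apply/measurable_EFinP; exact: measurable_funM.
  rewrite -ge0_integralD //; last 4 first.
  - by move=> w _; rewrite lee_fin sqr_ge0.
  - by apply/measurable_EFinP/measurable_funX; exact: measurable_funB.
  - by move=> w _; rewrite adde_ge0 // lee_fin mulr_ge0.
  - by apply: emeasurable_funD; apply/measurable_EFinP; exact: measurable_funM.
  rewrite -ge0_integralD //; last 4 first.
  - by move=> w _; rewrite lee_fin sqr_ge0.
  - by apply/measurable_EFinP/measurable_funX.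
  - by move=> w _; rewrite lee_fin sqr_ge0.
  - by apply/measurable_EFinP/measurable_funX.
  rewrite le_eqVlt; apply/orP; left; apply/eqP; apply: eq_integral => w _.
  by rewrite -!EFinD; congr (_%:E); rewrite sqrrB !mulr2n; ring.
by rewrite EMM addeA [X in _ <= X + _]addeC leeD2r // ESS.
Qed.

(* [b] stands for [a ^ q] with [1 <= q <= 2]: weights above 1 are bounded in L1,
   the others through the variance, and AM-GM with parameter [t] turns the
   second moment into a first one. *)
Lemma truncated_lln :
  \int[P]_w (`|\sum_(v <- s) a v w * (g v w + r v w - (c + eps))|)%:E <=
  (2 * (c + eps) * B + t / 2 + V * B / (2 * t) + 2 * eps)%:E.
Proof.
(* The majorants match the terms of the bound: [h1] is the variance part; [h2] the heavy weights,
   where |g - c| <= g + c costs 2c in mean; [h3] the remainders, costing 2 eps since the total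
   weight has mean at most 1. *)
pose h1 w : R := (t / 2 + (S w - M w) ^+ 2 * (2 * t)^-1)%R.
pose h2 w : R := (\sum_(v <- s) ah v w * (g v w + c))%R.
pose h3 w : R := (\sum_(v <- s) a v w * (r v w + eps))%R.
have t20 : (0 < 2 * t)%R by rewrite mulr_gt0.
have h10 w : (0 <= h1 w)%R.
  rewrite /h1 addr_ge0 // ?divr_ge0 ?sqr_ge0 //; exact: ltW.
have h20 w : (0 <= h2 w)%R by apply: sumr_ge0 => v _; rewrite mulr_ge0 // addr_ge0.
have h30 w : (0 <= h3 w)%R by apply: sumr_ge0 => v _; rewrite mulr_ge0 // addr_ge0.
have mh1 : measurable_fun setT h1.
  apply: measurable_funD => //; apply: measurable_funM => //.
  by apply: measurable_funX; exact: measurable_funB.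
have mh2 : measurable_fun setT h2.
  by apply: measurable_sum => v; apply: measurable_funM => //; exact: measurable_funD.
have mh3 : measurable_fun setT h3.
  by apply: measurable_sum => v; apply: measurable_funM => //; exact: measurable_funD.
apply: (@le_trans _ _ (\int[P]_w ((h1 w)%:E + ((h2 w)%:E + (h3 w)%:E)))).
  apply: ge0_le_integral => //.
  - apply/measurable_EFinP/measurableT_comp => //; apply: measurable_sum => v.
    by apply: measurable_funM => //; apply: measurable_funB => //; exact: measurable_funD.
  - by do ![apply: emeasurable_funD]; exact/measurable_EFinP.
  move=> w _; rewrite -!EFinD lee_fin.
  have -> : (\sum_(v <- s) a v w * (g v w + r v w - (c + eps)) = (S w - M w) +
    (\sum_(v <- s) ah v w * (g v w - c) + \sum_(v <- s) a v w * (r v w - eps)))%R.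
    rewrite /S /M -sumrB -!big_split /=; apply: eq_bigr => v _.
    by rewrite /al /ah; case: ifP => _; ring.
  apply: le_trans (ler_normD _ _) _; apply: lerD.
    rewrite /h1; set y := (S w - M w)%R.
    rewrite -real_normK ?num_real //; set z := `|y|%R.
    rewrite -subr_ge0 (_ : _ - _ = (z - t) ^+ 2 / (2 * t))%R; last by field; exact: lt0r_neq0.
    by rewrite divr_ge0 ?sqr_ge0 // ltW.
  apply: le_trans (ler_normD _ _) _; apply: lerD.
    apply: le_trans (ler_norm_sum _ _ _) _; apply: ler_sum => v _.
    rewrite normrM ger0_norm //; apply: ler_wpM2l => //.
    by apply: le_trans (ler_normB _ _) _; rewrite !ger0_norm.
  apply: le_trans (ler_norm_sum _ _ _) _; apply: ler_sum => v _.
  rewrite normrM ger0_norm //; apply: ler_wpM2l => //.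
  by apply: le_trans (ler_normB _ _) _; rewrite !ger0_norm.
rewrite ge0_integralD //; last 4 first.
- by move=> w _; rewrite lee_fin.
- exact/measurable_EFinP.
- by move=> w _; rewrite adde_ge0 // lee_fin.
- by apply: emeasurable_funD; exact/measurable_EFinP.
rewrite ge0_integralD //; last 4 first.
- by move=> w _; rewrite lee_fin.
- exact/measurable_EFinP.
- by move=> w _; rewrite lee_fin.
- exact/measurable_EFinP.
have -> : (2 * (c + eps) * B + t / 2 + V * B / (2 * t) + 2 * eps)%:E =
  (t / 2 + V * B / (2 * t))%:E + ((2 * (c + eps) * B)%:E + (2 * eps)%:E).
  by rewrite -!EFinD; congr (_%:E); ring.
apply: leeD.
  under eq_integral do rewrite EFinD (EFinM (_ ^+ 2)).
  rewrite ge0_integralD //; last 3 first.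
  - by move=> w _; rewrite lee_fin divr_ge0 // ltW.
  - by move=> w _; rewrite -EFinM lee_fin mulr_ge0 ?sqr_ge0 // invr_ge0 ltW.
  - apply/measurable_EFinP/measurable_funM => //.
    by apply: measurable_funX; exact: measurable_funB.
  rewrite ge0_integralZr //; last 3 first.
  - by apply/measurable_EFinP/measurable_funX; exact: measurable_funB.
  - by move=> w _; rewrite lee_fin sqr_ge0.
  - by rewrite lee_fin invr_ge0 ltW.
  rewrite integral_cst //= probability_setT mule1 EFinD leeD //.
  by rewrite EFinM lee_wpmul2r // lee_fin invr_ge0 ltW.
apply: leeD.
  under eq_integral do rewrite -sumEFin.
  rewrite ge0_integral_sum //; last 2 first.
  - by move=> v; apply/measurable_EFinP/measurable_funM => //; exact: measurable_funD.
  - by move=> v w _; rewrite lee_fin mulr_ge0 // addr_ge0.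
  apply: (@le_trans _ _ (\sum_(v <- s) (\int[P]_w (b v w)%:E) * (2 * (c + eps))%:E)).
    rewrite [leLHS]big_seq [leRHS]big_seq; apply: lee_sum => v vs.
    under eq_integral do rewrite mulrDr EFinD.
    rewrite ge0_integralD //; last 4 first.
    - by move=> w _; rewrite lee_fin mulr_ge0.
    - by apply/measurable_EFinP; exact: measurable_funM.
    - by move=> w _; rewrite lee_fin mulr_ge0.
    - by apply/measurable_EFinP; exact: measurable_funM.
    rewrite Eg //.
    under [X in _ + X]eq_integral do rewrite EFinM.
    rewrite ge0_integralZr //; last 2 first.
    - exact/measurable_EFinP.
    - by move=> w _; rewrite lee_fin.
    rewrite -ge0_muleDr ?lee_fin // -EFinD.
    apply: lee_pmul => //.
    - by apply: integral_ge0 => w _; rewrite lee_fin.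
    - by rewrite lee_fin addr_ge0.
    - apply: ge0_le_integral => //.
      + by move=> w _; rewrite lee_fin.
      + exact/measurable_EFinP.
      + exact/measurable_EFinP.
      + move=> w _; rewrite lee_fin /ah; case: ifPn => //; rewrite -ltNge; exact: ab1.
    - by rewrite lee_fin mulr_natl mulr2n lerD // lerDl.
  rewrite -ge0_sume_distrl; last by move=> v _; apply: integral_ge0 => w _; rewrite lee_fin.
  by rewrite muleC (EFinM _ B) lee_wpmul2l // lee_fin mulr_ge0 // addr_ge0.
under eq_integral do rewrite -sumEFin.
rewrite ge0_integral_sum //; last 2 first.
- by move=> v; apply/measurable_EFinP/measurable_funM => //; exact: measurable_funD.
- by move=> v w _; rewrite lee_fin mulr_ge0 // addr_ge0.
apply: (@le_trans _ _ (\sum_(v <- s) (\int[P]_w (a v w)%:E) * (2 * eps)%:E)).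
  rewrite [leLHS]big_seq [leRHS]big_seq; apply: lee_sum => v vs.
  under eq_integral do rewrite mulrDr EFinD.
  rewrite ge0_integralD //; last 4 first.
  - by move=> w _; rewrite lee_fin mulr_ge0.
  - by apply/measurable_EFinP; exact: measurable_funM.
  - by move=> w _; rewrite lee_fin mulr_ge0.
  - by apply/measurable_EFinP; exact: measurable_funM.
  rewrite Er //.
  under [X in _ + X]eq_integral do rewrite EFinM.
  rewrite ge0_integralZr //; last 2 first.
  - exact/measurable_EFinP.
  - by move=> w _; rewrite lee_fin.
  by rewrite -ge0_muleDr ?lee_fin // -EFinD mulr_natl mulr2n.
rewrite -ge0_sume_distrl; last by move=> v _; apply: integral_ge0 => w _; rewrite lee_fin.
by rewrite -[leRHS]mul1e lee_wpmul2r // lee_fin mulr_ge0.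
Qed.

End TruncatedLLN.

(** * The Ulam-Harris tree as a function of a fixed environment *)

Section Tree.
Context {R : realType}.
Implicit Types (om : seq nat -> config R) (u v : seq nat).

(** [generation] and [position] are recast over a deterministic environment [om], so that they can
    be composed with [shift] and the martingale limit becomes a function on the space of
    environments. *)
Fixpoint gen (n : nat) om : seq (seq nat) :=
  if n is k.+1 then
    flatten [seq [seq rcons u j | j <- iota 0 (size (om u))] | u <- gen k om]
  else [:: [::]].

Definition pos v om : R :=
  \sum_(k < size v) nth 0 (om (take k v) : seq R) (nth 0%N v k).

Definition shift (j : nat) om : seq nat -> config R := fun u => om (j :: u).

Lemma genS n om : gen n.+1 om =
  flatten [seq [seq rcons u j | j <- iota 0 (size (om u))] | u <- gen n om].
Proof. by []. Qed.

Lemma mem_gen_rcons n u j om :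
  (rcons u j \in gen n.+1 om) = (u \in gen n om) && (j < size (om u))%N.
Proof.
apply/flattenP/andP => [[_ /mapP[u' u'g ->]] /mapP[j' j'I /rcons_inj[-> ->]]|[ug jI]].
  by rewrite u'g; move: j'I; rewrite mem_iota.
exists [seq rcons u j | j <- iota 0 (size (om u))]; first by apply/mapP; exists u.
by apply/mapP; exists j; rewrite ?mem_iota.
Qed.

(** Membership reduces to finitely many conditions on the strict ancestors of [v]. This gives its
    measurability, and shows that it does not read the offspring list of [v] itself. *)
Lemma mem_gen n v om : (v \in gen n om) = (size v == n) &&
  [forall k : 'I_(size v), (nth 0%N v k < size (om (take k v)))%N].
Proof.
elim: n v => [|n IH] v.
  by case: v => [|x v] //=; rewrite inE eqxx; apply/esym/forallP => -[].
rewrite genS; case/lastP: v => [|u j].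
  apply/negbTE/negP => /flattenP[_ /mapP[u _ ->]] /mapP[j _] /(congr1 size).
  by rewrite size_rcons.
rewrite -genS mem_gen_rcons IH size_rcons eqSS -andbA; congr (_ && _).
apply/andP/forallP => [[/forallP H jI] k|H].
  have := ltn_ord k; rewrite ltnS leq_eqVlt => /orP[/eqP kE|ku].
    by rewrite kE nth_rcons ltnn eqxx -cats1 take_size_cat.
  by rewrite nth_rcons ku -cats1 take_cat ku; exact: (H (Ordinal ku)).
split; last first.
  by have := H ord_max; rewrite /= nth_rcons ltnn eqxx -cats1 take_size_cat.
apply/forallP => k; have ku := ltn_ord k.
by have := H (widen_ord (leqnSn _) k); rewrite /= nth_rcons ku -cats1 take_cat ku.
Qed.

Lemma size_gen n v om : v \in gen n om -> size v = n.
Proof. by rewrite mem_gen => /andP[/eqP]. Qed.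

Lemma uniq_gen n om : uniq (gen n om).
Proof.
elim: n => //= n IH; elim: (gen n om) IH => //= u g IH /andP[ug uniqg].
rewrite cat_uniq IH // andbT map_inj_uniq ?iota_uniq /=; last exact: rcons_injr.
apply/hasPn => _ /flattenP[_ /mapP[u' u'g ->]] /mapP[j _ ->].
apply/negP => /mapP[j' _] /rcons_inj[uu' _].
by move: ug; rewrite -uu' u'g.
Qed.

Lemma sum_genS n om (f : seq nat -> R) : \sum_(v <- gen n.+1 om) f v =
  \sum_(u <- gen n om) \sum_(j < size (om u)) f (rcons u j).
Proof.
rewrite genS big_flatten big_map; apply: eq_bigr => u _.
by rewrite big_map -{1}[size (om u)]subn0 -/(index_iota _ _) big_mkord.
Qed.

Lemma pos_rcons u j om : pos (rcons u j) om = pos u om + nth 0 (om u : seq R) j.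
Proof.
rewrite /pos size_rcons big_ord_recr /= nth_rcons ltnn eqxx -cats1 take_size_cat //.
congr (_ + _); apply: eq_bigr => k _.
by rewrite cats1 nth_rcons ltn_ord -cats1 take_cat ltn_ord.
Qed.

Lemma pos_cons j u om :
  pos (j :: u) om = nth 0 (om [::] : seq R) j + pos u (shift j om).
Proof. by rewrite /pos /= big_ord_recl /=. Qed.

(** [gen] grows at the leaves; this is the decomposition at the root, the source of the recursive
    equation for the limit. *)
Lemma genS_shift n om : gen n.+1 om =
  flatten [seq [seq j :: u | u <- gen n (shift j om)] | j <- iota 0 (size (om [::]))].
Proof.
elim: n => [|n IH].
  by rewrite /= cats0; elim: (iota _ _) => //= j s ->.
rewrite genS IH; elim: (iota 0 (size (om [::]))) => //= j s IHs.
rewrite map_cat flatten_cat IHs; congr (_ ++ _).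
rewrite map_flatten -!map_comp; congr flatten; apply: eq_map => u /=.
by rewrite -map_comp; apply: eq_map.
Qed.

Lemma sum_genS_shift n om (f : seq nat -> R) : \sum_(v <- gen n.+1 om) f v =
  \sum_(j < size (om [::])) \sum_(u <- gen n (shift j om)) f ((j : nat) :: u).
Proof.
rewrite genS_shift big_flatten big_map -{1}[size (om [::])]subn0 -/(index_iota _ _) big_mkord.
by apply: eq_bigr => j _; rewrite big_map.
Qed.

(* An enumeration of all labels: every random finite sum over a generation is
   an eventually constant sequence of sums over these deterministic lists. *)
Definition words (K : nat) : seq (seq nat) := pmap pickle_inv (iota 0 K).

Lemma wordsS K : words K.+1 = words K ++ seq_of_opt (pickle_inv K).
Proof. by rewrite /words -addn1 iotaD /= pmap_cat /=; case: (pickle_inv K). Qed.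

Lemma mem_words K v : (v \in words K) = (choice.pickle v < K)%N.
Proof.
rewrite mem_pmap; apply/mapP/idP => [[k kK vE]|vK].
  have := @pickle_invK (seq nat) k; rewrite -vE /= => ->.
  by move: kK; rewrite mem_iota.
by exists (choice.pickle v); rewrite ?mem_iota // pickleK_inv.
Qed.

Lemma uniq_words K : uniq (words K).
Proof.
elim: K => // K IH; rewrite wordsS cat_uniq IH /=.
have := @pickle_invK (seq nat) K; case: (pickle_inv K) => //= v vK.
by rewrite mem_words vK ltnn.
Qed.

Lemma sum_words (V : nmodType) (s : seq (seq nat)) (f : seq nat -> V) :
  uniq s -> \forall K \near \oo,
  \sum_(v <- words K | v \in s) f v = \sum_(v <- s) f v.
Proof.
move=> us; exists (\max_(v <- s) (choice.pickle v).+1)%N => // K /= sK.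
rewrite -big_filter; apply: perm_big; apply: uniq_perm; rewrite ?filter_uniq ?uniq_words //.
move=> v; rewrite mem_filter mem_words andb_idr // => vs.
by apply: leq_trans sK; apply: leq_bigmax_seq vs _.
Qed.

End Tree.

(** * Measurability of finite configurations and of sums over a generation *)

Section ConfigMeasurability.
Context {R : realType}.

Lemma measurable_config_size (k : nat) : measurable [set s : config R | size s = k].
Proof.
apply: sub_sigma_algebra; exists k, (fun=> setT); split => //.
by apply/seteqP; split => s /=; [|case].
Qed.

Lemma measurable_fun_config_size_gt (j : nat) :
  measurable_fun [set: config R] (fun s => (j < size s)%N).
Proof.
apply: (measurable_fun_bool true).
rewrite setTI (_ : _ @^-1` _ = ~` \bigcup_(k in [set k | (k <= j)%N]) [set s : config R | size s = k]).
  by apply: measurableC; apply: bigcup_measurable => k _; exact: measurable_config_size.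
apply/seteqP; split => s /=.
  by move=> js [k /= kj sk]; move: js; rewrite sk ltnNge kj.
by move=> H; rewrite ltnNge; apply/negP => sj; apply: H; exists (size s).
Qed.

Lemma measurable_config_nth (j : nat) :
  measurable_fun [set: config R] (fun s => nth 0 (s : seq R) j).
Proof.
move=> _ B mB; rewrite setTI.
rewrite (_ : _ @^-1` _ = \bigcup_k ([set s : config R | size s = k] `&`
    [set s : config R | B (nth 0 (s : seq R) j)])); last first.
  by apply/seteqP; split => s /=; [move=> Bs; exists (size s)|case=> k _ []].
apply: bigcupT_measurable => k; have [jk|kj] := ltnP j k.
  apply: sub_sigma_algebra; exists k, (fun i => if i == j then B else setT); split.
    by move=> i; case: ifP.
  apply/seteqP; split => s /= [sk Bs]; split => //.
    by move=> i ik; case: eqP => // ->.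
  by have := Bs j jk; rewrite eqxx.
(* For [k <= j] the default value 0 of [nth] is read, so the preimage within {size = k} is
   everything or nothing according to whether [B] contains 0. *)
have [B0|B0] := pselect (B 0).
  rewrite (_ : _ `&` _ = [set s : config R | size s = k]); first exact: measurable_config_size.
  by apply/seteqP; split => s /= => [[]//|sk]; split => //; rewrite nth_default ?sk.
rewrite (_ : _ `&` _ = set0) //; apply/seteqP; split => s //= [sk].
by rewrite nth_default ?sk.
Qed.

Definition psum (al : R) (s : config R) : R := \sum_(x <- (s : seq R)) expR (al * x).

Lemma psumE al s : psum al s = \sum_(j < size s) expR (al * nth 0 (s : seq R) j).
Proof. by rewrite /psum (big_nth 0) big_mkord. Qed.

Lemma psum_ge0 al s : 0 <= psum al s.
Proof. by apply: sumr_ge0 => x _; exact: expR_ge0. Qed.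

(** A sum of random length is the pointwise limit, eventually constant, of sums of fixed length
    whose terms beyond the size are set to 0. *)
Lemma measurable_fun_config_sum (f : nat -> config R -> R) :
  (forall j, measurable_fun setT (f j)) ->
  measurable_fun setT (fun s : config R => \sum_(j < size s) f j s).
Proof.
move=> mf; apply: (@measurable_fun_cvg _ _ _ _
    (fun K (s : config R) => \sum_(0 <= j < K) if (j < size s)%N then f j s else 0)).
  move=> K; apply: measurable_sum => j; apply: measurable_fun_ifT => //.
  exact: measurable_fun_config_size_gt.
move=> s _; apply: cvg_near_cst; exists (size s) => // K /= sK.
by rewrite -(big_mkord xpredT (f^~ s)) (big_nat_widen _ _ _ _ _ sK) [RHS]big_mkcond.
Qed.

Lemma measurable_psum al : measurable_fun [set: config R] (psum al).
Proof.
rewrite (_ : psum al = fun s : config R => \sum_(j < size s) expR (al * nth 0 (s : seq R) j)).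
  apply: (measurable_fun_config_sum (f := fun j s => expR (al * nth 0 (s : seq R) j))) => j.
  apply: measurableT_comp => //; apply: measurable_funM => //.
  exact: measurable_config_nth.
by apply/funext => s; exact: psumE.
Qed.

End ConfigMeasurability.

Section TreeMeasurability.
Context {R : realType} {d : measure_display} {T : measurableType d}.
Variables (om : T -> seq nat -> config R) (n : nat).
Hypothesis mom : forall u, (size u < n)%N -> measurable_fun setT (om^~ u).

Lemma measurable_mem_gen v : measurable_fun setT (fun w => v \in gen n (om w)).
Proof.
under eq_fun do rewrite mem_gen.
have [vn|vn] := eqVneq (size v) n; last first.
  exact: measurable_cst.
apply: (measurable_fun_bool true); rewrite setTI.
rewrite (_ : _ @^-1` _ = \bigcap_k
   [set w | (k < size v)%N -> (nth 0%N v k < size (om w (take k v)))%N]); last first.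
  apply/seteqP; split => w /=.
    by move=> /forallP H k _ kv; exact: (H (Ordinal kv)).
  by move=> H; apply/forallP => k; apply: H => /=.
apply: bigcapT_measurable => k; have [kv|vk] := ltnP k (size v); last first.
  by rewrite (_ : [set _ | _] = setT) //; apply/seteqP; split.
have mk : measurable_fun setT (om^~ (take k v)).
  by apply: mom; rewrite size_take kv -vn.
have := measurableT_comp (measurable_fun_config_size_gt (nth 0%N v k)) mk.
move=> /(_ measurableT [set true] Logic.I); rewrite setTI.
by congr measurable; apply/seteqP; split => w /=; [move=> H _|apply].
Qed.

Lemma measurable_pos v : (size v <= n)%N -> measurable_fun setT (fun w => pos v (om w)).
Proof.
move=> vn; apply: measurable_sum => k.
have mk : measurable_fun setT (om^~ (take k v)).
  by apply: mom; rewrite size_take ltn_ord (leq_trans _ vn).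
exact: (measurableT_comp (measurable_config_nth (nth 0%N v k)) mk).
Qed.

Lemma measurable_gen_ite v (f : T -> R) : (size v = n -> measurable_fun setT f) ->
  measurable_fun setT (fun w => if v \in gen n (om w) then f w else 0).
Proof.
have [vn mf|vn _] := eqVneq (size v) n.
  by apply: measurable_fun_ifT => //; [exact: measurable_mem_gen|exact: mf].
rewrite (_ : (fun w => _) = fun=> 0); first exact: measurable_cst.
apply/funext => w; by case: ifP => // /size_gen /eqP; rewrite (negbTE vn).
Qed.

Lemma sum_gen_near (f : seq nat -> R) o : \forall K \near \oo,
  \sum_(v <- words K) (if v \in gen n o then f v else 0) = \sum_(v <- @gen R n o) f v.
Proof.
have [K0 _ H] := sum_words f (uniq_gen n o).
by exists K0 => // K /H; rewrite -big_mkcond.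
Qed.

Lemma measurable_sum_gen (f : seq nat -> T -> R) :
  (forall v, size v = n -> measurable_fun setT (f v)) ->
  measurable_fun setT (fun w => \sum_(v <- gen n (om w)) f v w).
Proof.
move=> mf; apply: (@measurable_fun_cvg _ _ _ _
    (fun K w => \sum_(v <- words K) if v \in gen n (om w) then f v w else 0)).
  by move=> K; apply: measurable_sum => v; apply: measurable_gen_ite => /mf.
by move=> w _; apply: cvg_near_cst; exact: sum_gen_near.
Qed.

(** Monotone convergence along [words]. The mean of a sum over a random set of labels becomes a
    limit of sums of means over fixed labels, to which independence applies label by label. *)
Lemma integral_sum_gen (P : probability T R) (f : seq nat -> T -> R) :
  (forall v, size v = n -> measurable_fun setT (f v)) -> (forall v w, 0 <= f v w) ->
  (\sum_(v <- words K) \int[P]_w (if v \in gen n (om w) then f v w else 0)%:E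
    @[K --> \oo] --> \int[P]_w (\sum_(v <- gen n (om w)) f v w)%:E)%E.
Proof.
move=> mf f0.
pose F K w := (\sum_(v <- words K) if v \in gen n (om w) then f v w else 0)%:E.
have mite v : measurable_fun setT (fun w => if v \in gen n (om w) then f v w else 0).
  by apply: measurable_gen_ite => /mf.
have ite0 v w : 0 <= (if v \in gen n (om w) then f v w else 0) by case: ifP.
rewrite (_ : (fun K => _) = fun K => \int[P]_w F K w)%E; last first.
  apply/funext => K; rewrite /F; under [RHS]eq_integral do rewrite -sumEFin.
  rewrite ge0_integral_sum // => v; first exact/measurable_EFinP.
  by move=> w _; rewrite lee_fin.
rewrite (_ : (\int[P]_w _ = \int[P]_w limn (F^~ w))%E); last first.
  apply: eq_integral => w _; apply/esym/cvg_lim => //; apply: cvg_near_cst.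
  have [K0 _ H] := sum_gen_near (f^~ w) (om w).
  by exists K0 => // K /H; rewrite /F => ->.
apply: cvg_monotone_convergence => //.
- by move=> K; apply/measurable_EFinP; exact: measurable_sum.
- by move=> K w _; rewrite lee_fin sumr_ge0.
- move=> w _; apply: homo_leq (@le_trans _ _) _ => [//|K]; rewrite /F lee_fin.
  by rewrite wordsS big_cat /= lerDl sumr_ge0.
Qed.

End TreeMeasurability.

(** * Almost sure events, and the strict gap nu(q theta) < q nu(theta) *)

Section AlmostSure.
Context {d : measure_display} {T : measurableType d} {R : realType}.
Variable P : probability T R.

Lemma prob1_ae (A : set T) : measurable A -> P A = 1%E -> {ae P, forall w, A w}.
Proof.
move=> mA PA; exists (~` A); split => //; first exact: measurableC.
by rewrite probability_setC // PA subee.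
Qed.

Lemma ae_false : {ae P, forall w : T, False} -> False.
Proof.
move=> [N [mN PN sub]].
have : P setT = 0%E.
  apply/eqP; rewrite eq_le measure_ge0 andbT -PN le_measure ?inE //.
  by move=> w _; apply: sub => /=; tauto.
by rewrite probability_setT => /eqP; rewrite onee_eq0.
Qed.

End AlmostSure.

(* The minimum of [f s / s] over [(0, 2 theta)] is attained at some [s <= theta]
   because [f s / s] blows up at 0 and is at least [f theta / theta] on
   [(theta, 2 theta)]; its derivative vanishes there. *)
Lemma ratio_critical_point (R : realType) (f : R -> R) (va theta : R) :
  0 < va -> 0 < theta -> (forall s, - va < s -> derivable f s 1) -> 0 < f 0 ->
  (forall q, 1 < q -> q <= 2 -> q * f theta <= f (q * theta)) ->
  exists s, [/\ 0 < s, s <= theta & f s / s = derive1 f s].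
Proof.
move=> va0 th0 df f00 Hq; pose h s := f s / s.
have cf s : - va < s -> {for s, continuous f}.
  by move=> /df /derivable1_diffP /differentiable_continuous.
pose c := f 0 / 2.
have c0 : 0 < c by rewrite divr_gt0.
have [dl dl0 Hdl] : exists2 dl : R, 0 < dl & forall s, 0 < s -> s < dl -> c < f s.
  have va00 : - va < 0 by rewrite oppr_lt0.
  have /cvgrPdist_lt /(_ c c0) [e /= e0 He] := cf 0 va00.
  exists e => // s s0 se; have := He s; rewrite /= sub0r normrN gtr0_norm // => /(_ se).
  by rewrite ltr_norml => /andP[_]; rewrite /c; lra.
pose D := Num.min (Num.min dl theta) (c / (`|h theta| + 1)) / 2.
have hp : 0 < `|h theta| + 1 by rewrite ltr_wpDl.
have D0 : 0 < D by rewrite divr_gt0 // !lt_min dl0 th0 divr_gt0.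
have DD : D * 2 = Num.min (Num.min dl theta) (c / (`|h theta| + 1)).
  by rewrite /D -mulrA mulVf ?mulr1.
have : [/\ D * 2 <= dl, D * 2 <= theta & D * 2 <= c / (`|h theta| + 1)].
  by rewrite DD; split; rewrite !ge_min lexx ?orbT.
move=> [Ddl Dth Dc].
have Dh s : 0 < s -> s <= D -> h theta <= h s.
  move=> s0 sD; have cs : c < f s by apply: Hdl => //; lra.
  rewrite /h ler_pdivlMr //; apply: le_trans (ltW cs).
  have : D * 2 * (`|h theta| + 1) <= c by rewrite -ler_pdivlMr.
  have := ler_norm (h theta); rewrite -/(h theta); have := normr_ge0 (h theta); nra.
have [sm /[!in_itv]/= /andP[Dsm smth] hmin] : exists2 s, s \in `[D, theta]%R &
    forall t, t \in `[D, theta]%R -> h s <= h t.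
  apply: EVT_min; first by lra.
  apply: derivable_within_continuous => s /[!in_itv]/= /andP[Ds _].
  apply: derivableM; first by apply: df; lra.
  by apply: derivableV; [apply/eqP; lra|].
have sm0 : 0 < sm by lra.
have hth : h sm <= h theta by apply: hmin; rewrite in_itv /= lexx andbT; lra.
have hall t : 0 < t -> t < 2 * theta -> h sm <= h t.
  move=> t0 t2; have [tD|Dt] := leP t D; first exact: le_trans (Dh _ t0 tD).
  have [tth|tht] := leP t theta; first by apply: hmin; rewrite in_itv /= tth andbT ltW.
  apply: le_trans hth _; rewrite /h.
  have := Hq (t / theta); rewrite ltr_pdivlMr // mul1r ler_pdivrMr // => /(_ tht (ltW t2)).
  rewrite -[_ / theta * theta]mulrA mulVf ?gt_eqF // mulr1 => E.
  rewrite ler_pdivlMr // ; apply: le_trans E; rewrite le_eqVlt; apply/orP; left; apply/eqP; ring.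
pose phi s := f s - h sm * s.
have phi_min t : t \in `]0, 2 * theta[%R -> phi sm <= phi t.
  move=> /[!in_itv]/= /andP[t0 t2].
  have -> : phi sm = 0 by rewrite /phi /h mulfVK ?subrr // gt_eqF.
  rewrite subr_ge0 -ler_pdivlMr //; exact: hall.
have dphi t : - va < t -> is_derive t 1 phi ('D_1 f t - h sm).
  move=> tva; apply: is_deriveB; first by split => //; exact: df.
  have := @is_deriveM R R^o (cst (h sm)) id t 1 0 1 _ _.
  by rewrite /= scaler0 addr0 /GRing.scale /= mulr1; exact.
have smI : sm \in `]0, 2 * theta[%R by rewrite in_itv /= sm0; lra.
have [_ d0] : is_derive sm 1 phi 0.
  apply: (derive1_at_min _ _ smI phi_min); first by lra.
  by move=> t /[!in_itv]/= /andP[t0 _]; have /dphi[] : - va < t by lra.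
have [_ d1] : is_derive sm 1 phi ('D_1 f sm - h sm) by apply: dphi; lra.
exists sm; split => //.
rewrite derive1E -/(h sm); apply/eqP; rewrite eq_sym -subr_eq0 -d1 d0 //.
Qed.

Section Moments.
Context {d : measure_display} {T : measurableType d} {R : realType}.
Variables (P : probability T R) (Z0 : {mfun T >-> config R}).
Hypotheses (HA1 : assumption_A1 P Z0) (HA2 : assumption_A2 P Z0).

Lemma size_ge1_ae : {ae P, forall w, (1 <= size (Z0 w))%N}.
Proof.
apply: prob1_ae; last by case: HA2.
have := measurableT_comp (measurable_fun_config_size_gt (R := R) 0) (measurable_funPT Z0).
by move=> /(_ measurableT [set true] Logic.I); rewrite setTI.
Qed.

Definition mom (al : R) : R := fine (moment P Z0 al).

Lemma measurable_psumZ al : measurable_fun setT (fun w => psum al (Z0 w)).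
Proof. exact: measurableT_comp (measurable_psum al) (measurable_funPT Z0). Qed.

Lemma integrable_psum al : (moment P Z0 al < +oo)%E ->
  P.-integrable setT (EFin \o (fun w => psum al (Z0 w))).
Proof.
move=> fin; apply/integrableP; split; first exact/measurable_EFinP/measurable_psumZ.
apply: le_lt_trans fin; rewrite le_eqVlt; apply/orP; left; apply/eqP.
by apply: eq_integral => w _ /=; rewrite ger0_norm ?psum_ge0.
Qed.

Lemma moment_ge0 al : (0 <= moment P Z0 al)%E.
Proof. by apply: integral_ge0 => w _; rewrite lee_fin psum_ge0. Qed.

Lemma momE al : (moment P Z0 al < +oo)%E -> moment P Z0 al = (mom al)%:E.
Proof. by move=> fin; rewrite /mom fineK // ge0_fin_numE ?moment_ge0. Qed.

(** Almost surely there is a child, so the exponential sum is almost surely positive; a zero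
    integral would force it to vanish almost surely. *)
Lemma mom_gt0 al : (moment P Z0 al < +oo)%E -> 0 < mom al.
Proof.
move=> fin; rewrite lt_neqAle fine_ge0 ?moment_ge0 // andbT; apply/eqP => m0.
have : (\int[P]_w `|(psum al (Z0 w))%:E| = 0)%E.
  transitivity (moment P Z0 al); last by rewrite momE // -m0.
  by apply: eq_integral => w _ /=; rewrite ger0_norm ?psum_ge0.
move/ae_eq_integral_abs => /(_ measurableT) ae0.
apply: (@ae_false _ _ _ P); apply: filterS2 size_ge1_ae (ae0 _) => [w s1 /(_ Logic.I)|].
  case=> /eqP; rewrite psumE (bigD1 (Ordinal s1)) //= gt_eqF //.
  by apply: ltr_wpDr; [apply: sumr_ge0 => j _; exact: expR_ge0|exact: expR_gt0].
exact/measurable_EFinP/measurable_psumZ.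
Qed.

(** m(0) is E[N], and N + 1_{N = 1} >= 2 almost surely, so m(0) >= 2 - P(N = 1) > 1. It provides
    nu(0) > 0, which makes nu(s)/s blow up at 0. *)
Lemma mom0_gt1 : (moment P Z0 0 < +oo)%E -> 1 < mom 0.
Proof.
move=> fin; have [P1 _ _] := HA2; rewrite -lte_fin -momE //.
pose A := [set w | size (Z0 w) = 1%N].
have mA : measurable A.
  have := measurable_funPT Z0 measurableT _ (measurable_config_size (R := R) 1).
  by rewrite setTI.
have : (2%:E <= moment P Z0 0 + P A)%E.
  have -> : P A = (\int[P]_w (\1_A w)%:E)%E by rewrite integral_indic // setIT.
  rewrite -ge0_integralD //; last 3 first.
  - by move=> w _; rewrite lee_fin psum_ge0.
  - exact/measurable_EFinP/measurable_psumZ.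
  - exact/measurable_EFinP.
  have -> : 2%:E = (\int[P]_w (2%:E : \bar R))%E by rewrite integral_cst //= probability_setT mule1.
  apply: ae_ge0_le_integral => //.
  - by move=> w _; rewrite adde_ge0 ?lee_fin ?psum_ge0.
  - by apply: emeasurable_funD; apply/measurable_EFinP; [exact: measurable_psumZ|].
  apply: filterS size_ge1_ae => w s1 _; rewrite -EFinD lee_fin -/(psum 0 (Z0 w)) psumE.
  under eq_bigr do rewrite mul0r expR0.
  rewrite sumr_const card_ord indicE.
  case E : (size (Z0 w)) s1 => [|[|k]] // _; first by rewrite mem_set.
  by rewrite -natrD ler_nat.
move=> h; rewrite ltNge; apply/negP => m1; move: h; apply/negP; rewrite -ltNge.
rewrite (_ : 2%:E = 1%E + 1%E)%E //; apply: lee_ltD => //.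
by rewrite ge0_fin_numE ?moment_ge0.
Qed.

(** Majorant for differentiating under the integral, uniform in [th] near [a]: |x| <= e^(dl |x|) /
    dl, so the factor x and the deviation of [th] each move the exponent by at most dl |x|; the two
    exponentials serve the two signs of x. *)
Lemma mul_expR_le (dl a x th : R) : 0 < dl -> a - dl < th -> th < a + dl ->
  `|x * expR (th * x)| <= 2 / dl * (expR ((a + 2 * dl) * x) + expR ((a - 2 * dl) * x)).
Proof.
move=> dl0 th1 th2; rewrite normrM (ger0_norm (expR_ge0 _)).
have xle : `|x| <= dl^-1 * expR (dl * `|x|).
  rewrite ler_pdivlMl // ; apply: le_trans (expR_ge1Dx _); lra.
have key : expR (dl * `|x|) * expR (th * x) <= expR ((a + 2 * dl) * x) + expR ((a - 2 * dl) * x).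
  rewrite -expRD; have [x0|x0] := leP 0 x.
    rewrite -[leLHS]addr0 lerD ?expR_ge0 // ler_expR ger0_norm //; nra.
  rewrite -[leLHS]add0r lerD ?expR_ge0 // ler_expR ltr0_norm //; nra.
apply: le_trans (ler_wpM2r (expR_ge0 _) xle) _.
have i0 : 0 <= dl^-1 by rewrite invr_ge0 ltW.
rewrite -[leLHS]mulrA (le_trans (ler_wpM2l i0 key)) //.
by rewrite ler_wpM2r ?addr_ge0 ?expR_ge0 // mulr_natl mulr2n lerDl.
Qed.

Lemma is_derive_psum (s : config R) (th : R) :
  is_derive th 1 (psum^~ s) (\sum_(x <- (s : seq R)) x * expR (th * x)).
Proof.
rewrite /psum; elim: (s : seq R) => [|x l IH].
  by rewrite big_nil; under eq_fun do rewrite big_nil; exact: is_derive_cst.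
rewrite big_cons; under eq_fun do rewrite big_cons.
apply: is_deriveD.
have -> : (fun th => expR (th * x)) = expR \o (fun th => th * x) by [].
have H : is_derive th 1 (fun th : R => th * x) x.
  have := @is_deriveM R R^o id (cst x) th 1 1 0 _ _.
  by rewrite /= scaler0 add0r /GRing.scale /= mulr1; exact.
by rewrite mulrC; exact: is_derive1_comp.
Qed.

Lemma derivable_mom (va a : R) : 0 < va ->
  (forall al : R, - va < al -> (moment P Z0 al < +oo)%E) -> - va < a ->
  derivable mom a 1.
Proof.
(* A third of the distance to [- va] keeps [a - 2 * dl] above [- va], so both moments in the
   majorant are finite. *)
move=> va0 fin ava; pose dl := (a + va) / 3.
have dl0 : 0 < dl by rewrite divr_gt0 //; lra.
pose G w := 2 / dl * (psum (a + 2 * dl) (Z0 w) + psum (a - 2 * dl) (Z0 w)).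
apply: (@derivable_under_integral R _ T P (fun al w => psum al (Z0 w)) setT measurableT
   a (a - dl) (a + dl) _ _ _ G).
- by rewrite /= in_itv /=; apply/andP; split; lra.
- move=> x; rewrite /= in_itv /= => /andP[x1 x2]; apply: integrable_psum; apply: fin.
  by move: x1; rewrite /dl; lra.
- by move=> x w _ _; have [] := is_derive_psum (Z0 w) x.
- by move=> w; rewrite /G mulr_ge0 ?addr_ge0 ?psum_ge0 // divr_ge0 // ltW.
- rewrite (_ : EFin \o G = fun w => ((2 / dl)%:E * ((psum (a + 2 * dl) (Z0 w))%:E + (psum (a - 2 * dl) (Z0 w))%:E))%E) //.
  apply: integrableZl => //; apply: integrableD => //; apply: integrable_psum; apply: fin;
    rewrite /dl; lra.
- move=> x w; rewrite /= in_itv /= => /andP[x1 x2] _.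
  rewrite /partial1of2 derive1E; have [_ ->] := is_derive_psum (Z0 w) x.
  rewrite /G /psum -big_split /= mulr_sumr.
  apply: le_trans (ler_norm_sum _ _ _) _; apply: ler_sum => y _.
  exact: mul_expR_le.
Qed.

Lemma derivable_nu (va a : R) : 0 < va ->
  (forall al : R, - va < al -> (moment P Z0 al < +oo)%E) -> - va < a ->
  derivable (nu P Z0) a 1.
Proof.
move=> va0 fin ava; have dm := derivable_mom va0 fin ava.
have m0 : 0 < mom a by apply: mom_gt0; exact: fin.
have -> : nu P Z0 = (@ln R) \o mom by [].
have Hm : is_derive a 1 mom ('D_1 mom a) by split.
have Hl := is_derive1_ln m0.
by have [] := is_derive1_comp Hl Hm.
Qed.

(** If the inequality failed for every q in (1, 2], nu(s)/s would have a critical point in (0,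
    theta], whereas theta lies strictly below the infimum [theta0] of such points. *)
Lemma exponent_gap (theta : R) : 0 < theta -> (theta%:E < theta0 P Z0)%E ->
  exists q : R, [/\ 1 < q, q <= 2 & nu P Z0 (q * theta) < q * nu P Z0 theta].
Proof.
move=> th0 thlt; apply: contrapT => H.
have Hq q : 1 < q -> q <= 2 -> q * nu P Z0 theta <= nu P Z0 (q * theta).
  by move=> q1 q2; rewrite leNgt; apply/negP => q3; apply: H; exists q.
have [va va0 fin] := HA1.
have m0 : 1 < mom 0 by apply: mom0_gt1; apply: fin; rewrite oppr_lt0.
have f00 : 0 < nu P Z0 0 by exact: ln_gt0.
have [s [s0 sth fs]] :=
  ratio_critical_point va0 th0 (fun s => @derivable_nu va s va0 fin) f00 Hq.
have : (theta0 P Z0 <= s%:E)%E by apply: ereal_inf_lbound; exists s.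
by move=> /(lt_le_trans thlt); rewrite lte_fin ltNge sth.
Qed.

End Moments.

(** * Integration against an independent variable, and means over a generation *)

Section IndependentProduct.
Context {d d' : measure_display} {T : measurableType d} {S : measurableType d'} {R : realType}.
Variables (P : probability T R) (H : set (set T)) (X : T -> S).
Hypotheses (Hm : H `<=` measurable) (mX : measurable_fun setT X).
Hypothesis ind : forall A B, <<s H >> A -> measurable B ->
  P (A `&` X @^-1` B) = (P A * P (X @^-1` B))%E.

(** The identity, seen as a map from [T] into [T] with the sigma-algebra generated by [H], is the
    variable independent of [X] to which [independent_integral] applies. *)
Lemma sub_measurable_integral (f : T * S -> \bar R) :
  measurable_fun [set: (g_sigma_algebraType H * S)%type]
    (f : (g_sigma_algebraType H * S)%type -> \bar R) ->
  (forall z, 0 <= f z)%E ->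
  (\int[P]_w f (w, X w) = \int[P]_w \int[P]_w' f (w, X w'))%E.
Proof.
move=> mf f0.
apply: (@independent_integral _ _ _ T R (g_sigma_algebraType H) S P id X _ mX _ f) => //.
by move=> _ A mA; rewrite setTI; apply: smallest_sub mA => //; exact: sigma_algebra_measurable.
Qed.

Lemma sub_measurable_integralM (f : T -> R) (g : S -> R) :
  sub_measurable H f -> measurable_fun setT g ->
  (forall w, 0 <= f w) -> (forall y, 0 <= g y) ->
  (\int[P]_w (f w * g (X w))%:E = \int[P]_w (f w)%:E * \int[P]_w (g (X w))%:E)%E.
Proof.
move=> mf mg f0 g0.
have mf' : measurable_fun setT f by exact: measurable_g_sigma_weaken mf.
have mgX : measurable_fun setT (fun w => g (X w)) by exact: measurableT_comp.
rewrite (@sub_measurable_integral (fun z => (f z.1 * g z.2)%:E)) /=; last 2 first.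
- apply/measurable_EFinP; apply: measurable_funM.
    exact: (measurableT_comp mf measurable_fst).
  exact: (measurableT_comp mg measurable_snd).
- by move=> z; rewrite lee_fin mulr_ge0.
rewrite -ge0_integralZr //; last 3 first.
- exact/measurable_EFinP.
- by move=> w _; rewrite lee_fin.
- by apply: integral_ge0 => w _; rewrite lee_fin.
apply: eq_integral => w _; under eq_integral do rewrite EFinM.
rewrite ge0_integralZl //.
- exact/measurable_EFinP.
- by move=> w' _; rewrite lee_fin.
- by rewrite lee_fin.
Qed.

End IndependentProduct.

(** Fatou's lemma, for integrands such as absolute values of partial sums, which are not monotone in
    [K]. *)
Lemma integral_near_le (d : measure_display) (T : measurableType d) (R : realType)
    (P : probability T R) (f_ : nat -> T -> R) (f : T -> R) (M : \bar R) :
  (forall K, measurable_fun setT (f_ K)) -> (forall K w, 0 <= f_ K w) ->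
  (forall w, f_ K w @[K --> \oo] --> f w) ->
  (forall K, \int[P]_w (f_ K w)%:E <= M)%E -> (\int[P]_w (f w)%:E <= M)%E.
Proof.
move=> mf f0 near le_M.
have -> : (\int[P]_w (f w)%:E = \int[P]_w limn_einf (fun K => (f_ K w)%:E))%E.
  apply: eq_integral => w _.
  have : (f_ K w)%:E @[K --> \oo] --> (f w)%:E by apply: cvg_EFin; [exact: nearW|exact: near].
  by move=> /cvg_limn_einf_sup[-> _].
apply: le_trans (fatou _ _ _ _) _ => //.
- by move=> K; exact/measurable_EFinP.
- by move=> K w _; rewrite lee_fin.
rewrite limn_einf_lim; apply: lime_le; first exact: is_cvg_einfs.
apply: nearW => K; rewrite /einfs; apply: (@le_trans _ _ (\int[P]_w (f_ K w)%:E)%E) => //.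
by apply: ereal_inf_lbound; exists K => /=.
Qed.

Section TreeExpectation.
Context {d : measure_display} {T : measurableType d} {R : realType}.
Variables (P : probability T R) (Z : seq nat -> T -> config R).
Hypothesis mZ : forall u, measurable_fun setT (Z u).

Definition others (v : seq nat) : set (set T) :=
  \bigcup_(u in [set u | u != v]) g_sigma_algebra_preimage (Z u).

Hypothesis indZ : forall v A B, <<s others v >> A -> measurable B ->
  P (A `&` Z v @^-1` B) = (P A * P (Z v @^-1` B))%E.

Let om w u := Z u w.

Lemma others_measurable v : others v `<=` measurable.
Proof. by move=> A [u _ [B mB <-]]; exact: mZ. Qed.

Lemma sub_measurable_others v u : u != v -> sub_measurable (others v) (Z u).
Proof.
move=> uv _ B mB; apply: sub_sigma_algebra; exists u => //.
by exists B.
Qed.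

(** Induction on the last generation: whether [v] of length n is alive and where it sits depend on
    strictly shorter labels only, hence are independent of [Z v], whose exponential sum contributes
    one factor [m]. *)
Lemma integral_exp_pos (al m : R) (n : nat) : 0 <= m ->
  (forall u, \int[P]_w (psum al (Z u w))%:E = m%:E)%E ->
  (\int[P]_w (\sum_(v <- gen n (om w)) expR (al * pos v (om w)))%:E = (m ^+ n)%:E)%E.
Proof.
move=> m0 Em; elim: n => [|n IH].
  under eq_integral do rewrite big_seq1 /pos big_ord0 mulr0 expR0.
  by rewrite integral_cst //= probability_setT mule1 expr0.
have mpos v : size v = n -> measurable_fun setT (fun w => expR (al * pos v (om w))).
  move=> vn; apply: measurableT_comp => //; apply: measurable_funM => //.
  by apply: (measurable_pos (n := n)) => [u _|]; [exact: mZ|rewrite vn].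
under eq_integral => w _.
  rewrite sum_genS.
  under eq_bigr => u _.
    under eq_bigr do rewrite pos_rcons mulrDr expRD.
    rewrite -mulr_sumr -psumE.
    over.
  over.
have c1 := @integral_sum_gen R d T om n (fun u _ => mZ u) P
   (fun v w => expR (al * pos v (om w)) * psum al (om w v)).
have c2 := @integral_sum_gen R d T om n (fun u _ => mZ u) P
   (fun v w => expR (al * pos v (om w))).
have {}c2 := c2 mpos (fun v w => expR_ge0 _).
have {}c1 : (\sum_(v <- words K) \int[P]_w (if v \in gen n (om w) then
    expR (al * pos v (om w)) * psum al (om w v) else 0)%:E
  @[K --> \oo] --> \int[P]_w (\sum_(v <- gen n (om w))
    expR (al * pos v (om w)) * psum al (om w v))%:E)%E.
  apply: c1 => [v vn|v w]; last by rewrite mulr_ge0 ?expR_ge0 ?psum_ge0.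
  apply: measurable_funM; first exact: mpos.
  exact: measurableT_comp (measurable_psum al) (mZ v).
rewrite IH in c2.
have c3 := cvgeZl (y := m%:E) _ c2.
rewrite exprS EFinM -(cvg_lim _ (c3 _)) //; apply/esym/cvg_lim => //.
apply: cvg_trans c1; apply: near_eq_cvg; apply: nearW => K.
rewrite ge0_sume_distrr; last by move=> v _; apply: integral_ge0 => w _; rewrite lee_fin; case: ifP.
apply: eq_bigr => v _.
transitivity (\int[P]_w ((if v \in gen n (om w) then expR (al * pos v (om w)) else 0)
    * psum al (Z v w))%:E)%E.
  by apply: eq_integral => w _; case: ifP => //; rewrite mul0r.
rewrite (sub_measurable_integralM (@others_measurable v) (mZ v) (@indZ v)
  (f := fun w => if v \in gen n (om w) then expR (al * pos v (om w)) else 0) (g := psum al));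
  last 4 first.
- have [vn|vn] := eqVneq (size v) n; last first.
    rewrite (_ : (fun w => _) = fun=> 0); first exact: measurable_cst.
    by apply/funext => w; case: ifP => // /size_gen /eqP; rewrite (negbTE vn).
  apply: (measurable_gen_ite (om := om : g_sigma_algebraType (others v) -> _)) => [u un|_].
    by apply: sub_measurable_others; apply: contraTneq un => ->; rewrite vn ltnn.
  apply: measurableT_comp => //; apply: measurable_funM => //.
  apply: (measurable_pos (om := om : g_sigma_algebraType (others v) -> _) (n := n)); last by rewrite vn.
  by move=> u un; apply: sub_measurable_others; apply: contraTneq un => ->; rewrite vn ltnn.
- exact: measurable_psum.
- by move=> w; case: ifP => // _; exact: expR_ge0.
- by move=> y; exact: psum_ge0.
by rewrite Em muleC.
Qed.

End TreeExpectation.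

(** * The weak law on one generation of the tree *)

Section TreeLLN.
Context {d d' : measure_display} {T : measurableType d} {S : measurableType d'} {R : realType}.
Variables (P : probability T R) (Z : seq nat -> T -> config R) (X : seq nat -> T -> S).
Variables (n : nat) (H : seq nat -> set (set T)).
Variables (y : seq nat -> T -> R) (q : R) (g r : S -> R) (c eps V B t : R).
Let om w u := Z u w.
Hypothesis mZ : forall u, (size u < n)%N -> measurable_fun setT (Z u).
Hypothesis mX : forall v, size v = n -> measurable_fun setT (X v).
Hypothesis Hm : forall v, size v = n -> H v `<=` measurable.
Hypothesis HZ : forall v u, size v = n -> (size u < n)%N -> sub_measurable (H v) (Z u).
Hypothesis HX : forall v v', size v = n -> size v' = n -> v != v' -> sub_measurable (H v) (X v').
Hypothesis my : forall v, size v = n -> measurable_fun setT (y v).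
Hypothesis Hy : forall v v', size v = n -> size v' = n -> sub_measurable (H v) (y v').
Hypothesis ind : forall v A B, size v = n -> <<s H v >> A -> measurable B ->
  P (A `&` X v @^-1` B) = (P A * P (X v @^-1` B))%E.
Hypotheses (mg : measurable_fun setT g) (mr : measurable_fun setT r).
Hypotheses (g0 : forall x, 0 <= g x) (r0 : forall x, 0 <= r x).
Hypotheses (c0 : 0 <= c) (eps0 : 0 <= eps) (V0 : 0 <= V) (t0 : 0 < t).
Hypothesis Eg : forall v, size v = n -> (\int[P]_w (g (X v w))%:E = c%:E)%E.
Hypothesis Eg2 : forall v, size v = n -> (\int[P]_w (g (X v w) ^+ 2)%:E <= V%:E)%E.
Hypothesis Er : forall v, size v = n -> (\int[P]_w (r (X v w))%:E = eps%:E)%E.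
Hypotheses (q1 : 1 <= q) (q2 : q <= 2).
Hypothesis Ea : (\int[P]_w (\sum_(v <- gen n (om w)) expR (y v w))%:E <= 1)%E.
Hypothesis Eb : (\int[P]_w (\sum_(v <- gen n (om w)) expR (q * y v w))%:E <= B%:E)%E.

Let ite (f : seq nat -> T -> R) v w := if v \in gen n (om w) then f v w else 0.

(** [words K] may miss part of the generation, but it is a prefix of a list that contains all of it,
    and the terms are nonnegative. *)
Let sum_ite_le (f : seq nat -> T -> R) K : (forall v w, 0 <= f v w) ->
  (forall v, size v = n -> measurable_fun setT (f v)) ->
  (\sum_(v <- [seq v <- words K | size v == n]) \int[P]_w (ite f v w)%:E <=
   \int[P]_w (\sum_(v <- gen n (om w)) f v w)%:E)%E.
Proof.
move=> f0 mf.
have mite v : measurable_fun setT (ite f v) by apply: measurable_gen_ite => // /mf.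
rewrite -ge0_integral_sum //; last 2 first.
- by move=> v; exact/measurable_EFinP.
- by move=> v w _; rewrite lee_fin /ite; case: ifP.
apply: ge0_le_integral => //.
- by move=> w _; apply: sume_ge0 => v _; rewrite lee_fin /ite; case: ifP.
- by apply: emeasurable_sum => v; exact/measurable_EFinP.
- by apply/measurable_EFinP; apply: measurable_sum_gen.
move=> w _; rewrite sumEFin lee_fin /ite -big_mkcond /= -big_filter.
have [K0 _ HK] := sum_words (f^~ w) (uniq_gen n (om w)).
rewrite -(HK (maxn K K0) (leq_maxr _ _)) big_filter big_filter_cond.
rewrite (_ : words (maxn K K0) = words K ++ drop (size (words K)) (words (maxn K K0))).
  rewrite big_cat /= -[leLHS]addr0 lerD ?sumr_ge0 //.
  rewrite big_mkcond [leRHS]big_mkcond; apply: ler_sum => v _.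
  by case: (size v == n); case: (v \in _).
have : prefix (words K) (words (maxn K K0)).
  elim: (maxn K K0) (leq_maxl K K0) => [|L IH]; first by rewrite leqn0 => /eqP ->.
  rewrite leq_eqVlt => /orP[/eqP->|]; first exact: prefix_refl.
  by rewrite ltnS => /IH; rewrite wordsS => /prefix_trans; apply; exact: prefix_prefix.
by move=> /prefixP[s ->]; rewrite drop_size_cat.
Qed.

(** [truncated_lln] is applied to the labels of length n among [words K], with weight 0 for those
    not alive; its bound is free of [K], so Fatou carries it to the whole generation. *)
Lemma tree_lln :
  (\int[P]_w `|\sum_(v <- gen n (om w)) expR (y v w) *
       (g (X v w) + r (X v w) - (c + eps))|%:E <=
   (2 * (c + eps) * B + t / 2 + V * B / (2 * t) + 2 * eps)%:E)%E.
Proof.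
pose s K := [seq v <- words K | size v == n].
pose a := ite (fun v w => expR (y v w)).
pose b := ite (fun v w => expR (q * y v w)).
(* Labels of other lengths get zero marks and the full sigma-algebra, so that what [truncated_lln]
   asks of every label is trivial there. *)
pose g' v w := if size v == n then g (X v w) else 0.
pose r' v w := if size v == n then r (X v w) else 0.
pose H' v : set (set T) := if size v == n then H v else measurable.
have H'm v : H' v `<=` measurable.
  by rewrite /H'; case: eqP => [vn|_ //]; exact: (Hm vn).
have mI (f : T -> R) : measurable_fun setT f -> sub_measurable measurable f.
  by move=> mf _ A mA; apply: sub_sigma_algebra; exact: mf.
have mab (f : R -> R) : measurable_fun setT f -> forall v,
    measurable_fun setT (ite (fun v w => f (y v w)) v).
  move=> mf v; apply: measurable_gen_ite => // vn.
  by apply: measurableT_comp => //; exact: my.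
have Hab v v' : sub_measurable (H' v) (a v').
  rewrite /H'; case: eqP => vn; last first.
    apply: mI => //. apply: (mab expR); exact: measurable_expR.
  apply: (measurable_gen_ite (om := om : g_sigma_algebraType (H v) -> _)) => [u un|v'n].
    exact: HZ.
  apply: measurableT_comp => //; exact: Hy.
have mg' v : measurable_fun setT (g' v).
  by rewrite /g'; case: eqP => // vn; apply: measurableT_comp => //; exact: mX.
have mr' v : measurable_fun setT (r' v).
  by rewrite /r'; case: eqP => // vn; apply: measurableT_comp => //; exact: mX.
have prod v (f : T -> R) (h : S -> R) : size v = n -> (forall w, 0 <= f w) ->
   sub_measurable (H' v) f -> measurable_fun setT h -> (forall x, 0 <= h x) ->
   (\int[P]_w (f w * h (X v w))%:E = \int[P]_w (f w)%:E * \int[P]_w (h (X v w))%:E)%E.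
  move=> vn f0 Hf mh h0; apply: (sub_measurable_integralM (H := H v)) => //.
  - exact: (Hm vn).
  - exact: mX.
  - by move=> A D; exact: ind.
  - by move: Hf; rewrite /H' vn eqxx.
have sE K v : v \in s K -> size v = n by rewrite mem_filter => /andP[/eqP].
apply: (@integral_near_le _ _ _ _
   (fun K w => `|\sum_(v <- s K) a v w * (g' v w + r' v w - (c + eps))|)).
- move=> K; apply: measurableT_comp => //; apply: measurable_sum => v.
  apply: measurable_funM; first by apply: (mab expR); exact: measurable_expR.
  by apply: measurable_funB => //; exact: measurable_funD.
- by [].
- move=> w; apply: cvg_near_cst.
  have [K0 _ HK] := sum_words (fun v => expR (y v w) * (g (X v w) + r (X v w) - (c + eps)))
     (uniq_gen n (om w)).
  exists K0 => // K /HK <-; congr `|_|.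
  rewrite big_filter big_mkcond [RHS]big_mkcond; apply: eq_bigr => v _.
  rewrite /a /ite /g' /r'; case: ifPn => [/eqP ->|vn].
    by rewrite eqxx; case: ifP => //; rewrite mul0r.
  by case: ifP => // /size_gen /eqP; rewrite (negbTE vn).
move=> K; apply: (@truncated_lln _ _ _ P _ (s K) H' a b g' r' c eps V B t) => //.
- by rewrite filter_uniq // uniq_words.
- by move=> v w; rewrite /a /ite; case: ifP => // _; exact: expR_ge0.
- by move=> v w; rewrite /g'; case: ifP.
- by move=> v w; rewrite /r'; case: ifP.
- move=> v; apply: (mab (fun x => expR (q * x))).
  by apply: measurableT_comp => //; apply: measurable_funM.
- move=> v v' vv'; rewrite /H'; case: eqP => vn; last by apply: mI.
  rewrite /g'; case: eqP => v'n; last exact: measurable_cst.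
  by apply: (measurableT_comp mg); exact: HX.
- move=> v f vs f0 Hf; have vn := sE _ _ vs.
  rewrite -(Eg vn) -prod //.
  by apply: eq_integral => w _; rewrite /g' vn eqxx.
- move=> v f vs f0 Hf; have vn := sE _ _ vs.
  apply: (@le_trans _ _ (\int[P]_w (f w)%:E * \int[P]_w (g (X v w) ^+ 2)%:E)%E); last first.
    by apply: lee_wpmul2l; [apply: integral_ge0 => w _; rewrite lee_fin|exact: Eg2].
  rewrite -(prod v f (fun x => g x ^+ 2)) //.
  + by rewrite le_eqVlt; apply/orP; left; apply/eqP; apply: eq_integral => w _; rewrite /g' vn eqxx.
  + exact: measurable_funX.
  + by move=> x; exact: sqr_ge0.
- move=> v f vs f0 Hf; have vn := sE _ _ vs.
  rewrite -(Er vn) -prod //.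
  by apply: eq_integral => w _; rewrite /r' vn eqxx.
- apply: le_trans Ea; apply: sum_ite_le => [v w|v vn]; first exact: expR_ge0.
  by apply: measurableT_comp => //; exact: my.
(* This goal and the next use 1 <= q <= 2: e^y <= e^(q y) when y > 0, and e^(2 y) <= e^(q y) when y
   <= 0. *)
- move=> v w; rewrite /a /b /ite; case: ifP => _; last by rewrite ltr10.
  by rewrite -[X in X < _]expR0 ltr_expR ler_expR => y0; rewrite ler_peMl // ltW.
- move=> v w; rewrite /a /b /ite; case: ifP => _; last by rewrite expr0n.
  rewrite -[X in _ <= X]expR0 ler_expR -expRM_natl ler_expR => y0.
  exact: ler_wnM2r.
- apply: le_trans Eb; apply: sum_ite_le => [v w|v vn]; first exact: expR_ge0.
  by apply: measurableT_comp => //; apply: measurable_funM => //; exact: my.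
Qed.

End TreeLLN.

(** * Measurable limits, and convergence from summable increments *)

Section SequenceLimit.
Context {d : measure_display} {T : measurableType d} {R : realType}.

Lemma cvgn_limn_esupP (u : nat -> R) :
  cvgn u <-> limn_einf (EFin \o u) = limn_esup (EFin \o u) /\
            limn_esup (EFin \o u) \is a fin_num.
Proof.
split=> [cu|[E fin]].
  have : (EFin \o u) n @[n --> \oo] --> (limn u)%:E by apply: cvg_EFin; [exact: nearW|exact: cu].
  by move=> /cvg_limn_einf_sup[-> ->].
have c : (EFin \o u) n @[n --> \oo] --> limn_esup (EFin \o u).
  apply: (@squeeze_cvge _ \oo _ R (einfs (EFin \o u)) _ (esups (EFin \o u))).
  - apply: nearW => n; apply/andP; split.
      by apply: ereal_inf_lbound; exists n => /=.
    by apply: ereal_sup_ubound; exists n => /=.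
  - by rewrite -E limn_einf_lim; exact: is_cvg_einfs.
  - by rewrite limn_esup_lim; exact: is_cvg_esups.
apply/cvg_ex; exists (fine (limn_esup (EFin \o u))).
by move: c; rewrite -{1}(fineK fin) => /fine_cvg.
Qed.

(** [limn] takes the default [point] on divergent sequences, so it is a case distinction on the
    measurable event that the lower and upper limits agree and are finite. *)
Lemma measurable_limn (u : nat -> T -> R) :
  (forall n, measurable_fun setT (u n)) -> measurable_fun setT (fun w => limn (u^~ w)).
Proof.
move=> mu.
have msup : measurable_fun setT (fun w => limn_esup (fun n => (u n w)%:E)).
  by apply: measurable_fun_limn_esup => n; exact/measurable_EFinP.
have minf : measurable_fun setT (fun w => limn_einf (fun n => (u n w)%:E)).
  rewrite /limn_einf; apply: measurableT_comp => //.
  by apply: measurable_fun_limn_esup => n; apply: measurableT_comp => //; exact/measurable_EFinP.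
rewrite (_ : (fun w => _) = fun w =>
   if [&& limn_einf (fun n => (u n w)%:E) == limn_esup (fun n => (u n w)%:E),
     (-oo < limn_esup (fun n => (u n w)%:E))%E & (limn_esup (fun n => (u n w)%:E) < +oo)%E]
   then fine (limn_esup (fun n => (u n w)%:E)) else point).
  apply: measurable_fun_ifT => //.
    apply: measurable_and; first exact: measurable_fun_eqe.
    by apply: measurable_and; exact: measurable_fun_lte.
  by apply: measurableT_comp msup; exact: fine_measurable.
apply/funext => w; case: ifPn => [/and3P[/eqP E ny py]|H].
  have fin : limn_esup (EFin \o u^~ w) \is a fin_num.
    by rewrite fin_numE -ltNye -ltey ny py.
  have cu : cvgn (u^~ w) by apply/cvgn_limn_esupP.
  have : (EFin \o u^~ w) n @[n --> \oo] --> (limn (u^~ w))%:E by apply: cvg_EFin; [exact: nearW|exact: cu].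
  by move=> /cvg_limn_einf_sup[_]; rewrite /comp => ->.
apply: dvgP => /cvgn_limn_esupP[E fin]; move/negP: H; apply.
move: fin; rewrite fin_numE -ltNye -ltey => /andP[].
by rewrite /comp => -> ->; rewrite !andbT; apply/eqP.
Qed.

Lemma limn_ge0 (u : nat -> R) : (forall n, 0 <= u n) -> 0 <= limn u.
Proof.
move=> u0; have [cu|du] := pselect (cvgn u); last by rewrite (dvgP du).
by apply: limr_ge => //; exact: nearW.
Qed.

End SequenceLimit.

Section SummableIncrements.
Context {d : measure_display} {T : measurableType d} {R : realType}.
Variables (P : probability T R) (W : nat -> T -> R) (C rho : R).
Hypotheses (mW : forall n, measurable_fun setT (W n)) (C0 : 0 <= C).
Hypotheses (rho0 : 0 <= rho) (rho1 : rho < 1).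
Hypothesis incr : forall n, (\int[P]_w `|W n.+1 w - W n w|%:E <= (C * rho ^+ n)%:E)%E.

Let mD n : measurable_fun setT (fun w => `|W n.+1 w - W n w|%:E).
Proof.
by apply/measurable_EFinP; apply: measurableT_comp => //; exact: measurable_funB.
Qed.

Let tail N : (\int[P]_w (\sum_(N <= n <oo) `|W n.+1 w - W n w|%:E) <=
   (C * rho ^+ N / (1 - rho))%:E)%E.
Proof.
under eq_integral do rewrite -nneseries_addn //.
rewrite integral_nneseries => [||n|n w _] //.
rewrite (@nneseries_addn _ (fun n => \int[P]_w `|W n.+1 w - W n w|%:E)%E N); last first.
  by move=> n; apply: integral_ge0 => w _; rewrite lee_fin.
apply: lime_le.
  by apply: is_cvg_nneseries => n _ _; apply: integral_ge0 => w _; rewrite lee_fin.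
apply: nearW => n.
apply: (@le_trans _ _ (\sum_(N <= k < n) (C * rho ^+ k)%:E)%E); first by apply: lee_sum => k _.
rewrite sumEFin lee_fin -mulr_sumr -mulrA ler_wpM2l //.
have r1 : 0 < 1 - rho by rewrite subr_gt0.
rewrite ler_pdivlMr //.
have [Nn|nN] := leqP N n; last by rewrite big_geq ?mul0r ?exprn_ge0 // ltnW.
suff -> : (\sum_(N <= k < n) rho ^+ k) * (1 - rho) = rho ^+ N - rho ^+ n.
  by rewrite gerBl exprn_ge0.
elim: n Nn => [|n IH]; first by rewrite leqn0 => /eqP ->; rewrite big_geq // mul0r subrr.
rewrite leq_eqVlt => /orP[/eqP <-|]; first by rewrite big_geq // mul0r subrr.
by rewrite ltnS => Nn; rewrite big_nat_recr //= mulrDl IH // exprS; ring.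
Qed.

Let tail_fin_ae : {ae P, forall w, (\sum_(n <oo) `|W n.+1 w - W n w|%:E < +oo)%E}.
Proof.
have : P.-integrable setT (fun w => \sum_(n <oo) `|W n.+1 w - W n w|%:E)%E.
  apply/integrableP; split.
    by apply: ge0_emeasurable_sum => // n w _ _; rewrite lee_fin.
  apply: le_lt_trans (ltry (C * rho ^+ 0 / (1 - rho))); apply: le_trans (tail 0).
  rewrite le_eqVlt; apply/orP; left; apply/eqP; apply: eq_integral => w _.
  by rewrite gee0_abs // nneseries_ge0 // => n _ _; rewrite lee_fin.
move/(integrable_ae measurableT); apply: filterS => w /(_ Logic.I).
by rewrite ltey fin_numE => /andP[].
Qed.

(** The total variation of the sequence has finite mean, hence is almost surely finite, and the
    telescoping series converges absolutely. *)
Lemma cvg_increments_ae : {ae P, forall w, cvgn (W^~ w)}.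
Proof.
apply: filterS tail_fin_ae => w fin.
pose u n := W n.+1 w - W n w.
have : cvgn [normed series u].
  apply: nondecreasing_is_cvgn.
    by apply/nondecreasing_seqP => n; rewrite /= /series /= big_nat_recr //= lerDl.
  exists (fine (\sum_(n <oo) `|u n|%:E)%E) => _ [n _ <-].
  rewrite -lee_fin fineK; last first.
    by rewrite ge0_fin_numE // nneseries_ge0 // => k _ _; rewrite lee_fin.
  rewrite /series /= -sumEFin; apply: nneseries_lim_ge => k _ _.
  by rewrite lee_fin.
move/normed_cvg => cu.
have -> : W^~ w = (fun n => W 0%N w + series u n).
  apply/funext => n; rewrite /series /= /u.
  by rewrite telescope_sumr // addrC subrK.
by apply: is_cvgD => //; exact: is_cvg_cst.
Qed.

(** Almost surely the distance to the limit is at most the remaining variation, whose mean is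
    bounded by a geometric tail. *)
Lemma L1_increments n :
  (\int[P]_w `|W n w - limn (W^~ w)|%:E <= (C * rho ^+ n / (1 - rho))%:E)%E.
Proof.
apply: le_trans (tail n); apply: ae_ge0_le_integral => //.
- apply/measurable_EFinP; apply: measurableT_comp => //; apply: measurable_funB => //.
  exact: measurable_limn.
- by move=> w _; apply: nneseries_ge0 => k _ _; rewrite lee_fin.
- under eq_fun do rewrite -nneseries_addn //.
  by apply: ge0_emeasurable_sum => // k w _ _; rewrite lee_fin.
apply: filterS cvg_increments_ae => w cW _.
have : `|W n w - W k w|%:E @[k --> \oo] --> `|W n w - limn (W^~ w)|%:E.
  apply: cvg_EFin; first exact: nearW.
  by apply: cvg_norm; apply: cvgB; [exact: cvg_cst|exact: cW].
move=> c; rewrite -(cvg_lim _ c) //; apply: lime_le; first by apply/cvg_ex; eexists; exact: c.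
exists n => // k /= nk.
apply: (@le_trans _ _ (\sum_(n <= j < k) `|W j.+1 w - W j w|%:E)%E).
  rewrite sumEFin lee_fin distrC -(telescope_sumr (W^~ w) nk); exact: ler_norm_sum.
by apply: nneseries_lim_ge => j _ _; rewrite lee_fin.
Qed.

End SummableIncrements.

(** * Offspring sums and their truncation by family size *)

Section ConfigInequalities.
Context {R : realType}.
Implicit Types (s : config R) (al K : R).

(** Cauchy-Schwarz over the children, through 2ab <= a^2 + b^2. On families of bounded size it
    trades a second moment for the exponential moment at 2 al. *)
Lemma psum_sqr_le al s : psum al s ^+ 2 <= (size s)%:R * psum (2 * al) s.
Proof.
pose a (j : 'I_(size s)) := expR (al * nth 0 (s : seq R) j).
have a2 j : a j ^+ 2 = expR (2 * al * nth 0 (s : seq R) j).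
  by rewrite /a -expRM_natl; congr expR; ring.
have -> : psum (2 * al) s = \sum_j a j ^+ 2.
  by rewrite psumE; apply: eq_bigr => j _; rewrite a2.
have -> : psum al s = \sum_j a j by rewrite psumE.
rewrite expr2 big_distrlr /=.
apply: (@le_trans _ _ (\sum_i \sum_j (a i ^+ 2 + a j ^+ 2) / 2)).
  apply: ler_sum => i _; apply: ler_sum => j _.
  by have := sqr_ge0 (a i - a j); nra.
set S := (\sum_j a j ^+ 2).
rewrite (_ : \sum_i \sum_j _ = \sum_i (a i ^+ 2 * (size s)%:R + S) / 2); last first.
  apply: eq_bigr => i _.
  by rewrite -mulr_suml big_split /= sumr_const card_ord mulr_natr.
rewrite -mulr_suml big_split /= -mulr_suml -/S sumr_const card_ord -mulr_natr.
by rewrite le_eqVlt; apply/orP; left; apply/eqP; field.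
Qed.

(** Termwise x <= (K + x^2 / K) / 2; the free parameter [K] is used later to balance the two
    contributions. *)
Lemma psum_le_amgm al K s : 0 < K ->
  psum al s <= ((size s)%:R * K + psum (2 * al) s / K) / 2.
Proof.
move=> K0; rewrite !psumE.
have -> : (size s)%:R * K = \sum_(j < size s) K.
  by rewrite sumr_const card_ord mulr_natl.
rewrite [X in _ + X]mulr_suml -big_split /= mulr_suml; apply: ler_sum => j _.
have -> : expR (2 * al * nth 0 (s : seq R) j) = expR (al * nth 0 (s : seq R) j) ^+ 2.
  by rewrite -expRM_natl; congr expR; ring.
set x := expR _; rewrite -subr_ge0.
rewrite (_ : _ - _ = (x - K) ^+ 2 / (2 * K)); last by field; exact: lt0r_neq0.
by rewrite divr_ge0 ?sqr_ge0 // mulr_ge0 // ltW.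
Qed.

End ConfigInequalities.

Section OffspringTruncation.
Context {d : measure_display} {T : measurableType d} {R : realType}.
Variables (P : probability T R) (Z0 : {mfun T >-> config R}) (al : R).

(** The cut is on the family size and not on the value of the sum, because the size is what
    [psum_sqr_le] multiplies by and what has a moment of order 1 + p. *)
Definition trunc_lo (M : R) (s : config R) : R := if (size s)%:R <= M then psum al s else 0.
Definition trunc_hi (M : R) (s : config R) : R := if (size s)%:R <= M then 0 else psum al s.

Lemma measurable_size : measurable_fun [set: config R] (fun s => (size s)%:R : R).
Proof.
rewrite (_ : (fun s => _) = psum 0); first exact: measurable_psum.
by apply/funext => s; rewrite psumE; under eq_bigr do rewrite mul0r expR0;
  rewrite sumr_const card_ord.
Qed.

Lemma measurable_trunc_lo M : measurable_fun setT (trunc_lo M).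
Proof.
apply: measurable_fun_ifT => //; last exact: measurable_psum.
by apply: measurable_fun_ler => //; exact: measurable_size.
Qed.

Lemma measurable_trunc_hi M : measurable_fun setT (trunc_hi M).
Proof.
apply: measurable_fun_ifT => //; last exact: measurable_psum.
by apply: measurable_fun_ler => //; exact: measurable_size.
Qed.

Lemma trunc_lo_ge0 M s : 0 <= trunc_lo M s.
Proof. by rewrite /trunc_lo; case: ifP => // _; exact: psum_ge0. Qed.

Lemma trunc_hi_ge0 M s : 0 <= trunc_hi M s.
Proof. by rewrite /trunc_hi; case: ifP => // _; exact: psum_ge0. Qed.

Lemma integral_trunc_lo_sqr (M : R) : 0 <= M -> (moment P Z0 (2 * al) < +oo)%E ->
  (\int[P]_w (trunc_lo M (Z0 w) ^+ 2)%:E <= (M * mom P Z0 (2 * al))%:E)%E.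
Proof.
move=> M0 fin; rewrite EFinM -momE // /moment -ge0_integralZl //; last 2 first.
- exact/measurable_EFinP/measurable_psumZ.
- by move=> w _; rewrite lee_fin psum_ge0.
apply: ge0_le_integral => //.
- by move=> w _; rewrite lee_fin sqr_ge0.
- apply/measurable_EFinP/measurable_funX.
  exact: measurableT_comp (measurable_trunc_lo M) (measurable_funPT Z0).
- apply/measurable_EFinP/measurable_funM => //; exact: measurable_psumZ.
move=> w _; rewrite -EFinM lee_fin /trunc_lo; case: ifP => sM; last first.
  by rewrite expr0n /= mulr_ge0 // psum_ge0.
by apply: le_trans (psum_sqr_le _ _) _; rewrite ler_wpM2r // psum_ge0.
Qed.

Lemma integral_trunc_hi (p C3 M K : R) : 0 < p -> 0 < M -> 0 < K ->
  (\int[P]_w (((size (Z0 w))%:R : R) `^ (1 + p))%:E = C3%:E)%E ->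
  (moment P Z0 (2 * al) < +oo)%E ->
  (\int[P]_w (trunc_hi M (Z0 w))%:E <=
    ((K * M `^ (- p) * C3 + K^-1 * mom P Z0 (2 * al)) / 2)%:E)%E.
Proof.
move=> p0 M0 K0 E3 fin.
have K0' : 0 <= K / 2 * M `^ (- p) by rewrite mulr_ge0 ?powR_ge0 // divr_ge0 // ltW.
have K1' : 0 <= K^-1 / 2 by rewrite divr_ge0 // invr_ge0 ltW.
have msz : measurable_fun setT (fun w => ((size (Z0 w))%:R : R) `^ (1 + p)).
  apply: (@measurableT_comp _ _ _ _ _ _ (@powR R ^~ (1 + p))); first exact: measurable_powR.
  exact: measurableT_comp measurable_size (measurable_funPT Z0).
have -> : ((K * M `^ (- p) * C3 + K^-1 * mom P Z0 (2 * al)) / 2)%:E =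
   ((K / 2 * M `^ (- p))%:E * C3%:E + (K^-1 / 2)%:E * (mom P Z0 (2 * al))%:E)%E.
  by rewrite -!EFinM -EFinD; congr (_%:E); field; exact: lt0r_neq0.
rewrite -E3 -momE // /moment -ge0_integralZl //; last first.
  exact/measurable_EFinP.
rewrite -ge0_integralZl //; last 2 first.
- exact/measurable_EFinP/measurable_psumZ.
- by move=> w _; rewrite lee_fin psum_ge0.
rewrite -ge0_integralD //; last 4 first.
- by move=> w _; rewrite -EFinM lee_fin mulr_ge0 // powR_ge0.
- by apply/measurable_EFinP/measurable_funM.
- by move=> w _; rewrite -EFinM lee_fin mulr_ge0 // psum_ge0.
- by apply/measurable_EFinP/measurable_funM => //; exact: measurable_psumZ.
apply: ge0_le_integral => //.
- by move=> w _; rewrite lee_fin trunc_hi_ge0.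
- apply/measurable_EFinP.
  exact: measurableT_comp (measurable_trunc_hi M) (measurable_funPT Z0).
- apply/measurable_EFinP/measurable_funD; apply: measurable_funM => //.
  exact: measurable_psumZ.
move=> w _; rewrite -!EFinM -EFinD lee_fin /trunc_hi; case: ifPn => sM.
  by rewrite addr_ge0 // mulr_ge0 ?powR_ge0 ?psum_ge0.
apply: le_trans (psum_le_amgm al (Z0 w) K0) _.
rewrite -/(psum (2 * al) (Z0 w)); set N := ((size (Z0 w))%:R : R) in sM *.
rewrite -ltNge in sM; have N0 : 0 < N by apply: lt_trans sM.
(* Writing N as N^(1+p) N^(-p) and using N > M gives N <= N^(1+p) M^(-p): here the moment of order 1
   + p is spent. *)
have NE : N = N `^ (1 + p) * N `^ (- p).
  by rewrite -powRD ?(gt_eqF N0) ?implybT // addrK powRr1 // ltW.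
have : N `^ (- p) <= M `^ (- p).
  rewrite !powRN lef_pV2 ?posrE ?powR_gt0 //; apply: ge0_ler_powR; rewrite ?nnegrE ltW //.
move=> /(ler_wpM2l (powR_ge0 N (1 + p))); rewrite -NE => /(ler_wpM2l (ltW K0)).
lra.
Qed.

End OffspringTruncation.

Lemma has_law_integral (R : realType) (d d' d2 : measure_display) (T : measurableType d)
    (T2 : measurableType d2) (S : measurableType d') (P : probability T R) (Q : probability T2 R)
    (X : {mfun T >-> S}) (X' : {mfun T2 >-> S}) (f : S -> \bar R) :
  has_law P X (pushforward Q X') -> measurable_fun setT f -> (forall s, 0 <= f s)%E ->
  (\int[P]_w f (X w) = \int[Q]_w f (X' w))%E.
Proof.
move=> XX' mf f0.
have := ge0_integral_distribution (P := P) X mf f0.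
have := ge0_integral_distribution (P := Q) X' mf f0.
rewrite /= /comp => <- <-; apply: eq_measure_integral => A mA _; exact: XX'.
Qed.

(** * Geometric decay of the martingale increments in L1 *)

Section MartingaleIncrements.
Context {d : measure_display} {T : measurableType d} {R : realType}.
Variables (P : probability T R) (Z : seq nat -> {mfun T >-> config R}).
Hypothesis Zid : forall u, same_law P (Z u) (Z [::]).
Hypothesis HA1 : assumption_A1 P (Z [::]).
Hypothesis HA2 : assumption_A2 P (Z [::]).
Hypothesis HA3 : assumption_A3 P (Z [::]).
Variable theta : R.
Hypotheses (theta_gt0 : 0 < theta) (theta_lt : (theta%:E < theta0 P (Z [::]))%E).
Hypothesis indZ : forall v A B, <<s others (fun u => Z u : T -> config R) v >> A ->
  measurable B -> P (A `&` Z v @^-1` B) = (P A * P (Z v @^-1` B))%E.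

Let om w u := Z u w.
Let nv := nu P (Z [::]) theta.
Let m := mom P (Z [::]) theta.

(** The additive martingale with its normalisation m(theta)^n = e^(n nu) moved into the exponents,
    so that its terms are the weights e^y of [tree_lln]. *)
Definition Wt (n : nat) (o : seq nat -> config R) : R :=
  \sum_(v <- gen n o) expR (theta * pos v o - n%:R * nv).

Let fin al : 0 < al -> (moment P (Z [::]) al < +oo)%E.
Proof.
by move=> al0; have [va va0] := HA1; apply; apply: lt_trans al0; rewrite oppr_lt0.
Qed.

Let m_gt0 al : 0 < al -> 0 < mom P (Z [::]) al.
Proof. by move=> al0; apply: mom_gt0 => //; exact: fin. Qed.

Let momE_exp al : 0 < al -> mom P (Z [::]) al = expR (nu P (Z [::]) al).
Proof. by move=> al0; rewrite /nu lnK // posrE; exact: m_gt0. Qed.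

Lemma integral_psum_copy al u : 0 < al ->
  (\int[P]_w (psum al (Z u w))%:E = (mom P (Z [::]) al)%:E)%E.
Proof.
move=> al0; rewrite -momE; last exact: fin.
apply: (has_law_integral (f := fun s => (psum al s)%:E) (Zid u)).
  by apply/measurable_EFinP; exact: measurable_psum.
by move=> s; rewrite lee_fin psum_ge0.
Qed.

Lemma integral_gen_exp al n b : 0 < al ->
  (\int[P]_w (\sum_(v <- gen n (om w)) expR (al * pos v (om w) - b))%:E =
   (expR (n%:R * nu P (Z [::]) al - b))%:E)%E.
Proof.
move=> al0; transitivity ((expR (- b))%:E * (mom P (Z [::]) al ^+ n)%:E)%E; last first.
  by rewrite -EFinM momE_exp // -expRM_natl -expRD addrC.
have mZ u : measurable_fun setT (Z u) by exact: measurable_funPT.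
rewrite -(@integral_exp_pos _ _ _ P (fun u => Z u) mZ indZ al _ n (ltW (m_gt0 al0))); last first.
  by move=> u; exact: integral_psum_copy.
rewrite -ge0_integralZl //; last 2 first.
- apply/measurable_EFinP; apply: measurable_sum_gen => [u _|v vn]; first exact: measurable_funPT.
  apply: measurableT_comp => //; apply: measurable_funM => //.
  by apply: (measurable_pos (n := n)); [move=> u _; exact: measurable_funPT|rewrite vn].
- by move=> w _; rewrite lee_fin sumr_ge0 // => v _; exact: expR_ge0.
apply: eq_integral => w _; rewrite -EFinM mulr_sumr; congr (_%:E).
by apply: eq_bigr => v _; rewrite expRD mulrC.
Qed.

Lemma integral_Wt n : (\int[P]_w (Wt n (om w))%:E = 1)%E.
Proof. by rewrite integral_gen_exp // subrr expR0. Qed.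

(** [dl] is a quarter of the gap. The rate 4 dl leaves room for the family cut-off e^(dl n) and for
    the factor e^(dl n) that 1/t brings into the variance term. *)
Lemma gen_gap : exists q dl : R, [/\ 1 <= q, q <= 2, 0 < dl & forall n,
  (\int[P]_w (\sum_(v <- gen n (om w)) expR (q * (theta * pos v (om w) - n%:R * nv)))%:E
   = (expR (- 4 * (dl * n%:R)))%:E)%E].
Proof.
have [q [q1 q2 gap]] := exponent_gap HA1 HA2 theta_gt0 theta_lt.
exists q, ((q * nv - nu P (Z [::]) (q * theta)) / 4); split => //.
- exact: ltW.
- by rewrite divr_gt0 // subr_gt0.
move=> n.
have -> : - 4 * ((q * nv - nu P (Z [::]) (q * theta)) / 4 * n%:R) =
   n%:R * nu P (Z [::]) (q * theta) - q * (n%:R * nv) by field.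
rewrite -integral_gen_exp; last by rewrite mulr_gt0 //; lra.
by apply: eq_integral => w _; congr (_%:E); apply: eq_bigr => v _; congr expR; ring.
Qed.

(** Decomposition at the last generation: the sums over children, divided by m, are marks of mean 1
    attached to generation n, which is the form the weak law accepts. *)
Lemma WtS n o : Wt n.+1 o =
  \sum_(v <- gen n o) expR (theta * pos v o - n%:R * nv) * (psum theta (o v) / m).
Proof.
rewrite /Wt sum_genS; apply: eq_bigr => u _.
rewrite psumE mulr_suml mulr_sumr; apply: eq_bigr => j _.
rewrite pos_rcons /m momE_exp // -expRN -!expRD; congr expR.
by rewrite -natr1; rewrite /nv; ring.
Qed.

Lemma integral_Wt_incr : exists C rho : R, [/\ 0 <= C, 0 <= rho, rho < 1 & forall n,
  (\int[P]_w `|Wt n.+1 (om w) - Wt n (om w)|%:E <= (C * rho ^+ n)%:E)%E].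
Proof.
have [q [dl [q1 q2 dl0 Egap]]] := gen_gap.
have [p p0 E3] := HA3.
pose C3 := fine (\int[P]_w (((size (Z [::] w))%:R : R) `^ (1 + p))%:E)%E.
have C30 : (0 <= \int[P]_w (((size (Z [::] w))%:R : R) `^ (1 + p))%:E)%E.
  by apply: integral_ge0 => w _; rewrite lee_fin powR_ge0.
have {}E3 : (\int[P]_w (((size (Z [::] w))%:R : R) `^ (1 + p))%:E = C3%:E)%E.
  by rewrite /C3 fineK // ge0_fin_numE.
have {}C30 : 0 <= C3 by rewrite -lee_fin -E3.
have m0 : 0 < m by exact: m_gt0.
have t20 : 0 < 2 * theta by rewrite mulr_gt0.
pose m2 := mom P (Z [::]) (2 * theta).
have m20 : 0 < m2 by exact: m_gt0.
have fin2 := fin t20.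
(* The slower of two rates: [dl] suffices for the weight, [t] and variance terms, and [p * dl / 2]
   is that of the truncated families. *)
pose eta := Num.min dl (p * dl / 2).
have eta0 : 0 < eta by rewrite lt_min dl0 divr_gt0 // mulr_gt0.
(* The four summands are the coefficients of the four terms in the bound of [tree_lln]: heavy
   weights, [t], variance, large families. *)
exists (2 + 1 / 2 + m2 / (2 * m ^+ 2) + (C3 + m2) / m), (expR (- eta)); split.
- have cst_ge0 (x y z : R) : 0 < x -> 0 < y -> 0 <= z ->
      0 <= 2 + 1 / 2 + y / (2 * x ^+ 2) + (z + y) / x.
    by move=> x0 y0 z0; rewrite !addr_ge0 // divr_ge0 ?addr_ge0 ?mulr_ge0 ?sqr_ge0 // ltW.
  exact: cst_ge0.
- exact: expR_ge0.
- by rewrite -expR0 ltr_expR oppr_lt0.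
move=> n.
(* [K] is M^(p/2), which makes K M^(-p) and 1/K equal, both e^(- p dl n / 2). *)
pose M := expR (dl * n%:R); pose K := expR (p * dl / 2 * n%:R); pose t := expR (- (dl * n%:R)).
have M0 : 0 < M by exact: expR_gt0.
have K0 : 0 < K by exact: expR_gt0.
have t0 : 0 < t by exact: expR_gt0.
pose g (s : config R) := m^-1 * trunc_lo theta M s.
pose r (s : config R) := m^-1 * trunc_hi theta M s.
have mi0 : 0 <= m^-1 by rewrite invr_ge0 ltW.
have g0 s : 0 <= g s by rewrite mulr_ge0 // trunc_lo_ge0.
have r0 s : 0 <= r s by rewrite mulr_ge0 // trunc_hi_ge0.
have mg : measurable_fun setT g by apply: measurable_funM => //; exact: measurable_trunc_lo.
have mr : measurable_fun setT r by apply: measurable_funM => //; exact: measurable_trunc_hi.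
have grE s : g s + r s = psum theta s / m.
  by rewrite /g /r /trunc_lo /trunc_hi; case: ifP => _; rewrite mulr0 ?addr0 ?add0r mulrC.
have mgZ u : measurable_fun setT (fun w => g (Z u w)).
  exact: measurableT_comp mg (measurable_funPT (Z u)).
have mrZ u : measurable_fun setT (fun w => r (Z u w)).
  exact: measurableT_comp mr (measurable_funPT (Z u)).
have sum1 : (\int[P]_w (g (Z [::] w))%:E + \int[P]_w (r (Z [::] w))%:E = 1)%E.
  rewrite -ge0_integralD //; last 4 first.
  - by move=> w _; rewrite lee_fin.
  - exact/measurable_EFinP.
  - by move=> w _; rewrite lee_fin.
  - exact/measurable_EFinP.
  under eq_integral do rewrite -EFinD grE mulrC EFinM.
  rewrite ge0_integralZl //; last 2 first.
  - by apply/measurable_EFinP; exact: measurable_psumZ.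
  - by move=> w _; rewrite lee_fin psum_ge0.
  by rewrite integral_psum_copy // -EFinM mulVf // gt_eqF.
have Ig0 : (0 <= \int[P]_w (g (Z [::] w))%:E)%E.
  by apply: integral_ge0 => w _; rewrite lee_fin.
have Ir0 : (0 <= \int[P]_w (r (Z [::] w))%:E)%E.
  by apply: integral_ge0 => w _; rewrite lee_fin.
have Igfin : (\int[P]_w (g (Z [::] w))%:E \is a fin_num)%E.
  rewrite ge0_fin_numE //; apply: (@le_lt_trans _ _ 1%E); last by rewrite ltry.
  by rewrite -sum1 leeDl.
have Irfin : (\int[P]_w (r (Z [::] w))%:E \is a fin_num)%E.
  rewrite ge0_fin_numE //; apply: (@le_lt_trans _ _ 1%E); last by rewrite ltry.
  by rewrite -sum1 leeDr.
pose c := fine (\int[P]_w (g (Z [::] w))%:E)%E.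
pose eps := fine (\int[P]_w (r (Z [::] w))%:E)%E.
(* The two truncated means add up to that of the normalised offspring sum, so the centring [c + eps]
   in the weak law is exactly the 1 subtracted in the increment. *)
have ce1 : c + eps = 1.
  by apply/EFin_inj; rewrite EFinD !fineK.
have epsle : eps <= (expR (- (p * dl / 2 * n%:R)) * (C3 + m2) / 2) / m.
  rewrite -lee_fin fineK //.
  under eq_integral do rewrite EFinM.
  rewrite ge0_integralZl //; last 2 first.
  - apply/measurable_EFinP.
    exact: measurableT_comp (measurable_trunc_hi theta M) (measurable_funPT (Z [::])).
  - by move=> w _; rewrite lee_fin trunc_hi_ge0.
  rewrite mulrC EFinM lee_wpmul2l ?lee_fin //.
  apply: le_trans (integral_trunc_hi p0 M0 K0 E3 fin2) _.
  rewrite lee_fin ler_wpM2r // le_eqVlt; apply/orP; left; apply/eqP.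
  have -> : K * M `^ (- p) = expR (- (p * dl / 2 * n%:R)).
    by rewrite /M -expRM -expRD; congr expR; field.
  by rewrite mulrDr; congr (_ + _); rewrite -expRN.
have diffE w : Wt n.+1 (om w) - Wt n (om w) =
  \sum_(v <- gen n (om w)) expR (theta * pos v (om w) - n%:R * nv) *
     (g (Z v w) + r (Z v w) - (c + eps)).
  rewrite WtS /Wt -sumrB; apply: eq_bigr => v _.
  by rewrite grE ce1 mulrBr mulr1.
under eq_integral do rewrite diffE.
apply: (@le_trans _ _ (2 * (c + eps) * expR (- 4 * (dl * n%:R)) + t / 2 +
    (M * m2 / m ^+ 2) * expR (- 4 * (dl * n%:R)) / (2 * t) + 2 * eps)%:E).
  have my (H : set (set T)) v : (forall u, (size u < n)%N -> sub_measurable H (Z u)) ->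
      size v = n -> sub_measurable H (fun w => theta * pos v (om w) - n%:R * nv).
    move=> HZ vn; apply: measurable_funB => //; apply: measurable_funM => //.
    by apply: (measurable_pos (om := om : g_sigma_algebraType H -> _) (n := n));
      [exact: HZ|rewrite vn].
  have oZ v u : size v = n -> (size u < n)%N ->
     sub_measurable (others (fun u => Z u : T -> config R) v) (Z u).
    move=> vn un; apply: sub_measurable_others.
    by apply: contraTneq un => ->; rewrite vn ltnn.
  apply: (@tree_lln _ _ T (config R) R P (fun u => Z u) (fun u => Z u) n
     (others (fun u => Z u : T -> config R))
     (fun v w => theta * pos v (om w) - n%:R * nv) q g r c eps (M * m2 / m ^+ 2)
     (expR (- 4 * (dl * n%:R))) t) => //.
  - by move=> v _; apply: others_measurable => u; exact: measurable_funPT.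
  - by move=> v v' _ _ vv'; apply: sub_measurable_others; rewrite eq_sym.
  - move=> v vn; apply: measurable_funB => //; apply: measurable_funM => //.
    by apply: (measurable_pos (n := n)); [move=> u _; exact: measurable_funPT|rewrite vn].
  - move=> v v' vn v'n; apply: my => // u un; exact: oZ.
  - by move=> v A B _; exact: indZ.
  - exact: fine_ge0.
  - exact: fine_ge0.
  - by rewrite divr_ge0 ?sqr_ge0 // mulr_ge0 // ltW.
  - move=> v _; rewrite /c fineK //.
    apply: (has_law_integral (f := fun s => (g s)%:E) (Zid v)); first exact/measurable_EFinP.
    by move=> s; rewrite lee_fin.
  - move=> v _; rewrite (has_law_integral (f := fun s => (g s ^+ 2)%:E) (Zid v)); last 2 first.
    + by apply/measurable_EFinP; exact: measurable_funX.
    + by move=> s; rewrite lee_fin sqr_ge0.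
    under eq_integral do rewrite exprMn EFinM.
    rewrite ge0_integralZl //; last 3 first.
    + apply/measurable_EFinP/measurable_funX.
      exact: measurableT_comp (measurable_trunc_lo theta M) (measurable_funPT (Z [::])).
    + by move=> w _; rewrite lee_fin sqr_ge0.
    + by rewrite lee_fin sqr_ge0.
    rewrite [leRHS]EFinM muleC exprVn lee_wpmul2r ?lee_fin ?invr_ge0 ?sqr_ge0 //.
    by apply: integral_trunc_lo_sqr => //; exact: ltW.
  - move=> v _; rewrite /eps fineK //.
    apply: (has_law_integral (f := fun s => (r s)%:E) (Zid v)); first exact/measurable_EFinP.
    by move=> s; rewrite lee_fin.
  - by have := integral_Wt n; rewrite /Wt => ->.
  - by rewrite Egap.
rewrite lee_fin ce1 mulr1 -expRM_natl.
have e1 : expR (- (dl * n%:R)) <= expR (n%:R * - eta).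
  by rewrite ler_expR mulrN lerN2 mulrC ler_wpM2r // ge_min lexx.
have e2 : expR (- (p * dl / 2 * n%:R)) <= expR (n%:R * - eta).
  by rewrite ler_expR mulrN lerN2 mulrC ler_wpM2r // ge_min lexx orbT.
have nd0 : 0 <= dl * n%:R by rewrite mulr_ge0 // ltW.
have e4 : expR (- 4 * (dl * n%:R)) <= expR (n%:R * - eta).
  by apply: le_trans e1; rewrite ler_expR; lra.
have e3 : M * expR (- 4 * (dl * n%:R)) / t <= expR (n%:R * - eta).
  by apply: le_trans e1; rewrite /M /t -expRN -!expRD ler_expR; lra.
set E := expR (n%:R * - eta) in e1 e2 e3 e4 *.
rewrite [leRHS](_ : _ = 2 * E + 1 / 2 * E + m2 / (2 * m ^+ 2) * E + (C3 + m2) / m * E);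
  last by ring.
apply: lerD; last first.
  apply: (@le_trans _ _ (expR (- (p * dl / 2 * n%:R)) * (C3 + m2) / m)).
    by move: epsle; lra.
  rewrite (_ : _ / m = (C3 + m2) / m * expR (- (p * dl / 2 * n%:R))); last by ring.
  by rewrite ler_wpM2l // divr_ge0 ?addr_ge0 // ltW.
apply: lerD; last first.
  have -> : M * m2 / m ^+ 2 * expR (- 4 * (dl * n%:R)) / (2 * t) =
     m2 / (2 * m ^+ 2) * (M * expR (- 4 * (dl * n%:R)) / t).
    by field; rewrite !gt_eqF.
  by rewrite ler_wpM2l // divr_ge0 ?mulr_ge0 ?sqr_ge0 // ltW.
by apply: lerD; [rewrite ler_wpM2l|rewrite /t; lra].
Qed.

End MartingaleIncrements.

(** * Subfamilies, and the law of a whole environment *)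

Section IndependenceReindexing.
Context {d : measure_display} {T : measurableType d} {R : realType}.
Variable P : probability T R.

Lemma mutually_independent_sub (I : choiceType) (F G : I -> set (set T)) :
  (forall i, G i `<=` F i) -> mutually_independent P F -> mutually_independent P G.
Proof. by move=> GF indF J A JA; apply: indF => i /JA /GF. Qed.

(** Events are transported along [f], with the sure event off its range. This extracts the
    displacements from the joint family, and the subtree of a child from the whole tree. *)
Lemma mutually_independent_inj (I K : choiceType) (f : I -> K) (F : K -> set (set T)) :
  injective f -> mutually_independent P F -> mutually_independent P (F \o f).
Proof.
move=> finj indF J A JA.
pose A' k : set T := if pselect (exists i, f i = k) is left e then A (projT1 (cid e)) else setT.
have A'E i : A' (f i) = A i.
  rewrite /A'; case: pselect => [e|[]]; last by exists i.
  by case: cid => i' /= /finj ->.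
have := indF (f @` J)%fset A'.
rewrite big_imfset /=; last by move=> i i' _ _ /finj.
under [X in _ -> _ = X]eq_bigr do rewrite -A'E.
move=> <-; last by move=> k /imfsetP[i /= iJ ->]; rewrite A'E; exact: JA.
congr (P _); apply/seteqP; split => w H.
  by move=> k /imfsetP[i /= iJ ->]; rewrite A'E; exact: H.
by move=> i /= iJ; rewrite -A'E; apply: H; apply/imfsetP; exists i.
Qed.

End IndependenceReindexing.

Section Environment.
Context {R : realType}.

(** Generators of the product sigma-algebra. The martingale limit reads infinitely many labels, so
    equality in law of two trees has to be stated for whole environments. *)
Definition cylinders : set (set (seq nat -> config R)) :=
  [set C | exists (J : {fset seq nat}) (A : seq nat -> set (config R)),
     (forall u, measurable (A u)) /\ C = [set o | forall u, u \in J -> A u (o u)]].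

Definition env := g_sigma_algebraType cylinders.

HB.instance Definition _ := Measurable.on env.

Lemma measurable_coord u : measurable_fun [set: env] (fun o : env => o u).
Proof.
move=> _ B mB; rewrite setTI; apply: sub_sigma_algebra.
exists [fset u]%fset, (fun=> B); split => //; apply/seteqP; split => o /=.
  by move=> Bo v; rewrite inE => /eqP ->.
by apply; rewrite inE.
Qed.

Context {d : measure_display} {T : measurableType d}.

Lemma measurable_env (om : T -> env) :
  (forall u, measurable_fun setT (fun w => om w u)) -> measurable_fun setT om.
Proof.
move=> mom; apply: (@measurability _ _ _ env _ om cylinders) => //.
move=> _ [_ [J [A [mA ->]]] <-]; rewrite setTI.
rewrite (_ : _ @^-1` _ = \bigcap_(u in [set` J]) ((fun w => om w u) @^-1` A u)) //.
by apply: fin_bigcap_measurable => // u _; rewrite -[X in measurable X]setTI; exact: mom.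
Qed.

(** Cylinders form a pi-system on which independence turns the probability into a product of
    marginals, so equal marginals force equal laws. *)
Lemma env_law (P : probability T R) (X X' : seq nat -> {mfun T >-> config R}) :
  mutually_independent P (fun u => g_sigma_algebra_preimage (X u)) ->
  mutually_independent P (fun u => g_sigma_algebra_preimage (X' u)) ->
  (forall u, same_law P (X u) (X' u)) ->
  forall B : set env, measurable B ->
    P ((fun w => (fun u => X u w) : env) @^-1` B) =
    P ((fun w => (fun u => X' u w) : env) @^-1` B).
Proof.
move=> indX indX' XX' B mB.
have mX : measurable_fun setT (fun w => (fun u => X u w) : env).
  by apply: measurable_env => u; exact: measurable_funPT.
have mX' : measurable_fun setT (fun w => (fun u => X' u w) : env).
  by apply: measurable_env => u; exact: measurable_funPT.
pose Xm : {mfun T >-> env} := HB.pack (fun w => (fun u => X u w) : env)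
  (isMeasurableFun.Build _ _ _ _ _ mX).
pose Xm' : {mfun T >-> env} := HB.pack (fun w => (fun u => X' u w) : env)
  (isMeasurableFun.Build _ _ _ _ _ mX').
apply: (@g_sigma_algebra_measure_unique _ _ env cylinders _ (fun=> setT) _ _
  (distribution P Xm) (distribution P Xm')) => //.
- by move=> A cA; exact: sub_sigma_algebra.
- move=> _; exists fset0, (fun=> setT); split => //.
  by apply/seteqP; split.
- by rewrite bigcup_const.
- move=> _ _ [J1 [A1 [mA1 ->]]] [J2 [A2 [mA2 ->]]].
  exists (J1 `|` J2)%fset, (fun u => (if u \in J1 then A1 u else setT) `&`
      (if u \in J2 then A2 u else setT)); split.
    by move=> u; apply: measurableI; case: ifP.
  apply/seteqP; split => o /=.
    by move=> [H1 H2] u _; split; case: ifPn => // uJ; [exact: H1|exact: H2].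
  move=> H; split => u uJ; have := H u; rewrite inE uJ ?orbT => /(_ isT) []; rewrite ?uJ //.
- move=> _ [J [A [mA ->]]].
  transitivity (P (\bigcap_(u in [set` J]) (X u @^-1` A u))); first by [].
  transitivity (P (\bigcap_(u in [set` J]) (X' u @^-1` A u))); last by [].
  rewrite indX; last by move=> u _; exists (A u) => //; rewrite setTI.
  rewrite indX'; last by move=> u _; exists (A u) => //; rewrite setTI.
  by apply: eq_bigr => u _; exact: XX'.
- by move=> _; apply: le_lt_trans (probability_le1 _ measurableT) (ltry 1).
Qed.

End Environment.

Lemma cvgn_sum (R : realType) (J : Type) (r : seq J) (f : J -> nat -> R) (l : J -> R) :
  (forall j, f j n @[n --> \oo] --> l j) ->
  (\sum_(j <- r) f j n) @[n --> \oo] --> \sum_(j <- r) l j.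
Proof.
move=> fl; elim: r => [|j r IH].
  by rewrite big_nil; under eq_fun do rewrite big_nil; exact: cvg_cst.
by rewrite big_cons; under eq_fun do rewrite big_cons; exact: cvgD.
Qed.

Section PreimageSigma.
Context {d d' : measure_display} {T : measurableType d} {S : measurableType d'}.

Lemma g_sigma_preimage_measurable (X : T -> S) : measurable_fun setT X ->
  g_sigma_algebra_preimage X `<=` measurable.
Proof. by move=> mX A [B mB <-]; exact: mX. Qed.

Lemma g_sigma_preimage_setI (X : T -> S) : setI_closed (g_sigma_algebra_preimage X).
Proof.
move=> A A' [B mB <-] [B' mB' <-]; exists (B `&` B'); first exact: measurableI.
by rewrite !setTI preimage_setI.
Qed.

Lemma g_sigma_preimage_setT (X : T -> S) : g_sigma_algebra_preimage X setT.
Proof. by exists setT => //; rewrite setTI preimage_setT. Qed.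

Lemma g_sigma_preimage_mem (X : T -> S) B : measurable B ->
  g_sigma_algebra_preimage X (X @^-1` B).
Proof. by move=> mB; exists B => //; rewrite setTI. Qed.

End PreimageSigma.

(** * The martingale limit: mean, recursive equation, positivity *)

Section MartingaleLimit.
Context {d : measure_display} {T : measurableType d} {R : realType}.
Variables (P : probability T R) (Z : seq nat -> {mfun T >-> config R}).
Hypothesis Zid : forall u, same_law P (Z u) (Z [::]).
Hypothesis HA1 : assumption_A1 P (Z [::]).
Hypothesis HA2 : assumption_A2 P (Z [::]).
Hypothesis HA3 : assumption_A3 P (Z [::]).
Variable theta : R.
Hypotheses (theta_gt0 : 0 < theta) (theta_lt : (theta%:E < theta0 P (Z [::]))%E).
Hypothesis indM : mutually_independent P (fun u => g_sigma_algebra_preimage (Z u)).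

Let om w u := Z u w.
Let nv := nu P (Z [::]) theta.
Local Notation W := (Wt P Z theta).

Definition Wlim (o : seq nat -> config R) : R := limn (fun n => W n o).

Lemma others_independent v A B : <<s others (fun u => Z u : T -> config R) v >> A ->
  measurable B -> P (A `&` Z v @^-1` B) = (P A * P (Z v @^-1` B))%E.
Proof.
move=> mA mB.
apply: (@mutually_independent_pair _ _ _ P _ (fun u => g_sigma_algebra_preimage (Z u)) v) => //.
- by move=> u; apply: g_sigma_preimage_measurable; exact: measurable_funPT.
- by move=> u; exact: g_sigma_preimage_setI.
- by move=> u; exact: g_sigma_preimage_setT.
- exact: g_sigma_preimage_mem.
Qed.

Section Measurability.
Context {d' : measure_display} {T' : measurableType d'}.
Variable om' : T' -> seq nat -> config R.
Hypothesis mom' : forall u, measurable_fun setT (fun w => om' w u).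

Lemma measurable_Wt_comp n : measurable_fun setT (fun w => W n (om' w)).
Proof.
apply: measurable_sum_gen => [u _|v vn]; first exact: mom'.
apply: measurableT_comp => //; apply: measurable_funB => //; apply: measurable_funM => //.
by apply: (measurable_pos (n := n)); [move=> u _; exact: mom'|rewrite vn].
Qed.

Lemma measurable_Wlim : measurable_fun setT (fun w => Wlim (om' w)).
Proof. by apply: measurable_limn => n; exact: measurable_Wt_comp. Qed.

End Measurability.

Let mZ u : measurable_fun setT (fun w => om w u).
Proof. exact: measurable_funPT. Qed.

Lemma Wt_ge0 n o : 0 <= W n o.
Proof. by apply: sumr_ge0 => v _; exact: expR_ge0. Qed.

Lemma Wlim_ge0 o : 0 <= Wlim o.
Proof. by apply: limn_ge0 => n; exact: Wt_ge0. Qed.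

Lemma Wlim_cvg_ae : {ae P, forall w, cvgn (fun n => W n (om w))}.
Proof.
have [C [rho [C0 rho0 rho1 incr]]] :=
  integral_Wt_incr Zid HA1 HA2 HA3 theta_gt0 theta_lt others_independent.
by apply: (cvg_increments_ae _ C0 rho0 rho1 incr) => n; exact: measurable_Wt_comp.
Qed.

Lemma Wlim_L1 (e : R) : 0 < e -> \forall n \near \oo,
  (\int[P]_w `|W n (om w) - Wlim (om w)|%:E <= e%:E)%E.
Proof.
move=> e0.
have [C [rho [C0 rho0 rho1 incr]]] :=
  integral_Wt_incr Zid HA1 HA2 HA3 theta_gt0 theta_lt others_independent.
have : geometric (C / (1 - rho)) rho n @[n --> \oo] --> 0.
  by apply: cvg_geometric; rewrite ger0_norm.
move=> /cvgrPdist_le /(_ e e0); apply: filterS => n /=.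
rewrite sub0r normrN ger0_norm; last by rewrite mulr_ge0 ?exprn_ge0 ?divr_ge0 // subr_ge0 ltW.
move=> h; apply: (@le_trans _ _ (C * rho ^+ n / (1 - rho))%:E).
  by apply: (L1_increments _ C0 rho0 rho1 incr) => k; exact: measurable_Wt_comp.
by rewrite lee_fin mulrAC.
Qed.

(** The mean 1 passes to the limit by L1 convergence. Two one-sided bounds are used because the
    integral of the limit is not yet known to be finite. *)
Lemma integral_Wlim : (\int[P]_w (Wlim (om w))%:E = 1)%E.
Proof.
have mWl := measurable_Wlim mZ.
have half n : (\int[P]_w (Wlim (om w))%:E <= 1 + \int[P]_w `|W n (om w) - Wlim (om w)|%:E)%E.
  rewrite -(integral_Wt Zid HA1 HA2 theta_gt0 others_independent n).
  have mW := measurable_Wt_comp mZ n.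
  rewrite -ge0_integralD //; last 3 first.
  - by move=> w _; rewrite lee_fin Wt_ge0.
  - exact/measurable_EFinP.
  - by apply/measurable_EFinP; apply: measurableT_comp => //; exact: measurable_funB.
  apply: ge0_le_integral => //.
  - by move=> w _; rewrite lee_fin Wlim_ge0.
  - exact/measurable_EFinP.
  - apply: emeasurable_funD; first exact/measurable_EFinP.
    by apply/measurable_EFinP; apply: measurableT_comp => //; exact: measurable_funB.
  move=> w _; rewrite -EFinD lee_fin; have := ler_norm (- (W n (om w) - Wlim (om w))).
  by rewrite normrN; lra.
have half' n : (1 <= \int[P]_w (Wlim (om w))%:E + \int[P]_w `|W n (om w) - Wlim (om w)|%:E)%E.
  rewrite -(integral_Wt Zid HA1 HA2 theta_gt0 others_independent n).
  have mW := measurable_Wt_comp mZ n.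
  rewrite -ge0_integralD //; last 3 first.
  - by move=> w _; rewrite lee_fin Wlim_ge0.
  - exact/measurable_EFinP.
  - by apply/measurable_EFinP; apply: measurableT_comp => //; exact: measurable_funB.
  apply: ge0_le_integral => //.
  - by move=> w _; rewrite lee_fin Wt_ge0.
  - exact/measurable_EFinP.
  - apply: emeasurable_funD; first exact/measurable_EFinP.
    by apply/measurable_EFinP; apply: measurableT_comp => //; exact: measurable_funB.
  move=> w _; rewrite -EFinD lee_fin; have := ler_norm (W n (om w) - Wlim (om w)).
  by lra.
apply/eqP; rewrite eq_le; apply/andP; split; apply/lee_addgt0Pr => e e0.
  have [n _ /(_ n (leqnn _)) h] := Wlim_L1 e0.
  by apply: le_trans (half n) _; rewrite leeD2l.
have [n _ /(_ n (leqnn _)) h] := Wlim_L1 e0.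
by apply: le_trans (half' n) _; rewrite leeD2l.
Qed.

(** Unlike [WtS], this splits at the root: each child starts a copy of the martingale on its own
    subtree. *)
Lemma WtS_shift n o : W n.+1 o =
  \sum_(j < size (o [::])) expR (theta * nth 0 (o [::] : seq R) j - nv) * W n (shift j o).
Proof.
rewrite /Wt sum_genS_shift; apply: eq_bigr => j _; rewrite mulr_sumr.
apply: eq_bigr => u _; rewrite pos_cons -expRD; congr expR.
by rewrite -natr1 /nv; ring.
Qed.

Let Zshift j u : {mfun T >-> config R} := Z (j :: u).

Let Zshift_law j (B : set env) : measurable B ->
  P ((fun w => shift j (om w) : env) @^-1` B) = P ((fun w => om w : env) @^-1` B).
Proof.
move=> mB; apply: (@env_law R d T P (Zshift j) Z) => //.
- have cons_inj : injective (cons j : seq nat -> seq nat) by move=> u v [].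
  exact: (mutually_independent_inj cons_inj indM).
- by move=> u A mA; rewrite (Zid (j :: u) mA) /pushforward (Zid u mA).
Qed.

(** Convergence is a measurable set of environments, and the environment below [j] has the law of
    the whole one, so the probability 1 is inherited. Unborn children are covered, since their
    labels carry lists too. *)
Lemma Wlim_shift_cvg_ae j : {ae P, forall w, cvgn (fun n => W n (shift j (om w)))}.
Proof.
pose cv : set env := [set o | cvgn (fun n => W n o)].
have mcv : measurable cv.
  have mW n := measurable_Wt_comp (om' := fun o : env => o) (@measurable_coord R) n.
  have msup : measurable_fun [set: env] (fun w : env => limn_esup (fun n => (W n w)%:E)).
    by apply: measurable_fun_limn_esup => n; exact/measurable_EFinP.
  have minf : measurable_fun [set: env] (fun w : env => limn_einf (fun n => (W n w)%:E)).
    rewrite /limn_einf; apply: measurableT_comp => //.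
    by apply: measurable_fun_limn_esup => n; apply: measurableT_comp => //; exact/measurable_EFinP.
  rewrite (_ : cv = (setT `&` [set o : env | limn_einf (fun n => (W n o)%:E) = limn_esup (fun n => (W n o)%:E)])
     `&` (fun o : env => limn_esup (fun n => (W n o)%:E)) @^-1` [set x | x \is a fin_num]).
    apply: measurableI; first exact: measurable_eqe.
    rewrite -[X in measurable X]setTI; apply: msup => //.
    rewrite (_ : [set _ | _] = ~` [set -oo%E] `&` ~` [set +oo%E]).
      by apply: measurableI; apply: measurableC; exact: emeasurable_set1.
    apply/seteqP; split => x /=; rewrite fin_numE.
      by move=> /andP[/eqP ? /eqP ?].
    by move=> [/eqP -> /eqP ->].
  rewrite setTI; apply/seteqP; split => o /=; first by move/cvgn_limn_esupP.
  by move=> ?; apply/cvgn_limn_esupP.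
have mS : measurable ((fun w => shift j (om w) : env) @^-1` cv).
  by rewrite -[X in measurable X]setTI; apply: measurable_env.
have mO : measurable ((fun w => om w : env) @^-1` cv).
  by rewrite -[X in measurable X]setTI; apply: measurable_env.
apply: (prob1_ae mS); rewrite Zshift_law //.
apply/eqP; rewrite eq_le probability_le1 //=.
have [N [mN PN sub]] := Wlim_cvg_ae.
have : P (~` ((fun w => om w : env) @^-1` cv)) = 0%E.
  apply/eqP; rewrite eq_le measure_ge0 andbT -PN le_measure ?inE //.
  exact: measurableC.
rewrite probability_setC // => /eqP; rewrite sube_eq ?add0e ?fin_num_measure //.
by move=> /eqP <-.
Qed.

(** The root decomposition passes to the limit term by term, the family being finite, once the
    countably many null sets, one per [j], are discarded together. *)
Lemma Wlim_RDE_ae : {ae P, forall w, Wlim (om w) =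
  \sum_(j < size (Z [::] w)) expR (theta * nth 0 (Z [::] w : seq R) j - nv) * Wlim (shift j (om w))}.
Proof.
have : {ae P, forall w, forall j, cvgn (fun n => W n (shift j (om w)))}.
  by apply: ae_foralln => j; exact: Wlim_shift_cvg_ae.
apply: filterS => w cj; apply/cvg_lim => //.
rewrite -cvg_shiftS /=.
under eq_fun do rewrite WtS_shift.
apply: cvgn_sum => j; apply: cvgM; first exact: cvg_cst.
exact: cj.
Qed.

Definition Wlim_sub j : T -> R := fun w => Wlim (shift j (om w)).

Lemma measurable_Wlim_sub j : measurable_fun setT (Wlim_sub j).
Proof. by apply: measurable_Wlim => u; exact: measurable_funPT. Qed.

Lemma Wlim_sub_law j (B : set R) : measurable B ->
  P (Wlim_sub j @^-1` B) = P ((fun w => Wlim (om w)) @^-1` B).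
Proof.
move=> mB; have mWl := measurable_Wlim (om' := fun o : env => o) (@measurable_coord R).
apply: (@Zshift_law j ((fun o : env => Wlim o) @^-1` B)).
by rewrite -[X in measurable X]setTI; exact: mWl.
Qed.

(** Labels are grouped by first letter, the root being the block [None]; the limit in the subtree of
    [j] is measurable for the block of labels that start with [j]. *)
Lemma Wlim_sub_independent : mutually_independent P (fun i : option nat =>
  if i is Some j then g_sigma_algebra_preimage (Wlim_sub j)
  else g_sigma_algebra_preimage (Z [::])).
Proof.
pose kap (u : seq nat) : option nat := if u is j :: _ then Some j else None.
have := @mutually_independent_group _ _ _ P _ _ kap _ _ _ _ indM.
move=> /(_ (fun u => g_sigma_preimage_measurable (mZ u))) ind.
apply: mutually_independent_sub (ind _ _); last 2 first.
- by move=> u; exact: g_sigma_preimage_setI.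
- by move=> u; exact: g_sigma_preimage_setT.
case=> [j|] A; last first.
  by move=> ZA; apply: sub_sigma_algebra; exists [::].
move=> [B mB <-].
pose G := \bigcup_(u in [set u | kap u = Some j]) g_sigma_algebra_preimage (Z u).
have : measurable_fun [set: g_sigma_algebraType G] (Wlim_sub j : g_sigma_algebraType G -> R).
  apply: (measurable_Wlim (om' := (fun w u => Z (j :: u) w) : g_sigma_algebraType G -> _)) => u.
  move=> _ B' mB'; apply: sub_sigma_algebra; exists (j :: u) => //=.
  by exists B'.
by move=> /(_ measurableT B mB).
Qed.

Lemma Wlim_gt0_ae : {ae P, forall w, 0 < Wlim (om w)}.
Proof.
have mWl := measurable_Wlim mZ.
pose A0 := (fun w => Wlim (om w)) @^-1` [set 0].
have mA0 : measurable A0 by rewrite -[X in measurable X]setTI; exact: mWl.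
suff PA0 : P A0 = 0%E.
  exists A0; split => // w /= H; apply: contrapT => nA; apply: H.
  by rewrite lt_neqAle Wlim_ge0 andbT eq_sym; apply/eqP.
pose N1 := [set w | size (Z [::] w) = 1%N].
pose B j := Wlim_sub j @^-1` [set 0].
have mN1 : measurable N1.
  have := measurable_funPT (Z [::]) measurableT _ (measurable_config_size (R := R) 1).
  by rewrite setTI.
have mB j : measurable (B j).
  by rewrite -[X in measurable X]setTI; exact: measurable_Wlim_sub.
have PB j : P (B j) = P A0 by rewrite Wlim_sub_law.
have FB j : g_sigma_algebra_preimage (Wlim_sub j) (B j).
  exact: g_sigma_preimage_mem.
have FN1 : g_sigma_algebra_preimage (Z [::]) N1.
  exact: (g_sigma_preimage_mem (Z [::]) (measurable_config_size (R := R) 1)).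
have FN1c : g_sigma_algebra_preimage (Z [::]) (~` N1).
  exact: (g_sigma_preimage_mem (Z [::]) (measurableC (measurable_config_size (R := R) 1))).
have P1 : P (N1 `&` B 0%N) = (P N1 * P A0)%E.
  have := Wlim_sub_independent (J := [fset None; Some 0%N]%fset)
     (A := fun i => if i is Some j then B j else N1).
  rewrite big_fsetU1 ?inE //= big_seq_fset1 set_fsetU1 bigcap_setU1 set_fset1 bigcap_set1 PB.
  by apply => -[j|] _; [exact: FB|exact: FN1].
have P2 : P (~` N1 `&` (B 0%N `&` B 1%N)) = (P (~` N1) * (P A0 * P A0))%E.
  have := Wlim_sub_independent (J := [fset None; Some 0; Some 1]%N%fset)
     (A := fun i => if i is Some j then B j else ~` N1).
  rewrite -fsetUA big_fsetU1 ?inE //= big_fsetU1 ?inE //= big_seq_fset1.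
  rewrite !set_fsetU1 !bigcap_setU1 set_fset1 bigcap_set1 !PB.
  by apply => -[j|] _; [exact: FB|exact: FN1c].
have [N [mN PN sub]] : {ae P, forall w, A0 w -> (N1 `&` B 0%N) w \/ (~` N1 `&` (B 0%N `&` B 1%N)) w}.
  apply: filterS2 (size_ge1_ae HA2) Wlim_RDE_ae => w s1 RDE; rewrite /A0 /= => W0.
  have Bj j : (j < size (Z [::] w))%N -> B j w.
    move=> js; have : \sum_(j < size (Z [::] w)) expR (theta * nth 0 (Z [::] w : seq R) j - nv)
       * Wlim (shift j (om w)) == 0 by rewrite -RDE W0.
    rewrite psumr_eq0 => [|i _]; last by rewrite mulr_ge0 ?expR_ge0 ?Wlim_ge0.
    move=> /allP /(_ (Ordinal js) (mem_index_enum _)) /=.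
    by rewrite mulf_eq0 gt_eqF ?expR_gt0 //= => /eqP.
  have [N1w|N1w] := pselect (N1 w); [left|right]; split => //; first exact: Bj.
  have s2 : (1 < size (Z [::] w))%N.
    by rewrite ltn_neqAle s1 andbT; apply/eqP => e; apply: N1w; rewrite /N1 /= -e.
  by split; exact: Bj.
pose q := fine (P A0); pose a := fine (P N1).
have qE : P A0 = q%:E by rewrite /q fineK // fin_num_measure.
have aE : P N1 = a%:E by rewrite /a fineK // fin_num_measure.
have q0 : 0 <= q by rewrite -lee_fin -qE.
have a1 : a < 1 by have [+ _ _] := HA2; rewrite -/N1 aE lte_fin.
(* [D = 0] forces the first copy to vanish if [N = 1] and the first two if
   [N >= 2]; so [q] is 0 or at least 1, and [E D = 1] excludes the latter. *)
have ineq : q <= a * q + (1 - a) * (q * q).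
  rewrite -lee_fin EFinD !EFinM EFinB -qE -aE -probability_setC // -P1 -P2.
  apply: (@le_trans _ _ (P ((N1 `&` B 0%N) `|` ((~` N1 `&` (B 0%N `&` B 1%N)) `|` N)))).
    apply: le_measure; rewrite ?inE //.
      do ![apply: measurableU => //| apply: measurableI => //]; exact: measurableC.
    move=> w A0w; have [Nw|Nw] := pselect (N w); first by right; right.
    have : ~ (~ (A0 w -> (N1 `&` B 0%N) w \/ (~` N1 `&` (B 0%N `&` B 1%N)) w)).
      by move=> H; apply: Nw; apply: sub.
    by move=> /contrapT /(_ A0w) [H|H]; [left|right; left].
  have mX : measurable (~` N1 `&` (B 0%N `&` B 1%N)).
    by apply: measurableI; [exact: measurableC|exact: measurableI].
  apply: le_trans (measureU2 _ _ _) _ => //.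
  - exact: measurableI.
  - exact: measurableU.
  rewrite leeD2l //; apply: le_trans (measureU2 _ _ _) _ => //.
  by rewrite [X in (_ + X <= _)%E]PN adde0.
have [q00|q1] : q = 0 \/ 1 <= q.
  have [->|qn0] := eqVneq q 0; [by left|right].
  have qp : 0 < q by rewrite lt_neqAle eq_sym qn0.
  have : (1 - a) * q <= (1 - a) * (q * q) by lra.
  by rewrite ler_pM2l ?subr_gt0 // => h; rewrite -(ler_pM2l qp) mulr1.
- by rewrite qE q00.
exfalso.
have PA1 : P A0 = 1%E.
  by apply/eqP; rewrite eq_le probability_le1 //= qE lee_fin.
have : (\int[P]_w (Wlim (om w))%:E = 0)%E.
  rewrite -(integral0 P setT); apply: ge0_ae_eq_integral => //.
  - exact/measurable_EFinP.
  - by move=> w _; rewrite lee_fin Wlim_ge0.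
  - by apply: filterS (prob1_ae mA0 PA1) => w A0w _; rewrite /= A0w.
by rewrite integral_Wlim => /eqP; rewrite onee_eq0.
Qed.

End MartingaleLimit.

(** * Integrating out independent exponential clocks *)

Section ExponentialClocks.
Context {d : measure_display} {T : measurableType d} {R : realType}.
Variable P : probability T R.

Lemma exponential_prob_ge (c : R) : 0 <= c ->
  exponential_prob 1 [set x : R | c <= x] = (expR (- c))%:E.
Proof.
move=> c0.
rewrite (_ : [set x : R | c <= x] = `[c, +oo[%classic); last first.
  by apply/seteqP; split => x /=; rewrite in_itv /= andbT.
rewrite /exponential_prob (@ge0_continuous_FTC2y _ _ (fun x => - expR (- x)) c 0).
- by rewrite EFinN oppeK add0e.
- by move=> x _; exact: exponential_pdf_ge0.
- apply: (@continuous_subspaceW R^o _ _ [set` `[0, +oo[%R]).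
    by move=> x /=; rewrite !in_itv /= !andbT; exact: le_trans.
  exact: within_continuous_exponential_pdf.
- by rewrite -oppr0; apply: cvgN; exact: cvgr_expR.
- by move=> x _; exact: ex_derive.
- apply: cvgN; apply/cvg_at_right_filter; apply: continuous_comp; last exact: continuous_expR.
  exact: opp_continuous.
- move=> x cx; have := @derive1_exponential_pdf R 1 x.
  under eq_fun do rewrite mulN1r.
  by apply; move: cx; rewrite !in_itv /= !andbT; exact: le_lt_trans.
Qed.

(** The law has a density, so the point 0 carries no mass. Positive clocks are what makes log E_v
    finite. *)
Lemma exponential_gt0_ae (E : {RV P >-> R}) :
  has_law P E (exponential_prob 1) -> {ae P, forall w, 0 < E w}.
Proof.
move=> lawE.
have mA : measurable [set x : R | 0 < x].
  rewrite (_ : [set x : R | 0 < x] = `]0, +oo[%classic) //.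
  by apply/seteqP; split => x /=; rewrite in_itv /= andbT.
apply: prob1_ae; first by have := measurable_funPT E measurableT _ mA; rewrite setTI.
have := lawE _ mA; rewrite /preimage /= => ->.
transitivity (exponential_prob 1 [set x : R | 0 <= x]); last first.
  by rewrite exponential_prob_ge ?lexx // oppr0 expR0.
rewrite /exponential_prob.
rewrite (_ : [set x : R | 0 < x] = `]0, +oo[%classic); last first.
  by apply/seteqP; split => x /=; rewrite in_itv /= andbT.
rewrite (_ : [set x : R | 0 <= x] = `[0, +oo[%classic); last first.
  by apply/seteqP; split => x /=; rewrite in_itv /= andbT.
rewrite integral_itv_obnd_cbnd //.
by apply: measurable_funTS; apply/measurable_EFinP; exact: measurable_exponential_pdf.
Qed.

Variables (C : eqType) (H : set (set T)) (G : C -> set (set T)) (E c : C -> T -> R).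
Hypothesis Gm : forall v, G v `<=` measurable.
Hypothesis HG : forall v, H `<=` <<s G v >>.
Hypothesis GE : forall v u, u != v -> sub_measurable (G v) (E u).
Hypothesis mE : forall v, measurable_fun setT (E v).
Hypothesis ind : forall v A B, <<s G v >> A -> measurable B ->
  P (A `&` E v @^-1` B) = (P A * P (E v @^-1` B))%E.
Hypothesis lawE : forall v, has_law P (E v) (exponential_prob 1).
Hypothesis c0 : forall v w, 0 <= c v w.
Hypothesis Hc : forall v, sub_measurable H (c v).

(** Clocks are removed one at a time. Given everything but clock [v], its event has probability e^(-
    c_v), which is again [H]-measurable and is absorbed into [f]; the statement is for a general [f]
    so that the induction can do this. *)
Lemma integral_exponential_clocks (s : seq C) (f : T -> R) : uniq s ->
  (forall w, 0 <= f w) -> sub_measurable H f ->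
  (\int[P]_w (f w * (all (fun v => c v w <= E v w) s)%:R)%:E =
   \int[P]_w (f w * expR (- \sum_(v <- s) c v w))%:E)%E.
Proof.
have HGf v (h : T -> R) : sub_measurable H h -> sub_measurable (G v) h.
  move=> mh _ B mB; have := mh measurableT B mB.
  exact: (g_sigma_sub (@HG v)).
elim: s f => [|v s IH] f us f0 Hf.
  by apply: eq_integral => w _; rewrite /= big_nil oppr0 expR0.
have /andP[vs {}us] := us.
pose g w := f w * (all (fun u => c u w <= E u w) s)%:R.
have g0 w : 0 <= g w by rewrite mulr_ge0.
have Gg : sub_measurable (G v) g.
  apply: measurable_funM; first exact: HGf.
  rewrite (_ : (fun w => _) = fun w => if all (fun u => c u w <= E u w) s then 1 else 0); last first.
    by apply/funext => w; case: all.
  apply: measurable_fun_ifT => //.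
  elim: s vs {IH us g g0} => [|u s IHs] /=; first by move=> _; exact: measurable_cst.
  rewrite inE negb_or => /andP[vu vs].
  apply: measurable_and; last exact: IHs.
  by apply: measurable_fun_ler; [exact: HGf|apply: GE; rewrite eq_sym].
transitivity (\int[P]_w (g w * expR (- c v w))%:E)%E; last first.
  transitivity (\int[P]_w (f w * expR (- c v w) * (all (fun u => c u w <= E u w) s)%:R)%:E)%E.
    by apply: eq_integral => w _; rewrite /g mulrAC.
  rewrite IH; [|exact: us| |].
  - by apply: eq_integral => w _; rewrite big_cons opprD expRD mulrA.
  - by move=> w; rewrite mulr_ge0 ?expR_ge0.
  - apply: measurable_funM; first exact: Hf.
    by apply: measurableT_comp => //; apply: measurableT_comp => //; exact: Hc.
pose F (z : T * R) : \bar R := (g z.1 * (if c v z.1 <= z.2 then 1 else 0))%:E.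
transitivity (\int[P]_w F (w, E v w))%E.
  by apply: eq_integral => w _; rewrite /F /g /=; case: ifP; rewrite ?mulr1 ?mulr0.
rewrite (sub_measurable_integral (@Gm v) (mE v) (@ind v)); last 2 first.
- apply/measurable_EFinP; apply: measurable_funM.
    exact: (measurableT_comp Gg measurable_fst).
  apply: measurable_fun_ifT => //; apply: measurable_fun_ler; last exact: measurable_snd.
  exact: (measurableT_comp (HGf v _ (Hc v)) measurable_fst).
- by move=> z; rewrite lee_fin mulr_ge0 //; case: ifP.
apply: eq_integral => w _; rewrite /F /=.
transitivity (\int[P]_w' ((g w)%:E * (\1_[set w' | (c v w <= E v w')] w')%:E))%E.
  apply: eq_integral => w' _; rewrite -EFinM indicE; congr (_ * _)%:E.
  by case: ifPn => [cE|/negP cE]; [rewrite mem_set|rewrite memNset].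
have mA : measurable [set w' | c v w <= E v w'].
  have := mE v measurableT (measurable_itv `[c v w, +oo[).
  rewrite setTI; congr measurable; apply/seteqP; split => x /=; by rewrite in_itv /= andbT.
rewrite ge0_integralZl; [|exact: measurableT| | |]; last 3 first.
- by apply/measurable_EFinP; exact: measurable_indic.
- by move=> x _; rewrite lee_fin.
- by rewrite lee_fin.
rewrite integral_indic // setIT [RHS]EFinM; congr (_ * _)%E.
rewrite -exponential_prob_ge //.
rewrite -(lawE v) //.
rewrite (_ : [set _ | _] = `[c v w, +oo[%classic) //.
by apply/seteqP; split => x /=; rewrite in_itv /= andbT.
Qed.

End ExponentialClocks.

Section AlmostEverywhere.
Context {d : measure_display} {T : measurableType d} {R : realType}.
Variable P : probability T R.

Lemma ae_eq_measure (A B : set T) : measurable A -> measurable B ->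
  {ae P, forall w, A w <-> B w} -> P A = P B.
Proof.
move=> mA mB AB.
rewrite -(setIT A) -(setIT B) -!(integral_indic _ measurableT) //.
apply: ae_eq_integral => //.
- by apply/measurable_EFinP; exact: measurable_indic.
- by apply/measurable_EFinP; exact: measurable_indic.
apply: filterS AB => w ABw _; congr (_%:E); rewrite !indicE; congr (_%:R); congr nat_of_bool.
by apply/idP/idP; rewrite !inE => /ABw.
Qed.

End AlmostEverywhere.

(** * Rewriting a logarithmic mark as a threshold for its clock *)

Section LogarithmicMark.
Context {R : realType}.

(** Exponentiate and solve for [e]. For [y <= 0] the logarithm is -oo and the left side holds, which
    [Num.max y 0] reproduces by a threshold 0. *)
Lemma lne_quotient_le (theta y e b : R) : 0 < theta -> 0 < e ->
  ((theta^-1)%:E * (lne y%:E - lne e%:E) <= b%:E)%E =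
  (expR (- (theta * b)) * Num.max y 0 <= e).
Proof.
move=> th0 e0; rewrite (lne_EFin e0).
have [y0|y0] := ltP 0 y; last first.
  rewrite le0_lneNy ?lee_fin // /= addNye gt0_muleNy ?lte_fin ?invr_gt0 //.
  by rewrite leNye mulr0 ltW.
rewrite (lne_EFin y0) -EFinB -EFinM lee_fin ler_pdivrMl // lerBlDl.
have yE : expR (ln y) = y by rewrite lnK ?posrE.
have eE : expR (ln e) = e by rewrite lnK ?posrE.
rewrite -[in RHS]yE -[X in _ = (_ <= X)]eE -expRD ler_expR.
by rewrite -lerBlDr addrC.
Qed.

Lemma measurable_lne_EFin : measurable_fun [set: R] (fun x : R => lne x%:E).
Proof.
apply: measurable_fun_ifT => //; first exact: measurable_fun_ler.
by apply/measurable_EFinP; exact: measurable_ln.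
Qed.

(** The Lipschitz bound serves where D is bounded below, the bound by 1 on the rare event that D is
    small. *)
Lemma expRN_dist_le (a b : R) : 0 <= a -> 0 <= b ->
  `|expR (- a) - expR (- b)| <= `|a - b| /\ `|expR (- a) - expR (- b)| <= 1.
Proof.
wlog ab : a b / a <= b.
  move=> H a0 b0; have [ab|/ltW ba] := leP a b; first exact: H.
  by rewrite (distrC a) (distrC (expR _)); exact: (H b a ba b0 a0).
move=> a0 b0; rewrite ger0_norm; last by rewrite subr_ge0 ler_expR lerN2.
rewrite distrC ger0_norm ?subr_ge0 //; split; last first.
  have := expR_ge0 (- b); have : expR (- a) <= 1 by rewrite -expR0 ler_expR oppr_le0.
  lra.
have := expR_ge1Dx (a - b); rewrite (_ : expR (a - b) = expR a * expR (- b)); last by rewrite -expRD.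
have : expR (- a) * expR a = 1 by rewrite -expRD addNr expR0.
have : 0 < expR (- a) <= 1 by rewrite expR_gt0 -expR0 ler_expR oppr_le0.
move: (expR (- a)) (expR a) (expR (- b)) => u v z /andP[u0 u1] uv h.
have -> : z = u * (v * z) by rewrite mulrA uv mul1r.
nra.
Qed.

End LogarithmicMark.

Lemma has_law_integral_law (R : realType) (d d' : measure_display) (T : measurableType d)
    (S : measurableType d') (P : probability T R) (mu : probability S R)
    (X : {mfun T >-> S}) (f : S -> \bar R) :
  has_law P X mu -> measurable_fun setT f -> (forall s, 0 <= f s)%E ->
  (\int[P]_w f (X w) = \int[mu]_s f s)%E.
Proof.
move=> lawX mf f0; have := ge0_integral_distribution (P := P) X mf f0.
by rewrite /= /comp => <-; apply: eq_measure_integral => A mA _; exact: lawX.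
Qed.

(** * The modified maximum: replacing the marks Y_v by their mean *)

Section LastProgeny.
Context {d : measure_display} {T : measurableType d} {R : realType}.
Variables (P : probability T R) (Z : seq nat -> {mfun T >-> config R}).
Hypothesis Zid : forall u, same_law P (Z u) (Z [::]).
Hypothesis HA1 : assumption_A1 P (Z [::]).
Hypothesis HA2 : assumption_A2 P (Z [::]).
Hypothesis HA3 : assumption_A3 P (Z [::]).
Variable theta : R.
Hypotheses (theta_gt0 : 0 < theta) (theta_lt : (theta%:E < theta0 P (Z [::]))%E).
Variable mu : probability R R.
Hypotheses (mu_supp : mu [set y | 0 <= y] = 1%E) (mu_mean : (\int[mu]_y y%:E < +oo)%E).
Variables Y E : seq nat -> {RV P >-> R}.
Hypothesis Ylaw : forall v, (0 < size v)%N -> has_law P (Y v) mu.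
Hypothesis Elaw : forall v, (0 < size v)%N -> has_law P (E v) (exponential_prob 1).
Hypothesis indep : forall n, (0 < n)%N -> independent_generation Z P Y E n.

Let om w u := Z u w.
Let nv := nu P (Z [::]) theta.
Let mean : R := fine (\int[mu]_y y%:E)%E.
Let indM : mutually_independent P (fun u => g_sigma_algebra_preimage (Z u)).
Proof.
have inj : injective (fun u : seq nat => inl (inl u) : (seq nat + 1.-tuple nat + 1.-tuple nat)%type).
  by move=> u v [].
exact: (mutually_independent_inj inj (indep (ltn0Sn 0))).
Qed.

Let mZ u : measurable_fun setT (Z u : T -> config R).
Proof. exact: measurable_funPT. Qed.

Let FF n (i : (seq nat + n.-tuple nat + n.-tuple nat)%type) : set (set T) :=
  match i with
  | inl (inl u) => g_sigma_algebra_preimage (Z u)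
  | inl (inr v) => g_sigma_algebra_preimage (Y v)
  | inr v => g_sigma_algebra_preimage (E v)
  end.

Let FFm n i : FF (n := n) i `<=` measurable.
Proof.
by case: i => [[u|v]|v]; apply: g_sigma_preimage_measurable; exact: measurable_funPT.
Qed.

Lemma generation_pair n (i0 : (seq nat + n.-tuple nat + n.-tuple nat)%type) A B :
  (0 < n)%N -> <<s \bigcup_(i in [set i | i != i0]) FF i >> A -> FF i0 B ->
  P (A `&` B) = (P A * P B)%E.
Proof.
move=> n0; apply: mutually_independent_pair => [i|i|i|]; last exact: indep.
- exact: FFm.
- by case: i => [[u|v]|v]; exact: g_sigma_preimage_setI.
- by case: i => [[u|v]|v]; exact: g_sigma_preimage_setT.
Qed.

Let sub_FF n (D : set (seq nat + n.-tuple nat + n.-tuple nat)%type) i :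
  D i -> FF i `<=` <<s \bigcup_(i in D) FF i >>.
Proof. by move=> Di A FA; apply: sub_sigma_algebra; exists i. Qed.

Let sub_measurable_FF n (D : set (seq nat + n.-tuple nat + n.-tuple nat)%type) :
  [/\ forall u, D (inl (inl u)) -> sub_measurable (\bigcup_(i in D) FF i) (Z u : T -> config R),
      forall v, D (inl (inr v)) -> sub_measurable (\bigcup_(i in D) FF i) (Y v : T -> R)
    & forall v, D (inr v) -> sub_measurable (\bigcup_(i in D) FF i) (E v : T -> R)].
Proof.
split=> v Dv _ B mB; rewrite setTI; apply: (sub_FF Dv);
  exact: g_sigma_preimage_mem.
Qed.

(** Marks are nonnegative only almost surely; [Num.max y 0] makes them so everywhere without
    changing the mean. *)
Let integral_max : (\int[mu]_y (Num.max y 0)%:E = \int[mu]_y y%:E)%E.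
Proof.
apply: ae_eq_integral => //; first by apply/measurable_EFinP; exact: measurable_maxr.
have mA : measurable [set y : R | 0 <= y].
  rewrite (_ : [set y | _] = `[0, +oo[%classic) //.
  by apply/seteqP; split => x /=; rewrite in_itv /= andbT.
by apply: filterS (prob1_ae mA mu_supp) => y /= y0 _; rewrite max_l.
Qed.

Let meanE : (\int[mu]_y (Num.max y 0)%:E = mean%:E)%E.
Proof.
rewrite integral_max fineK // ge0_fin_numE // -integral_max.
by apply: integral_ge0 => y _; rewrite lee_fin le_max lexx orbT.
Qed.

Let mean_ge0 : 0 <= mean.
Proof.
by rewrite -lee_fin -meanE; apply: integral_ge0 => y _; rewrite lee_fin le_max lexx orbT.
Qed.

(** [mlo k] is at most k, hence has second moment at most k^2; the mean of [mhi k] tends to 0, which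
    is all that a finite mean provides. *)
Let mlo (k : nat) (y : R) : R := if y <= k%:R then Num.max y 0 else 0.
Let mhi (k : nat) (y : R) : R := if y <= k%:R then 0 else Num.max y 0.

Let mmax : measurable_fun [set: R] (fun y : R => Num.max y 0).
Proof. exact: measurable_maxr. Qed.
Let mmlo k : measurable_fun setT (mlo k).
Proof. by apply: measurable_fun_ifT => //; exact: measurable_fun_ler. Qed.
Let mmhi k : measurable_fun setT (mhi k).
Proof. by apply: measurable_fun_ifT => //; exact: measurable_fun_ler. Qed.
Let max_ge0 (y : R) : 0 <= Num.max y 0. Proof. by rewrite le_max lexx orbT. Qed.
Let mlo_ge0 k y : 0 <= mlo k y. Proof. by rewrite /mlo; case: ifP. Qed.
Let mhi_ge0 k y : 0 <= mhi k y. Proof. by rewrite /mhi; case: ifP. Qed.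

Let mlo_mhi k : (\int[mu]_y (mlo k y)%:E + \int[mu]_y (mhi k y)%:E = mean%:E)%E.
Proof.
rewrite -ge0_integralD //; last 4 first.
- by move=> y _; rewrite lee_fin.
- exact/measurable_EFinP.
- by move=> y _; rewrite lee_fin.
- exact/measurable_EFinP.
rewrite -meanE; apply: eq_integral => y _; rewrite -EFinD /mlo /mhi.
by case: ifP; rewrite ?addr0 ?add0r.
Qed.

Let mlo_cvg : (\int[mu]_y (mlo k y)%:E @[k --> \oo] --> mean%:E)%E.
Proof.
rewrite -meanE (_ : (\int[mu]_y _ = \int[mu]_y limn (fun k => (mlo k y)%:E))%E); last first.
  apply: eq_integral => y _; apply/esym/cvg_lim => //; apply: cvg_near_cst.
  exists (Num.bound `|y|) => // k /= yk; rewrite /mlo ifT //.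
  apply: le_trans (ler_norm y) _; apply: ltW.
  by apply: lt_le_trans (archi_boundP (normr_ge0 y)) _; rewrite ler_nat.
apply: cvg_monotone_convergence => //.
- by move=> k; apply/measurable_EFinP.
- by move=> k y _; rewrite lee_fin.
move=> y _ k l kl; rewrite lee_fin /mlo; case: ifPn => // yk.
  by rewrite (le_trans yk) // ler_nat.
by case: ifP.
Qed.

Lemma weighted_marks_L1 (e : R) : 0 < e -> \forall n \near \oo,
  (\int[P]_w `|\sum_(v <- gen n (om w)) expR (theta * pos v (om w) - n%:R * nv) *
       Num.max (Y v w) 0 - mean * Wt P Z theta n (om w)|%:E <= e%:E)%E.
Proof.
move=> e0.
have indZ := others_independent indM.
have [q [dl [q1 q2 dl0 Egap]]] := gen_gap Zid HA1 HA2 theta_gt0 theta_lt indZ.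
(* The level [k] is fixed before n, since a finite mean gives no rate for the tail of [mu]. *)
have [k epsk] : exists k, (\int[mu]_y (mhi k y)%:E <= (e / 8)%:E)%E.
  have e80 : 0 < e / 8 by rewrite divr_gt0.
  have /fine_cvgP[_ /cvgrPdist_le /(_ _ e80) [k _ /(_ k (leqnn _)) /= hk]] := mlo_cvg.
  exists k; have := mlo_mhi k.
  have : (0 <= \int[mu]_y (mlo k y)%:E)%E by apply: integral_ge0 => y _; rewrite lee_fin.
  move: hk; case: (\int[mu]_y (mlo k y)%:E)%E => [a| |] //= hk a0.
    case: (\int[mu]_y (mhi k y)%:E)%E => [b| |] //= [ab].
    rewrite lee_fin; move: hk; rewrite -ab (_ : a + b - a = b); last by ring.
    exact: le_trans (ler_norm b).
  by case: (\int[mu]_y (mhi k y)%:E)%E.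
pose c := fine (\int[mu]_y (mlo k y)%:E)%E.
pose eps := fine (\int[mu]_y (mhi k y)%:E)%E.
have Ilo0 : (0 <= \int[mu]_y (mlo k y)%:E)%E by apply: integral_ge0 => y _; rewrite lee_fin.
have Ihi0 : (0 <= \int[mu]_y (mhi k y)%:E)%E by apply: integral_ge0 => y _; rewrite lee_fin.
have Ilofin : (\int[mu]_y (mlo k y)%:E \is a fin_num)%E.
  by rewrite ge0_fin_numE // (le_lt_trans _ (ltry mean)) // -(mlo_mhi k) leeDl.
have Ihifin : (\int[mu]_y (mhi k y)%:E \is a fin_num)%E.
  by rewrite ge0_fin_numE // (le_lt_trans _ (ltry mean)) // -(mlo_mhi k) leeDr.
have ce : c + eps = mean.
  by apply/EFin_inj; rewrite -(mlo_mhi k) EFinD /c /eps !fineK.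
have eps8 : eps <= e / 8 by rewrite -lee_fin fineK.
have c0 : 0 <= c by rewrite fine_ge0.
have eps0 : 0 <= eps by rewrite fine_ge0.
(* The budget is e/2 for the terms proportional to B, e/4 for t/2 and e/4 for 2 eps; [K] below
   collects the coefficients of B. *)
pose t := e / 2; have t0 : 0 < t by rewrite divr_gt0.
pose K := 2 * mean + k%:R ^+ 2 / (2 * t).
have K0 : 0 <= K.
  by apply: addr_ge0; [exact: mulr_ge0|rewrite divr_ge0 ?sqr_ge0 // mulr_ge0 // ltW].
have Bn : \forall n \near \oo, K * expR (- 4 * (dl * n%:R)) <= e / 2.
  have : geometric K (expR (- 4 * dl)) n @[n --> \oo] --> 0.
    apply: cvg_geometric; rewrite ger0_norm ?expR_ge0 // -[ltRHS]expR0 ltr_expR; lra.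
  have e20 : 0 < e / 2 by rewrite divr_gt0.
  move=> /cvgrPdist_le /(_ _ e20); apply: filterS => n /=.
  rewrite sub0r normrN => h; apply: le_trans h; apply: le_trans (ler_norm _).
  by rewrite -expRM_natl; rewrite le_eqVlt; apply/orP; left; apply/eqP; congr (_ * expR _); ring.
near=> n.
have n0 : (0 < n)%N by near: n; exact: nbhs_infty_gt.
have KB : K * expR (- 4 * (dl * n%:R)) <= e / 2 by near: n; exact: Bn.
have vpos (v : seq nat) : size v = n -> (0 < size v)%N by move=> ->.
(* For the mark of [v] the conditioning includes the whole joint family except [Y v], in particular
   the other marks of the generation. *)
pose D v (i : (seq nat + n.-tuple nat + n.-tuple nat)%type) : Prop :=
  if i is inl (inr u) then tval u != v else true.
pose H v := \bigcup_(i in [set i | D v i]) FF i.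
have HZ v u : sub_measurable (H v) (Z u : T -> config R).
  by have [h _ _] := @sub_measurable_FF n [set i | D v i]; exact: h.
pose B := expR (- 4 * (dl * n%:R)).
have mY : forall v, measurable_fun setT (Y v : T -> R) by move=> v; exact: measurable_funPT.
have bound := @tree_lln _ _ T R R P (fun u => Z u : T -> config R) (fun u => Y u : T -> R) n H
  (fun v w => theta * pos v (om w) - n%:R * nv) q (mlo k) (mhi k) c eps (k%:R ^+ 2) B t.
apply: le_trans (le_trans (bound _ _ _ _ _ _ _ _ _ _ _ _ _ _ _ _ _ _ _ _ _ _ _) _) => {bound} //.
- rewrite le_eqVlt; apply/orP; left; apply/eqP; apply: eq_integral => w _; congr (`|_|%:E).
  rewrite /Wt mulr_sumr -sumrB; apply: eq_bigr => v _.
  rewrite ce mulrBr mulrC -/nv [in RHS]mulrC; congr (_ * _ - _).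
    by rewrite /mlo /mhi; case: ifP; rewrite ?addr0 ?add0r.
  by rewrite mulrC.
- by move=> v vn A [i _ FA]; exact: FFm FA.
- move=> v v' vn v'n vv'; have /eqP v'n' := v'n.
  have [_ h _] := @sub_measurable_FF n [set i | D v i].
  by apply: (h (Tuple v'n')); rewrite /D /= eq_sym.
- move=> v vn; apply: measurable_funB => //; apply: measurable_funM => //.
  by apply: (measurable_pos (n := n)); [move=> u _; exact: mZ|rewrite vn].
- move=> v v' vn v'n; apply: measurable_funB; last exact: measurable_cst.
  apply: measurable_funM; first exact: measurable_cst.
  apply: (measurable_pos (om := om : g_sigma_algebraType (H v) -> _) (n := n)); last by rewrite v'n.
  by move=> u _; exact: HZ.
- move=> v A B' vn HA mB'; have /eqP vn' := vn.
  apply: (@generation_pair n (inl (inr (Tuple vn')))) => //; last exact: g_sigma_preimage_mem.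
  rewrite (_ : [set i | _] = [set i | D v i]) //; apply/seteqP; split => -[[u|u]|u] //=.
- move=> v vn; rewrite /c fineK // (has_law_integral_law (f := fun y => (mlo k y)%:E) (Ylaw (vpos v vn))) //; last first.
    by move=> y; rewrite lee_fin.
  exact/measurable_EFinP.
- move=> v vn; apply: (@le_trans _ _ (\int[P]_w (k%:R ^+ 2)%:E)%E); last first.
    by rewrite integral_cst //= probability_setT mule1.
  apply: ge0_le_integral => //.
  + by move=> w _; rewrite lee_fin sqr_ge0.
  + by apply/measurable_EFinP; apply: measurable_funX; exact: measurableT_comp.
  + move=> w _; rewrite lee_fin ler_sqr ?nnegrE // /mlo; case: ifP => // yk.
    by rewrite ge_max yk /=.
- move=> v vn; rewrite /eps fineK // (has_law_integral_law (f := fun y => (mhi k y)%:E) (Ylaw (vpos v vn))) //; last first.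
    by move=> y; rewrite lee_fin.
  exact/measurable_EFinP.
- by rewrite -(integral_Wt Zid HA1 HA2 theta_gt0 indZ n).
- by rewrite Egap.
rewrite lee_fin ce.
rewrite (_ : 2 * mean * B + t / 2 + k%:R ^+ 2 * B / (2 * t) + 2 * eps = K * B + t / 2 + 2 * eps);
  last by rewrite /K; ring.
rewrite /t; move: KB; rewrite -/B; lra.
Unshelve. all: by end_near. Qed.

Local Notation D := (fun w => Wlim P Z theta (om w)).

Let A n w : R := \sum_(v <- gen n (om w)) expR (theta * pos v (om w) - n%:R * nv) * Num.max (Y v w) 0.

Let mD : measurable_fun setT D.
Proof. by apply: measurable_Wlim => u; exact: mZ. Qed.

Let mA n : measurable_fun setT (A n).
Proof.
apply: measurable_sum_gen => [u _|v vn]; first exact: mZ.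
apply: measurable_funM; last exact: (measurableT_comp mmax (measurable_funPT (Y v))).
apply: measurableT_comp => //; apply: measurable_funB => //; apply: measurable_funM => //.
by apply: (measurable_pos (n := n)); [move=> u _; exact: mZ|rewrite vn].
Qed.

Let A_ge0 n w : 0 <= A n w.
Proof. by apply: sumr_ge0 => v _; rewrite mulr_ge0 ?expR_ge0. Qed.

Let D_ge0 w : 0 <= D w. Proof. exact: Wlim_ge0. Qed.

Section FixedGeneration.
Variables (n : nat) (k : R).
Hypotheses (n0 : (0 < n)%N) (k0 : 0 <= k).

(** With k = e^(- theta x), the level that clock [v] must reach for its particle to stay below x
    after centring. Labels not alive get level 0, so the condition can range over all tuples. *)
Let c (v : n.-tuple nat) w : R :=
  if tval v \in gen n (om w) then
    k / D w * (expR (theta * pos v (om w) - n%:R * nv) * Num.max (Y v w) 0) else 0.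

Let s K : seq (n.-tuple nat) := pmap insub (words K).

Let sE K : [seq tval v | v <- s K] = [seq v <- words K | size v == n].
Proof.
rewrite /s (pmap_filter (@insubK _ _ _)).
by apply: eq_filter => v; rewrite isSome_insub.
Qed.

Let us K : uniq (s K).
Proof. by rewrite -(map_inj_uniq val_inj) sE filter_uniq // uniq_words. Qed.

Let mem_s (v : n.-tuple nat) K : (v \in s K) = (tval v \in words K).
Proof. by rewrite -(mem_map val_inj) sE mem_filter size_tuple eqxx. Qed.

Let c_ge0 v w : 0 <= c v w.
Proof.
rewrite /c; case: ifP => // _; rewrite mulr_ge0 ?mulr_ge0 ?expR_ge0 //.
by rewrite invr_ge0 D_ge0.
Qed.

Let Dset (v : n.-tuple nat) (i : (seq nat + n.-tuple nat + n.-tuple nat)%type) : Prop := i != inr v.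
Let G v := \bigcup_(i in [set i | Dset v i]) FF i.
Let H := \bigcup_(i in [set i : (seq nat + n.-tuple nat + n.-tuple nat)%type | if i is inl _ then true else false]) FF i.

(** The level contains D, which reads every generation; therefore [H] holds the displacements of all
    labels, together with the marks Y_v. *)
Let Hc v : sub_measurable H (c v).
Proof.
have [HZ HY _] := @sub_measurable_FF n [set i | if i is inl _ then true else false].
pose omH : g_sigma_algebraType H -> seq nat -> config R := om.
apply: (@measurable_gen_ite _ _ _ omH n _ v) => [u _|_]; first exact: HZ.
apply: measurable_funM.
  apply: measurable_funM; first exact: measurable_cst.
  (* D being nonnegative, its inverse is its power of exponent -1, a measurable function of the
     base. *)
  under eq_fun do rewrite -(powR_inv1 (D_ge0 _)).
  apply: (@measurableT_comp _ _ _ _ _ _ (@powR R ^~ (-1))); first exact: measurable_powR.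
  by apply: (@measurable_Wlim _ _ _ P Z theta _ _ omH) => u; exact: HZ.
apply: measurable_funM.
  apply: measurableT_comp => //; apply: measurable_funB; last exact: measurable_cst.
  apply: measurable_funM; first exact: measurable_cst.
  by apply: (measurable_pos (om := omH) (n := n)); [move=> u _; exact: HZ|rewrite size_tuple].
by apply: (measurableT_comp mmax); exact: HY.
Qed.

Let mc v : measurable_fun setT (c v).
Proof.
apply: measurable_g_sigma_weaken (Hc v).
by move=> B [i _ FB]; exact: FFm FB.
Qed.

Let mle v : measurable [set w | c v w <= E v w].
Proof.
have mE : measurable_fun setT (E v : T -> R) by exact: measurable_funPT.
have := measurable_fun_ler (mc v) mE measurableT (Y := [set true]) I.
by rewrite setTI; congr measurable; apply/seteqP; split => w.
Qed.

Let S K := [set w | all (fun v => c v w <= E (tval v) w) (s K)].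

Let mS K : measurable (S K).
Proof.
rewrite (_ : S K = \big[setI/setT]_(v <- s K) [set w | c v w <= E v w]).
  by apply: bigsetI_measurable => v _; exact: mle.
rewrite /S; elim: (s K) => [|v l IH] /=; first by rewrite big_nil; apply/seteqP; split.
rewrite big_cons -IH; apply/seteqP; split => w /=; first by move/andP.
by move=> [-> ->].
Qed.

Let SE : [set w | forall v : n.-tuple nat, (c v w <= E v w)%R] = \bigcap_K S K.
Proof.
apply/seteqP; split => w h; first by move=> K _; apply/allP => v _; exact: h.
move=> v; have /allP := h (choice.pickle (tval v)).+1 I; apply.
by rewrite mem_s mem_words.
Qed.

Lemma measurable_clocks : measurable [set w | forall v : n.-tuple nat, (c v w <= E v w)%R].
Proof. by rewrite SE; exact: bigcapT_measurable. Qed.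

Let clocks K : (P (S K) = \int[P]_w (expR (- \sum_(v <- s K) c v w))%:E)%E.
Proof.
have HG v : H `<=` <<s G v >>.
  by move=> B [[i|i] // _ FB]; apply: sub_sigma_algebra; exists (inl i).
have GE v u : u != v -> sub_measurable (G v) (E (tval u) : T -> R).
  move=> uv; have [_ _ h] := @sub_measurable_FF n [set i | Dset v i]; apply: h.
  by rewrite /Dset /=; apply: contra_neq uv => -[].
have := @integral_exponential_clocks _ T R P _ H G (fun v => E (tval v) : T -> R) c.
move=> /(_ _ _ GE _ _ _ c_ge0 Hc (s K) (fun=> 1) (us K)) cl.
transitivity (\int[P]_w (1 * (all (fun v => c v w <= E (tval v) w)%R (s K))%:R)%:E)%E.
  under eq_integral do rewrite mul1r.
  rewrite -[X in P X]setIT -integral_indic //; apply: eq_integral => w _; rewrite indicE; congr (_%:R%:E).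
  congr nat_of_bool; apply/idP/idP; first by rewrite inE.
  by move=> h; rewrite inE.
rewrite cl //.
- by apply: eq_integral => w _; rewrite mul1r.
- by move=> v B [i _ FB]; exact: FFm FB.
- move=> v B B' HB mB'; apply: (@generation_pair n (inr v)) => //.
  exact: g_sigma_preimage_mem.
- by move=> v; apply: Elaw; rewrite size_tuple.
- exact: measurable_cst.
Qed.

(** Finite lists of clocks are handled by [integral_exponential_clocks]; then continuity from above
    on the left, and dominated convergence with majorant 1 on the right, where the exponents are
    eventually equal to the full sum. *)
Lemma clocks_prob : (P [set w | forall v : n.-tuple nat, (c v w <= E v w)%R] =
  \int[P]_w (expR (- (k / D w * A n w)))%:E)%E.
Proof.
have c1 : (P \o S) K @[K --> \oo] --> P (\bigcap_K S K).
  apply: nonincreasing_cvg_mu => //.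
  - exact: le_lt_trans (probability_le1 _ (mS _)) (ltry 1).
  - exact: bigcapT_measurable.
  - apply/nonincreasing_seqP => K; rewrite subsetEset => w /= /allP h; apply/allP => v vs.
    by apply: h; move: vs; rewrite !mem_s !mem_words => /ltnW.
have c2 : (\int[P]_w (expR (- \sum_(v <- s K) c v w))%:E)%E @[K --> \oo] -->
    (\int[P]_w (expR (- (k / D w * A n w)))%:E)%E.
  have msum K : measurable_fun setT (fun w => expR (- \sum_(v <- s K) c v w)).
    apply: measurableT_comp => //; apply: measurableT_comp => //.
    by apply: measurable_sum => v.
  have mlim : measurable_fun setT (fun w => expR (- (k / D w * A n w))).
    apply: measurableT_comp => //; apply: measurableT_comp => //; apply: measurable_funM => //.
    apply: measurable_funM => //; under eq_fun do rewrite -(powR_inv1 (D_ge0 _)).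
    by apply: (@measurableT_comp _ _ _ _ _ _ (@powR R ^~ (-1))); first exact: measurable_powR.
  have [|||||_ _ c2] // := @dominated_convergence _ _ _ P setT measurableT
    (fun K w => (expR (- \sum_(v <- s K) c v w))%:E) (fun w => (expR (- (k / D w * A n w)))%:E)
    (cst 1%E).
  - by move=> K; apply/measurable_EFinP.
  - by apply/measurable_EFinP.
  - apply: aeW => w _; apply: cvg_near_cst.
    have [K0 _ HK] := sum_gen_near n (fun v => k / D w * (expR (theta * pos v (om w) - n%:R * nv)
       * Num.max (Y v w) 0)) (om w).
    exists K0 => // K /HK; rewrite -mulr_sumr -/(A n w) => <-.
    rewrite -(big_map (@tval n nat) xpredT (fun v => if v \in gen n (om w) then k / D w *
      (expR (theta * pos v (om w) - n%:R * nv) * Num.max (Y v w) 0) else 0)) sE big_filter.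
    rewrite big_mkcond; congr (expR (- _))%:E; apply: eq_bigr => v _.
    by case: eqP => // vn; case: ifP => // /size_gen.
  - exact: finite_measure_integrable_cst.
  - apply: aeW => w K _; rewrite lee_fin ger0_norm ?expR_ge0 // -[leRHS]expR0 ler_expR oppr_le0.
    by apply: sumr_ge0.
rewrite SE -(cvg_lim _ c1) // -(cvg_lim _ c2) //; congr (limn _).
by apply/funext => K /=; rewrite -clocks.
Qed.

End FixedGeneration.

(** * Distribution function of the centred maximum, and its limit *)

Let lpm n w : \bar R := last_progeny_modified_max Z theta Y E n w.

Let generationE n w : generation Z n w = gen n (om w).
Proof. by elim: n => //= n ->. Qed.

Let bigmaxe_leP (I : eqType) (r : seq I) (f : I -> \bar R) (y : \bar R) :
  ((\big[maxe/-oo]_(v <- r) f v <= y)%E) <-> (forall v, v \in r -> (f v <= y)%E).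
Proof.
split=> [h v vr|h]; first by apply: le_trans h; exact: le_bigmax_seq.
by rewrite big_seq; apply: bigmax_le => //; rewrite leNye.
Qed.

Let mark v w : \bar R :=
  ((pos v (om w))%:E + (theta^-1)%:E * (lne (Y v w)%:E - lne (E v w)%:E))%E.

(** The maximum is the eventually constant limit of maxima over [words K], labels not alive
    contributing the neutral value -oo. *)
Lemma measurable_lpm n : measurable_fun setT (lpm n).
Proof.
have mmark v : size v = n -> measurable_fun setT (mark v).
  move=> vn; apply: emeasurable_funD.
    by apply/measurable_EFinP; apply: (measurable_pos (n := n)); [move=> u _; exact: mZ|rewrite vn].
  apply: measurable_funeM; apply: emeasurable_funB.
    exact: (measurableT_comp (@measurable_lne_EFin R) (measurable_funPT (Y v))).
  exact: (measurableT_comp (@measurable_lne_EFin R) (measurable_funPT (E v))).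
apply: (@emeasurable_fun_cvg _ _ _ setT (fun K w => \big[maxe/-oo%E]_(v <- words K)
   (if v \in gen n (om w) then mark v w else -oo%E))) => [K|w _].
  elim: (words K) => [|v l IH]; first by under eq_fun do rewrite big_nil; exact: measurable_cst.
  under eq_fun do rewrite big_cons; apply: measurable_maxe => //.
  have [vn|vn] := eqVneq (size v) n.
    apply: measurable_fun_ifT => //; last exact: mmark.
    by apply: measurable_mem_gen => u _; exact: mZ.
  rewrite (_ : (fun w => _) = cst -oo%E) //.
  by apply/funext => w; case: ifP => // /size_gen /eqP; rewrite (negbTE vn).
apply: cvg_near_cst; exists (\max_(v <- gen n (om w)) (choice.pickle v).+1)%N => // K /= gK.
rewrite /lpm /last_progeny_modified_max generationE.
apply/eqP; rewrite eq_le; apply/andP; split; apply/bigmaxe_leP => v vg.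
  by case: ifP => [vg'|_]; [exact: (le_bigmax_seq -oo%E v xpredT (mark^~ w) vg' isT)|rewrite leNye].
have vK : v \in words K.
  by rewrite mem_words; apply: leq_trans gK; exact: leq_bigmax_seq.
have := le_bigmax_seq -oo%E v xpredT (fun v => if v \in gen n (om w) then mark v w else -oo%E) vK isT.
by rewrite /= vg.
Qed.

(** When D and all clocks are positive, which is almost sure, the centred maximum is at most x
    exactly when every clock reaches its level for k = e^(- theta x). *)
Lemma ecdf_lpm n x : (0 < n)%N ->
  ecdf P (fun w => lpm n w - (nv / theta * n%:R)%:E - (theta^-1)%:E * lne (D w)%:E)%E x =
  (\int[P]_w (expR (- (expR (- (theta * x)) / D w * A n w)))%:E)%E.
Proof.
move=> n0; rewrite -(clocks_prob n0 (expR_ge0 _)) /ecdf.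
apply: ae_eq_measure.
- rewrite -[X in measurable X]setTI; apply: emeasurable_fun_infty_c => //.
  apply: emeasurable_funB.
    by apply: emeasurable_funB; [exact: measurable_lpm|exact: measurable_cst].
  by apply: measurable_funeM; exact: (measurableT_comp (@measurable_lne_EFin R) mD).
- exact: measurable_clocks.
(* Enumerating labels turns positivity of all clocks into countably many almost sure events. Codes
   without a label yield the root, which the condition on the length excludes. *)
pose label K : seq nat := odflt [::] (pickle_inv K).
have E0 : {ae P, forall w K, (0 < size (label K))%N -> 0 < E (label K) w}.
  apply: ae_foralln => K; have [v0|v0] := boolP (0 < size (label K))%N.
    by apply: filterS (exponential_gt0_ae (Elaw v0)) => w.
  by apply: aeW => w v0'; case/negP: v0.
apply: filterS2 (Wlim_gt0_ae Zid HA1 HA2 HA3 theta_gt0 theta_lt indM) E0 => w D0 E0.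
have {}D0 : 0 < Wlim P Z theta (om w) := D0.
have {}E0 v : size v = n -> 0 < E v w.
  by move=> vn; have := E0 (choice.pickle v); rewrite /label pickleK_inv /= vn; exact.
have Dx v : expR (- (theta * (x + theta^-1 * ln (D w) + nv / theta * n%:R - pos v (om w)))) =
   expR (- (theta * x)) / D w * expR (theta * pos v (om w) - n%:R * nv).
  have -> : (D w)^-1 = expR (- ln (D w)) by rewrite expRN lnK.
  rewrite -!expRD; congr expR; field; exact: lt0r_neq0.
have equiv v : v \in gen n (om w) -> (mark v w <= (x + theta^-1 * ln (D w) + nv / theta * n%:R)%:E)%E =
  (expR (- (theta * x)) / D w * (expR (theta * pos v (om w) - n%:R * nv) * Num.max (Y v w) 0) <= E v w).
  move=> /size_gen vn; rewrite mulrA -Dx -lne_quotient_le //; last exact: E0.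
  by rewrite EFinB leeBrDl.
have HE : (lpm n w - (nv / theta * n%:R)%:E - (theta^-1)%:E * lne (Wlim P Z theta (om w))%:E <= x%:E)%E =
    (lpm n w <= (x + theta^-1 * ln (Wlim P Z theta (om w)) + nv / theta * n%:R)%:E)%E.
  by rewrite (lne_EFin D0) -EFinM !leeBlDr // -!EFinD.
apply: (@iff_trans _ (lpm n w <= (x + theta^-1 * ln (Wlim P Z theta (om w)) + nv / theta * n%:R)%:E)%E).
  by rewrite -HE.
rewrite /lpm /last_progeny_modified_max generationE.
split.
  move/bigmaxe_leP => h v; case: ifPn => vg; last by apply/ltW/E0; rewrite size_tuple.
  by rewrite -equiv //; exact: h.
move=> h; apply/bigmaxe_leP => v vg; rewrite -/(mark v w) equiv //.
have /eqP vn := size_gen vg.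
by have := h (Tuple vn); rewrite /= vg.
Qed.

Let integral_dist_le (f : T -> R) (L e : R) : measurable_fun setT f ->
  (forall w, 0 <= f w) -> 0 <= L -> (\int[P]_w `|f w - L|%:E <= e%:E)%E ->
  (\int[P]_w (f w)%:E)%E \is a fin_num /\ `|L - fine (\int[P]_w (f w)%:E)%E| <= e.
Proof.
move=> mf f0 L0 fL.
have md : measurable_fun setT (fun w => `|f w - L|%:E).
  by apply/measurable_EFinP; apply: measurableT_comp => //; exact: measurable_funB.
have IL : (\int[P]_w L%:E = L%:E)%E by rewrite integral_cst //= probability_setT mule1.
have I0 : (0 <= \int[P]_w (f w)%:E)%E by apply: integral_ge0 => w _; rewrite lee_fin.
have h1 : (\int[P]_w (f w)%:E <= L%:E + e%:E)%E.
  apply: (@le_trans _ _ (L%:E + \int[P]_w `|f w - L|%:E)%E); last by rewrite leeD2l.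
  rewrite -[in leRHS]IL -ge0_integralD //; apply: ge0_le_integral => //.
  - by move=> w _; rewrite lee_fin.
  - exact/measurable_EFinP.
  - exact: emeasurable_funD.
  - by move=> w _; rewrite -EFinD lee_fin; have := ler_norm (f w - L); lra.
have h2 : (L%:E <= \int[P]_w (f w)%:E + e%:E)%E.
  apply: (@le_trans _ _ (\int[P]_w (f w)%:E + \int[P]_w `|f w - L|%:E)%E); last by rewrite leeD2l.
  rewrite -[leLHS]IL -ge0_integralD //; last 2 first.
  - by move=> w _; rewrite lee_fin.
  - exact/measurable_EFinP.
  apply: ge0_le_integral => //.
  - apply: emeasurable_funD => //; exact/measurable_EFinP.
  - move=> w _; rewrite -EFinD lee_fin; have := ler_norm (L - f w); rewrite distrC; lra.
have fin : (\int[P]_w (f w)%:E)%E \is a fin_num.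
  by rewrite ge0_fin_numE // (le_lt_trans h1) // -EFinD ltry.
split=> //; move: h1 h2; rewrite -(fineK fin) -!EFinD !lee_fin /= ler_distl; lra.
Qed.

Let mDlt (b : R) : measurable [set w | D w < b].
Proof.
have := mD measurableT (measurable_itv `]-oo, b[); rewrite setTI.
by congr measurable; apply/seteqP; split => w; rewrite /= in_itv.
Qed.

(** The events {D < 1/(j+1)} decrease to a null set because D > 0 almost surely. *)
Let D_small (e : R) : 0 < e -> exists2 dl : R, 0 < dl & (P [set w | (D w < dl)%R] <= e%:E)%E.
Proof.
move=> e0; pose F j := [set w | D w < (j.+1%:R)^-1].
have mF j : measurable (F j) by exact: mDlt.
have : (P \o F) j @[j --> \oo] --> P (\bigcap_j F j).
  apply: nonincreasing_cvg_mu => //.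
  - exact: le_lt_trans (probability_le1 _ (mF _)) (ltry 1).
  - exact: bigcapT_measurable.
  - apply/nonincreasing_seqP => j; rewrite subsetEset => w /= h; apply: lt_le_trans h _.
    by rewrite lef_pV2 ?posrE // ler_nat.
have -> : P (\bigcap_j F j) = P set0.
  apply: ae_eq_measure => //; first exact: bigcapT_measurable.
  apply: filterS (Wlim_gt0_ae Zid HA1 HA2 HA3 theta_gt0 theta_lt indM) => w D0; split => // h.
  have := h (Num.bound (D w)^-1) I; rewrite /F /= => h'.
  have : (D w)^-1 < (Num.bound (D w)^-1).+1%:R.
    apply: lt_trans (archi_boundP _) _; last by rewrite ltr_nat.
    by rewrite invr_ge0 ltW.
  rewrite -[X in _ < X]invrK ltf_pV2 ?posrE ?invr_gt0 // => h''.
  by have := lt_trans h' h''; rewrite ltxx.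
rewrite measure0 => /fine_cvgP[_ /cvgrPdist_le /(_ _ e0) [j _ /(_ j (leqnn _)) /= h]].
exists (j.+1%:R)^-1; first by rewrite invr_gt0.
rewrite -/(F j) -[leLHS]fineK ?fin_num_measure // lee_fin.
by move: h; rewrite sub0r normrN; exact: le_trans (ler_norm _).
Qed.

(** On {D < dl} the integrand is within 1 of its limit and the probability is small. Elsewhere k/D
    <= k/dl, and A_n - mean D is split into A_n - mean W_n and mean (W_n - D), both small in L1. *)
Lemma ecdf_lpm_cvg x :
  ecdf P (fun w => lpm n w - (nv / theta * n%:R)%:E - (theta^-1)%:E * lne (D w)%:E)%E x
    @[n --> \oo] --> (expR (- (expR (- (theta * x)) * mean)))%:E.
Proof.
set k := expR (- (theta * x)); have k0 : 0 < k by exact: expR_gt0.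
pose f n w := expR (- (k / D w * A n w)).
have mf n : measurable_fun setT (f n).
  apply: measurableT_comp => //; apply: measurableT_comp => //; apply: measurable_funM => //.
  apply: measurable_funM => //; under eq_fun do rewrite -(powR_inv1 (D_ge0 _)).
  by apply: (@measurableT_comp _ _ _ _ _ _ (@powR R ^~ (-1))); first exact: measurable_powR.
have L1 (e : R) : 0 < e -> \forall n \near \oo,
    (\int[P]_w `|f n w - expR (- (k * mean))|%:E <= e%:E)%E.
  move=> e0; have e20 : 0 < e / 2 by rewrite divr_gt0.
  have [dl dl0 Pdl] := D_small e20.
  have mp : 0 < mean + 1 by rewrite ltr_wpDl.
  (* Chosen so that (k/dl) (1 + mean) eps = e/2; the other half of e pays for {D < dl}. *)
  pose eps := e / 2 * dl / (k * (mean + 1)).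
  have eps0 : 0 < eps by rewrite divr_gt0 ?mulr_gt0.
  have mB : measurable [set w | D w < dl] by exact: mDlt.
  apply: filterS2 (weighted_marks_L1 eps0)
    (Wlim_L1 Zid HA1 HA2 HA3 theta_gt0 theta_lt indM eps0) => n h1 h2.
  pose g1 w := `|A n w - mean * Wt P Z theta n (om w)|.
  pose g2 w := `|Wt P Z theta n (om w) - D w|.
  have mW : measurable_fun setT (fun w => Wt P Z theta n (om w)).
    by apply: measurable_Wt_comp => u; exact: mZ.
  have g10 w : 0 <= g1 w by exact: normr_ge0.
  have g20 w : 0 <= g2 w by exact: normr_ge0.
  have mg1 : measurable_fun setT g1.
    by apply: measurableT_comp => //; apply: measurable_funB => //; exact: measurable_funM.
  have mg2 : measurable_fun setT g2 by apply: measurableT_comp => //; exact: measurable_funB.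
  have kw : 0 <= k by exact: ltW.
  have dlw : 0 <= dl^-1 by rewrite invr_ge0 ltW.
  have kd0 : 0 <= k / dl by rewrite mulr_ge0.
  apply: (@le_trans _ _ (\int[P]_w ((k / dl)%:E * (g1 w)%:E +
     ((k / dl * mean)%:E * (g2 w)%:E + (\1_[set w | (D w < dl)%R] w)%:E)))%E).
    apply: ge0_le_integral => //.
    - apply/measurable_EFinP; apply: measurableT_comp => //; exact: measurable_funB.
    - apply: emeasurable_funD; first by apply/measurable_EFinP; exact: measurable_funM.
      apply: emeasurable_funD; first by apply/measurable_EFinP; exact: measurable_funM.
      by apply/measurable_EFinP; exact: measurable_indic.
    move=> w _; rewrite -!EFinM -!EFinD lee_fin.
    have a0 : 0 <= k / D w * A n w.
      by rewrite mulr_ge0 // mulr_ge0 ?invr_ge0 // ltW.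
    have b0 : 0 <= k * mean by rewrite mulr_ge0 // ltW.
    have [d1 d2] := expRN_dist_le a0 b0.
    have [Ddl|dlD] := ltP (D w) dl.
      rewrite indicE mem_set //; apply: le_trans d2 _; rewrite addrA lerDr.
      by apply: addr_ge0; rewrite !mulr_ge0.
    rewrite indicE memNset; last by move=> h; move: dlD; rewrite leNgt h.
    apply: le_trans d1 _; rewrite addr0.
    have D0 : 0 < D w by apply: lt_le_trans dlD.
    have -> : k / D w * A n w - k * mean = k / D w * (A n w - mean * D w).
      by field; exact: lt0r_neq0.
    rewrite normrM ger0_norm; last by rewrite divr_ge0 // ltW.
    apply: (@le_trans _ _ (k / dl * `|A n w - mean * D w|)).
      by rewrite ler_wpM2r // ler_wpM2l // lef_pV2 ?posrE.
    rewrite -[X in _ <= _ + X]mulrA -mulrDr ler_wpM2l // /g1 /g2.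
    have -> : A n w - mean * D w = (A n w - mean * Wt P Z theta n (om w)) +
       mean * (Wt P Z theta n (om w) - D w) by ring.
    by apply: le_trans (ler_normD _ _) _; rewrite lerD2l normrM ger0_norm.
  rewrite ge0_integralD //; last 4 first.
  - by move=> w _; rewrite -EFinM lee_fin mulr_ge0.
  - by apply/measurable_EFinP; exact: measurable_funM.
  - by move=> w _; rewrite -EFinM -EFinD lee_fin addr_ge0 // !mulr_ge0.
  - apply: emeasurable_funD; first by apply/measurable_EFinP; exact: measurable_funM.
    by apply/measurable_EFinP; exact: measurable_indic.
  rewrite ge0_integralD //; last 3 first.
  - by move=> w _; rewrite -EFinM lee_fin !mulr_ge0.
  - by apply/measurable_EFinP; exact: measurable_funM.
  - by apply/measurable_EFinP; exact: measurable_indic.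
  rewrite ge0_integralZl; [|exact: measurableT| | |]; last 3 first.
  - exact/measurable_EFinP.
  - by move=> w _; rewrite lee_fin.
  - by rewrite lee_fin kd0.
  rewrite ge0_integralZl; [|exact: measurableT| | |]; last 3 first.
  - exact/measurable_EFinP.
  - by move=> w _; rewrite lee_fin.
  - by rewrite lee_fin mulr_ge0.
  rewrite integral_indic // setIT.
  apply: (@le_trans _ _ ((k / dl)%:E * eps%:E + ((k / dl * mean)%:E * eps%:E + (e / 2)%:E))%E).
    by apply: leeD; [|apply: leeD => //]; apply: lee_wpmul2l => //; rewrite lee_fin ?mulr_ge0.
  rewrite -!EFinM -!EFinD lee_fin /eps le_eqVlt; apply/orP; left; apply/eqP.
  by field; rewrite !gt_eqF.
apply: cvg_trans (_ : (\int[P]_w (f n w)%:E)%E @[n --> \oo] --> (expR (- (k * mean)))%:E).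
  apply: near_eq_cvg; near=> n; rewrite ecdf_lpm //; near: n; exact: nbhs_infty_gt.
apply/fine_cvgP; split.
  apply: filterS (L1 1 ltr01) => n h.
  by have [] := integral_dist_le (mf n) (fun w => expR_ge0 _) (expR_ge0 _) h.
apply/cvgrPdist_le => e e0; apply: filterS (L1 e e0) => n h.
by have [] := integral_dist_le (mf n) (fun w => expR_ge0 _) (expR_ge0 _) h.
Unshelve. all: by end_near. Qed.

Let mean_fin : (\int[mu]_y y%:E = mean%:E)%E.
Proof. by rewrite -integral_max meanE.
Qed.

(** The comparison of [lne_quotient_le] again, now with one clock and the constant mark [mean]. *)
Lemma ecdf_limit d' (T' : measurableType d') (Q : probability T' R) (E0 : {RV Q >-> R}) x :
  has_law Q E0 (exponential_prob 1) ->
  ecdf Q (fun w => ((theta^-1)%:E * (lne (\int[mu]_y y%:E) - lne (E0 w)%:E))%E) x =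
  (expR (- (expR (- (theta * x)) * mean)))%:E.
Proof.
move=> E0law; rewrite mean_fin -exponential_prob_ge; last by rewrite mulr_ge0 ?expR_ge0.
have mge (b : R) : measurable [set y : R | b <= y].
  rewrite (_ : [set y | _] = `[b, +oo[%classic) //.
  by apply/seteqP; split => y /=; rewrite in_itv /= andbT.
rewrite -E0law //; apply: ae_eq_measure.
- rewrite -[X in measurable X]setTI; apply: emeasurable_fun_infty_c => //.
  apply: measurable_funeM; apply: emeasurable_funB => //.
  exact: (measurableT_comp (@measurable_lne_EFin R) (measurable_funPT E0)).
- have := measurable_funPT E0 measurableT _ (mge (expR (- (theta * x)) * mean)).
  by rewrite setTI.
apply: filterS (exponential_gt0_ae E0law) => w E0w.
apply: (@iff_trans _ ((theta^-1)%:E * (lne mean%:E - lne (E0 w)%:E) <= x%:E)%E); first by [].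
by rewrite lne_quotient_le // max_l.
Qed.

(** * Return to the additive martingale and its recursive equation *)

Lemma additive_martingaleE n w : additive_martingale Z P theta n w = Wt P Z theta n (om w).
Proof.
rewrite /additive_martingale generationE /Wt mulr_sumr; apply: eq_bigr => v _.
have [va va0 fin] := HA1.
rewrite expRD mulrC -/(pos v (om w)); congr (_ * _).
rewrite expRN expRM_natl /nu lnK // posrE; apply: mom_gt0 => //.
by apply: fin; apply: lt_trans theta_gt0; rewrite oppr_lt0.
Qed.

Lemma martingale_limitE : martingale_limit Z P theta = D.
Proof.
apply/funext => w; rewrite /martingale_limit /Wlim; congr (limn _).
by apply/funext => n; exact: additive_martingaleE.
Qed.

Lemma additive_martingale_cvg :
  {ae P, forall w, additive_martingale Z P theta n w @[n --> \oo] --> D w}.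
Proof.
apply: filterS (Wlim_cvg_ae Zid HA1 HA2 HA3 theta_gt0 theta_lt indM) => w.
suff -> : (fun n => additive_martingale Z P theta n w) = (fun n => Wt P Z theta n (om w)) by [].
by apply/funext => n; exact: additive_martingaleE.
Qed.

(** The copies are the limits in the subtrees of the first generation, on the same space, so the
    equation even holds almost surely. *)
Lemma Wlim_solves_RDE : solves_linear_RDE P (Z [::]) theta D.
Proof.
pose Ds j : {RV P >-> R} := HB.pack (Wlim_sub P Z theta j)
  (isMeasurableFun.Build _ _ _ _ _ (@measurable_Wlim_sub _ T R P Z theta j)).
exists Ds; split.
- by move=> j B mB; exact: (Wlim_sub_law Zid theta indM).
- by apply: mutually_independent_sub (@Wlim_sub_independent _ T R P Z theta indM) => -[j|].
move=> B mB; apply: ae_eq_measure.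
- by rewrite -[X in measurable X]setTI; exact: mD.
- rewrite -[X in measurable X]setTI.
  (* The sum of random length is rewritten over generation 1, where labels are single letters
     recovered by [head], so that [measurable_sum_gen] applies. *)
  rewrite (_ : (fun w => _) = fun w => \sum_(v <- gen 1 (om w))
     expR (theta * nth 0 (Z [::] w : seq R) (head 0%N v) - nv) * Ds (head 0%N v) w); last first.
    by apply/funext => w; rewrite sum_genS /= big_seq1.
  apply: measurable_sum_gen => // v _; apply: measurable_funM; last exact: measurable_funPT.
  apply: measurableT_comp => //; apply: measurable_funB => //; apply: measurable_funM => //.
  exact: (measurableT_comp (measurable_config_nth (head 0%N v)) (mZ [::])).
by apply: filterS (Wlim_RDE_ae Zid HA1 HA2 HA3 theta_gt0 theta_lt indM) => w /= <-.
Qed.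

Lemma expectation_Wlim : ('E_P[D] = 1)%E.
Proof. by rewrite unlock; exact: (integral_Wlim Zid HA1 HA2 HA3 theta_gt0 theta_lt indM). Qed.

End LastProgeny.

Theorem theorem2p5 (R : realType)
  (d : measure_display) (T : measurableType d) (P : probability T R)
  (Z : seq nat -> {mfun T >-> config R})
  (Zid : forall u, same_law P (Z u) (Z [::]))
  (HA1 : assumption_A1 P (Z [::]))
  (HA2 : assumption_A2 P (Z [::]))
  (HA3 : assumption_A3 P (Z [::]))
  (theta : R) (theta_gt0 : 0 < theta)
  (theta_lt : (theta%:E < theta0 P (Z [::]))%E)
  (mu : probability R R)
  (mu_supp : mu [set y | 0 <= y] = 1%E)
  (mu_neq : ~ (forall B, measurable B -> mu B = \d_(0 : R) B))
  (mu_mean : (\int[mu]_y y%:E < +oo)%E)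
  (Y E : seq nat -> {RV P >-> R})
  (Ylaw : forall v, (0 < size v)%N -> has_law P (Y v) mu)
  (Elaw : forall v, (0 < size v)%N -> has_law P (E v) (exponential_prob 1))
  (indep : forall n, (0 < n)%N -> independent_generation Z P Y E n)
  (d' : measure_display) (T' : measurableType d') (Q : probability T' R)
  (E0 : {RV Q >-> R})
  (E0law : has_law Q E0 (exponential_prob 1)) :
  let D := martingale_limit Z P theta in
  let H w : \bar R := ((theta^-1)%:E * lne (D w)%:E)%E in
  [/\ measurable_fun [set: T] D /\
      {ae P, forall w, additive_martingale Z P theta n w @[n --> \oo] --> D w},
      ('E_P[D] = 1)%E,
      solves_linear_RDE P (Z [::]) theta D
    & cvg_in_distribution P
        (fun n w => (last_progeny_modified_max Z theta Y E n w
                     - (nu P (Z [::]) theta / theta * n%:R)%:E - H w)%E)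
        Q
        (fun w => ((theta^-1)%:E *
                   (lne (\int[mu]_y y%:E) - lne (E0 w)%:E))%E)].
Proof.
move=> D H.
have DE : D = fun w => Wlim P Z theta (fun u => Z u w).
  exact: (martingale_limitE HA1 HA2 theta_gt0).
split.
- rewrite DE; split; first by apply: measurable_Wlim => u; exact: measurable_funPT.
  exact: (additive_martingale_cvg Zid HA1 HA2 HA3 theta_gt0 theta_lt indep).
- by rewrite DE; exact: (expectation_Wlim Zid HA1 HA2 HA3 theta_gt0 theta_lt indep).
- by rewrite DE; exact: (Wlim_solves_RDE Zid HA1 HA2 HA3 theta_gt0 theta_lt indep).
move=> x _; rewrite (ecdf_limit theta_gt0 mu_supp mu_mean x E0law) /H DE.
exact: (ecdf_lpm_cvg Zid HA1 HA2 HA3 theta_gt0 theta_lt mu_supp mu_mean Ylaw Elaw indep).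
Qed.
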